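(* Let $p\ge5$ be a prime, suppose $(\mathbb{Z}/p\mathbb{Z})^\times/\{\pm1\}=\langle\alpha\rangle$, let $a_0$ be a positive even integer and let $a_1,\ldots,a_{(p-1)/2}\in\mathbb{Z}$. Then $f_{a_0,\ldots,a_{(p-1)/2}}(\tau)$ lies in $M_{a_0/2}(\Gamma_1(p))$ if and only if all of the following hold: $$0\le a_0+2\sum_{i=1}^{(p-1)/2}a_i\equiv0\pmod{24},$$ $$\frac p2\sum_{i=1}^{(p-1)/2}\Bigl\langle\frac ip\Bigr\rangle\Bigl(1-\Bigl\langle\frac ip\Bigr\rangle\Bigr)a_i\in\mathbb{Z},$$ $$\frac p{24}\Bigl(a_0+2\sum_{i=1}^{(p-1)/2}a_i\Bigr)-\frac p2\sum_{i=1}^{(p-1)/2}\Bigl\langle\frac{i\alpha^m}p\Bigr\rangle\Bigl(1-\Bigl\langle\frac{i\alpha^m}p\Bigr\rangle\Bigr)a_i\ge0\quad\text{for all }0\le m\le\frac{p-3}2.$$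
   Context: Let $q=e^{2\pi i\tau}$, $(a;q)_\infty=\prod_{n\ge 1}(1-aq^{n-1})$, $(a,b;q)_\infty=(a;q)_\infty(b;q)_\infty$, $\langle r\rangle=r-\lfloor r\rfloor$. Put $$\ell(a_0,\ldots,a_{(p-1)/2})=\frac{p}{24}\Bigl(a_0+2\sum_{i=1}^{(p-1)/2}a_i\Bigr)-\frac p2\sum_{i=1}^{(p-1)/2}\Bigl\langle\frac ip\Bigr\rangle\Bigl(1-\Bigl\langle\frac ip\Bigr\rangle\Bigr)a_i,\qquad f_{a_0,\ldots,a_{(p-1)/2}}(\tau)=q^{\ell}(q^p;q^p)_\infty^{a_0}\prod_{i=1}^{(p-1)/2}(q^i,q^{p-i};q^p)_\infty^{a_i},$$ where $q^\ell=e^{2\pi i\ell\tau}$. $M_k(\Gamma)$ is the space of holomorphic modular forms of weight $k$ for $\Gamma$. *)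

(* Defs.v *)
From HB Require Import structures.
From mathcomp Require Import all_boot all_order all_algebra all_fingroup.
From mathcomp Require Import complex.
From mathcomp Require Import all_classical all_reals all_analysis.

Set Implicit Arguments.
Unset Strict Implicit.
Unset Printing Implicit Defensive.

Import Order.TTheory GRing.Theory Num.Theory numFieldNormedType.Exports.

Local Open Scope classical_set_scope.
Local Open Scope ring_scope.

(* R[i] packed as a numClosedFieldType, so that it inherits the topology and
   the normed module structure (over itself) of a numFieldType; [derivable] at
   direction 1 is then complex differentiability. *)
Definition Cplx (R : realType) : numClosedFieldType := R[i].

Definition cexp (R : realType) (z : Cplx R) : Cplx R :=
  let x := complex.Re z in let y := complex.Im z in
  (expR x * cos y +i* (expR x * sin y))%C.

Definition twopii (R : realType) : Cplx R := (0 +i* (pi *+ 2))%C.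

Definition upper_half_plane (R : realType) : set (Cplx R) :=
  [set tau | 0 < complex.Im tau].

Definition unit_disc (R : realType) : set (Cplx R) := [set z | `|z| < 1].

(* Only used for open D. *)
Definition holomorphic_on (R : realType) (D : set (Cplx R))
    (f : Cplx R -> Cplx R) : Prop :=
  forall z, D z -> derivable f z 1.

Definition SL2Z : set 'M[int]_2 := [set g | \det g = 1].

Definition Gamma1 (N : nat) : set 'M[int]_2 :=
  [set g | [/\ SL2Z g, (g 0%R 0%R = 1 %[mod N])%Z, (g 1%R 1%R = 1 %[mod N])%Z
             & (g 1%R 0%R = 0 %[mod N])%Z]].

(* The weight k operator f |_k g, for g of determinant 1. *)
Definition slash (R : realType) (k : int) (g : 'M[int]_2)
    (f : Cplx R -> Cplx R) (tau : Cplx R) : Cplx R :=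
  let den := (g 1 0)%:~R * tau + (g 1 1)%:~R in
  den ^ (- k) * f (((g 0 0)%:~R * tau + (g 0 1)%:~R) / den).

(* In terms of the local parameter e^{2 pi i tau / h}, f extends to a
   holomorphic function on the whole unit disc, including the centre. *)
Definition holomorphic_at_infty (R : realType) (f : Cplx R -> Cplx R) : Prop :=
  exists2 h : nat, (0 < h)%N &
  exists2 F : Cplx R -> Cplx R, holomorphic_on (@unit_disc R) F &
  forall tau, @upper_half_plane R tau ->
    f tau = F (cexp (twopii R * tau / h%:R)).

(* M_k(Gamma).  Functions on the upper half plane are represented by total
   functions; their values elsewhere play no role. *)
Definition modular_forms (R : realType) (k : int) (Gamma : set 'M[int]_2) :
    set (Cplx R -> Cplx R) :=
  [set f | [/\ holomorphic_on (@upper_half_plane R) f,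
    forall g, Gamma g ->
      forall tau, @upper_half_plane R tau -> slash k g f tau = f tau
  & forall g, SL2Z g -> holomorphic_at_infty (slash k g f)]].

(* (a; q)_oo *)
Definition qpoch (R : realType) (a q : Cplx R) : Cplx R :=
  lim ((fun N : nat => \prod_(0 <= n < N) (1 - a * q ^+ n)) @ \oo).

Definition frac_part (x : rat) : rat := x - (Num.floor x)%:~R.

(* The exponents a_0, ..., a_{(p-1)/2} are given by a : nat -> int; its values
   at larger indices are never used. *)

Definition exponent_sum (p : nat) (a : nat -> int) : int :=
  a 0%N + 2 * \sum_(1 <= i < (p.-1)./2.+1) a i.

(* p/2 * sum_i <i n / p> (1 - <i n / p>) a_i *)
Definition frac_sum (p : nat) (a : nat -> int) (n : int) : rat :=
  p%:R / 2 * \sum_(1 <= i < (p.-1)./2.+1)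
    (let x := frac_part (i%:R * n%:~R / p%:R) in x * (1 - x) * (a i)%:~R).

Definition ell (p : nat) (a : nat -> int) : rat :=
  p%:R / 24 * (exponent_sum p a)%:~R - frac_sum p a 1.

Definition eta_product (R : realType) (p : nat) (a : nat -> int)
    (tau : Cplx R) : Cplx R :=
  let q := cexp (twopii R * tau) in
  cexp (twopii R * ratr (ell p a) * tau) *
  qpoch (q ^+ p) (q ^+ p) ^ (a 0%N) *
  \prod_(1 <= i < (p.-1)./2.+1)
    (qpoch (q ^+ i) (q ^+ p) * qpoch (q ^+ (p - i)) (q ^+ p)) ^ (a i).

(* (Z/pZ)^* / {1, -1} is generated by the class of the integer alpha.
   The subgroup {1, -1} is written <[-1]>. *)
Definition generates_units_mod_sign (p : nat) (alpha : int) : Prop :=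
  let sgn := <[FinRing.unit 'Z_p (unitrN1 'Z_p)]>%g in
  exists2 u : {unit 'Z_p}, val u = alpha%:~R &
    (units_Zp p / sgn)%g = <[coset sgn u]>%g.

(* Main.v *)
(* Let K(z; t) be theta_1(z; t) / eta(t)^3 up to a constant. Euler's product for
   the sine turns the q-product of K into the lattice product z prod' (1 - z^2/w^2)
   over w = m t + n, with n summed first; for -1/t the same product appears with m
   summed first. If z^2 + u^2 = v^2, the quotient K(z) K(u) / K(v) is an absolutely
   convergent lattice product, hence does not depend on the order. For v = u + k t
   the quasi-periodicity of K then gives
     t K(z/t; -1/t) = e^{pi i z^2 / t} K(z; t).
   Together with t |-> t + 1 this gives the action of SL_2(Z) on K, and, by
   taking products over 2- and 3-torsion points, on eta^2.

   The function of the theorem is, up to sign, eta(p t)^T prod_i kap_i(t)^{a_i}, where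
   T = a_0 + 2 sum_i a_i and kap_i(t) = e^{pi i i^2 t / p} K(i t; p t). If p divides c,
   the matrix (a b; c d) maps kap_i to a constant times kap_{ia}, while t |-> -1/t maps
   kap_i(t) to a constant times K(-i/p; t/p). This yields the orders at the cusps
   over infinity (third condition) and over 0 (T >= 0). The constants for Gamma_1(p)
   are trivial when 24 | T and the second condition holds; conversely, these two
   follow from invariance under t |-> t + 1 and under the conjugate of
   t |-> t + p by t |-> -1/t. *)

Require Import Defs.
From mathcomp Require Import all_boot all_order all_algebra all_fingroup.
From mathcomp Require Import complex cyclic ring lra zify.
From mathcomp Require Import all_classical all_reals all_analysis.
Set Implicit Arguments.
Unset Strict Implicit.
Unset Printing Implicit Defensive.
Import Order.TTheory GRing.Theory Num.Theory numFieldNormedType.Exports.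
Local Open Scope classical_set_scope.
Local Open Scope ring_scope.

(** The product z prod' (1 - z^2/w^2) converges only conditionally: its logarithm contains - z^2
    sum' w^-2, whose value depends on whether rows or columns are summed first, and the factor e^{pi
    i z^2/t} measures exactly this discrepancy. A relation between three values of K becomes a
    statement about one value by solving v = u + k t together with v^2 - u^2 = z^2, which gives u =
    z^2/(2 k t) - k t/2; the integer k remains free to keep v off the lattice. The square of eta is
    used because a_0, hence T, is even: its weight is 1, so no square root of t occurs. The
    2-torsion points determine its cube and the 3-torsion points its fourth power; as 3 and 4 differ
    by 1, the quotient is eta^2 itself, without an undetermined root of unity. The exponents a_i may
    be negative, so every factor must be shown to have no zero, both on the upper half plane and at
    the centre of the disc. As p is prime, only two cases occur for a matrix (a b; c d): either p
    divides c, or c is invertible modulo p and the matrix is one of the first kind times S and a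
    translation. *)

(** * Modulus and limits of complex sequences *)

Section Norm.
Context {R : realType}.
Implicit Types (x y z l : Cplx R) (u : nat -> Cplx R).

(** The norm of [Cplx R] takes values in [Cplx R], where the order is partial; a real-valued modulus
    makes the estimates accessible to real arithmetic. *)
Definition cabs z : R := Normc.normc z.

Lemma normr_cabs z : `|z| = (cabs z)%:C%C.
Proof. by case: z. Qed.

Lemma cabsE z : cabs z = complex.Re `|z|.
Proof. by rewrite normr_cabs. Qed.

Lemma cabs_ge0 z : 0 <= cabs z.
Proof. by case: z => a b; exact: sqrtr_ge0. Qed.

Lemma cabs0 : cabs 0 = 0.
Proof. by rewrite cabsE normr0. Qed.

Lemma cabs1 : cabs 1 = 1.
Proof. by rewrite cabsE normr1. Qed.

Lemma cabs_eq0 z : (cabs z == 0) = (z == 0).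
Proof.
by apply/eqP/eqP => [/Normc.eq0_normc //|->]; rewrite cabs0.
Qed.

Lemma cabs_gt0 z : (0 < cabs z) = (z != 0).
Proof. by rewrite lt_def cabs_ge0 andbT cabs_eq0. Qed.

Lemma cabsM x y : cabs (x * y) = cabs x * cabs y.
Proof. exact: Normc.normcM. Qed.

Lemma cabsN x : cabs (- x) = cabs x.
Proof. by rewrite !cabsE normrN. Qed.

Lemma cabsD x y : cabs (x + y) <= cabs x + cabs y.
Proof. exact: le_normcD. Qed.

Lemma cabsC x y : cabs (x - y) = cabs (y - x).
Proof. by rewrite -cabsN opprB. Qed.

Lemma cabsB x y : cabs (x - y) <= cabs x + cabs y.
Proof. by rewrite -(cabsN y); exact: cabsD. Qed.

Lemma cabs_sub x y : cabs x - cabs y <= cabs (x - y).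
Proof. by rewrite lerBlDr; apply: le_trans (cabsD _ _); rewrite subrK. Qed.

Lemma cabsV x : cabs x^-1 = (cabs x)^-1.
Proof. exact: Normc.normcV. Qed.

Lemma cabsX x n : cabs (x ^+ n) = cabs x ^+ n.
Proof. by elim: n => [|n IH]; rewrite ?expr0 ?cabs1 // !exprS cabsM IH. Qed.

Lemma cabs_real (a : R) : cabs a%:C%C = `|a|.
Proof. by rewrite /cabs /= expr0n addr0 sqrtr_sqr. Qed.

Lemma cabs_nat n : cabs n%:R = n%:R.
Proof.
have -> : (n%:R : Cplx R) = (n%:R : R)%:C%C.
  exact/esym/(rmorph_nat (real_complex R)).
by rewrite cabs_real normr_nat.
Qed.

Lemma cabs_int (n : int) : cabs n%:~R = `|n|%:~R.
Proof.
have -> : (n%:~R : Cplx R) = (n%:~R : R)%:C%C.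
  exact/esym/(rmorph_int (real_complex R)).
by rewrite cabs_real intr_norm.
Qed.

Lemma Re_le_cabs z : `|complex.Re z| <= cabs z.
Proof.
by have := normc_ge_Re z; rewrite normr_cabs lecR.
Qed.

Lemma Im_le_cabs z : `|complex.Im z| <= cabs z.
Proof.
case: z => a b /=; rewrite -sqrtr_sqr ler_wsqrtr // lerDr sqr_ge0 //.
Qed.

Lemma cabs_le_ReIm z : cabs z <= `|complex.Re z| + `|complex.Im z|.
Proof.
case: z => a b /=; rewrite -[leRHS]ger0_norm ?addr_ge0 // -[leRHS]sqrtr_sqr.
apply: ler_wsqrtr; rewrite -(real_normK (num_real a)) -(real_normK (num_real b)).
by rewrite sqrrD lerD2r lerDl mulrn_wge0 // mulr_ge0.
Qed.

Lemma gt0_complexE (e : Cplx R) : 0 < e -> exists2 d : R, 0 < d & e = d%:C%C.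
Proof.
case: e => a b; rewrite ltcE /= => /andP[/eqP -> a0]; by exists a.
Qed.

Lemma normr_lt_cabs z (d : R) : (`|z| < d%:C%C) = (cabs z < d).
Proof. by rewrite normr_cabs ltcR. Qed.

Lemma cvgCP u l : u @ \oo --> l <->
  forall e : R, 0 < e -> exists N : nat, forall n, (N <= n)%N -> cabs (u n - l) < e.
Proof.
split=> [ul e e0|H].
  move/cvgrPdist_lt: ul => /(_ e%:C%C).
  rewrite ltcR => /(_ e0) [N _ HN]; exists N => n Nn.
  by rewrite cabsC -normr_lt_cabs; exact: HN.
apply/cvgrPdist_lt => e /gt0_complexE[d d0 ->].
have [N HN] := H d d0; exists N => // n Nn /=.
by rewrite normr_lt_cabs cabsC; exact: HN.
Qed.

Lemma cvgC_unique u l1 l2 : u @ \oo --> l1 -> u @ \oo --> l2 -> l1 = l2.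
Proof. by move=> h1 h2; exact: (cvg_unique _ h1 h2). Qed.

Lemma cvgC_ext u (v : nat -> Cplx R) l : (forall n, u n = v n) -> u @ \oo --> l -> v @ \oo --> l.
Proof. by move=> /funext ->. Qed.

Lemma cvgC_cst l : (fun _ : nat => l) @ \oo --> l.
Proof. exact: cvg_cst. Qed.

Lemma cvgCD u (v : nat -> Cplx R) l m : u @ \oo --> l -> v @ \oo --> m ->
  (fun n => u n + v n) @ \oo --> l + m.
Proof. by move=> ul vm; exact: (cvgD ul vm). Qed.

Lemma cvgCB u (v : nat -> Cplx R) l m : u @ \oo --> l -> v @ \oo --> m ->
  (fun n => u n - v n) @ \oo --> l - m.
Proof. by move=> ul vm; exact: (cvgB ul vm). Qed.

Lemma cvgCM u (v : nat -> Cplx R) l m : u @ \oo --> l -> v @ \oo --> m ->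
  (fun n => u n * v n) @ \oo --> l * m.
Proof. by move=> ul vm; exact: (cvgM ul vm). Qed.

Lemma cvgCV u l : l != 0 -> u @ \oo --> l -> (fun n => (u n)^-1) @ \oo --> l^-1.
Proof. by move=> l0 ul; exact: (cvgV l0 ul). Qed.

Lemma cvgC_eventually_ext N u (v : nat -> Cplx R) l :
  (forall n, (N <= n)%N -> u n = v n) -> u @ \oo --> l -> v @ \oo --> l.
Proof.
move=> uv /cvgCP H; apply/cvgCP => e /H [M HM]; exists (maxn N M) => n.
by rewrite geq_max => /andP[Nn Mn]; rewrite -uv // HM.
Qed.

Lemma cvgC_subseq (g : nat -> nat) u l :
  (forall n, (n <= g n)%N) -> u @ \oo --> l -> (u \o g) @ \oo --> l.
Proof.
move=> gn /cvgCP H; apply/cvgCP => e /H [M HM]; exists M => n Mn /=.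
by rewrite HM // (leq_trans Mn).
Qed.

Lemma cvgC_cabs_le u l (B : R) : u @ \oo --> l -> (forall n, cabs (u n) <= B) -> cabs l <= B.
Proof.
move=> /cvgCP H uB; rewrite leNgt; apply/negP => Bl.
have [|N HN] := H (cabs l - B); first by rewrite subr_gt0.
have := HN N (leqnn _); have := uB N; have := cabs_sub l (u N); rewrite cabsC.
lra.
Qed.

(* R[i] is not registered as a complete space, hence the detour by real and
   imaginary parts. *)
Lemma cauchyC_cvg u :
  (forall e : R, 0 < e -> exists N : nat, forall m n, (N <= m)%N -> (N <= n)%N ->
    cabs (u m - u n) < e) -> exists l, u @ \oo --> l.
Proof.
move=> H.
have real_lim (f : Cplx R -> R) : (forall z w, `|f z - f w| <= cabs (z - w)) ->
    exists l : R, forall e : R, 0 < e ->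
      exists N : nat, forall n, (N <= n)%N -> `|f (u n) - l| < e.
  move=> fle; have /cauchy_cvgP/cvg_ex[l /cvgrPdist_lt hl] : cauchy ((f \o u) @ \oo).
    apply/cauchy_ballP => e e0; have [N HN] := H e e0.
    exists ((f \o u) @` [set n | (N <= n)%N], (f \o u) @` [set n | (N <= n)%N]).
      by split; exists N => // n Nn; exists n.
    move=> [_ _] /= [[m hm <-] [n hn <-]]; apply: le_lt_trans (fle _ _) _; exact: HN.
  exists l => e e0; have [N _ HN] := hl e e0; exists N => n Nn.
  by rewrite distrC; exact: HN.
have [|a Ha] := real_lim (@complex.Re R).
  by move=> [a b] [c d]; exact: (Re_le_cabs ((a +i* b)%C - (c +i* d)%C)).
have [|b Hb] := real_lim (@complex.Im R).
  by move=> [a' b] [c d]; exact: (Im_le_cabs ((a' +i* b)%C - (c +i* d)%C)).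
exists (a +i* b)%C; apply/cvgCP => e e0.
have e20 : 0 < e / 2 by rewrite divr_gt0.
have [N1 HN1] := Ha _ e20; have [N2 HN2] := Hb _ e20.
exists (maxn N1 N2) => n; rewrite geq_max => /andP[/HN1 h1 /HN2 h2].
apply: le_lt_trans (cabs_le_ReIm _) _; case: (u n) h1 h2 => x y /=; lra.
Qed.

End Norm.

#[global] Arguments cabs {R} z : simpl never.
#[global] Arguments cvgC_cst {R} l.

(** * Complex derivatives and the exponential function *)

Section Derivation.
Context {R : realType}.
Implicit Types (z h l : Cplx R) (f : Cplx R -> Cplx R).

Lemma nbhsC0_cabs (P : set (Cplx R)) (d : R) : 0 < d ->
  (forall h, h != 0 -> cabs h < d -> P h) -> \forall h \near (0 : Cplx R)^', P h.
Proof.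
move=> d0 H; apply/nbhs_ballP; exists d%:C%C; first by rewrite /= ltcR.
move=> h /=; rewrite /ball /= sub0r normrN normr_lt_cabs => hd h0; exact: H.
Qed.

Lemma nbhsC_cabs (z : Cplx R) (P : set (Cplx R)) (d : R) : 0 < d ->
  (forall w, cabs (w - z) < d -> P w) -> nbhs z P.
Proof.
move=> d0 H; apply/nbhs_ballP; exists d%:C%C; first by rewrite /= ltcR.
by move=> h /=; rewrite /ball /= normr_lt_cabs cabsC; exact: H.
Qed.

Lemma is_deriveCP z f l :
  (forall e : R, 0 < e -> exists2 d : R, 0 < d &
    forall h, h != 0 -> cabs h < d -> cabs (h^-1 * (f (z + h) - f z) - l) < e) ->
  is_derive z 1 f l.
Proof.
move=> H; have H' : h^-1 *: ((f \o shift z) (h *: 1) - f z) @[h --> 0^'] --> l.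
  apply/cvgrPdist_lt => e /gt0_complexE[d d0 ->].
  have [r r0 Hr] := H d d0; apply: (nbhsC0_cabs r0) => h h0 hr.
  rewrite normr_lt_cabs cabsC /= /shift /= [h *: 1]mulr1.
  by have := Hr h h0 hr; rewrite (addrC z).
apply: DeriveDef; first by apply/cvg_ex; exists l.
exact: cvg_lim H'.
Qed.

(** The division-free form includes t = 0 and lets the expansions of exp, cos and sin be
    multiplied. *)
Lemma real_derive_expand (f : R -> R) (x d : R) : is_derive x 1 f d ->
  forall e : R, 0 < e -> exists2 r : R, 0 < r &
    forall t : R, `|t| < r -> `|f (x + t) - f x - d * t| <= e * `|t|.
Proof.
move=> [H Hd] e e0; move: H; rewrite /derivable => /cvg_ex[l Hl].
have ld : l = d by rewrite -Hd; apply/esym/cvg_lim => //.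
move/cvgrPdist_le: Hl => /(_ e e0)/nbhs_ballP[r /= r0 Hr]; exists r => // t tr.
have [->|t0] := eqVneq t 0; first by rewrite addr0 subrr mulr0 subrr normr0 mulr0.
have := Hr t; rewrite /ball /= sub0r normrN => /(_ tr t0).
rewrite ld [t *: 1]mulr1 => h.
have -> : f (x + t) - f x - d * t = - ((d - t^-1 *: (f (t + x) - f x)) * t).
  rewrite mulrBl [_ *: _]mulrC mulfVK // [t + x]addrC; ring.
by rewrite normrN normrM ler_wpM2r.
Qed.

Lemma cexpD (x y : Cplx R) : cexp (x + y) = cexp x * cexp y.
Proof.
case: x y => a b [c d]; rewrite /cexp /= expRD cosD sinD.
by apply/eqP; rewrite eq_complex /=; apply/andP; split; apply/eqP; ring.
Qed.

Lemma cexp0 : cexp 0 = 1 :> Cplx R.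
Proof. by rewrite /cexp /= expR0 cos0 sin0 mulr0 mulr1. Qed.

Lemma cabs_cexp z : cabs (cexp z) = expR (complex.Re z).
Proof.
rewrite /cabs /cexp /= !exprMn -mulrDr cos2Dsin2 mulr1 sqrtr_sqr ger0_norm //.
Qed.

Lemma cexp_neq0 z : cexp z != 0.
Proof. by rewrite -cabs_gt0 cabs_cexp expR_gt0. Qed.

Lemma cexp_expand (e : R) : 0 < e -> exists2 d : R, 0 < d &
  forall h, cabs h < d -> cabs (cexp h - 1 - h) <= e * cabs h.
Proof.
(* The errors add up to 9 e1 |h|: 4 from the real part and 5 from the imaginary part, where |h| < e1
   is used for the quadratic term. *)
move=> e0; pose e1 := Num.min 1 (e / 9).
have e10 : 0 < e1 by rewrite lt_min ltr01 divr_gt0.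
have e11 : e1 <= 1 by rewrite ge_min lexx.
have e1e : e1 <= e / 9 by rewrite ge_min lexx orbT.
clearbody e1.
have [r1 r10 H1] := real_derive_expand (is_derive_expR (0 : R)) e10.
have [r2 r20 H2] := real_derive_expand (is_derive_cos (0 : R)) e10.
have [r3 r30 H3] := real_derive_expand (is_derive_sin (0 : R)) e10.
pose d := Num.min (Num.min r1 r2) (Num.min r3 e1).
exists d; first by rewrite /d !lt_min r10 r20 r30 e10.
case=> x y hd.
have xle := Re_le_cabs (x +i* y)%C; have yle := Im_le_cabs (x +i* y)%C.
move: (cabs_ge0 (x +i* y)%C) hd xle yle; set n := cabs _ => /= n0.
rewrite !lt_min => /andP[/andP[nr1 nr2] /andP[nr3 ne1]] xle yle.
have {H1} := H1 x (le_lt_trans xle nr1).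
have {H2} := H2 y (le_lt_trans yle nr2).
have {H3} := H3 y (le_lt_trans yle nr3).
rewrite !add0r expR0 cos0 sin0 subr0 oppr0 mul0r subr0 !mul1r => H3 H2 H1.
have A1 : `|expR x - 1 - x| <= e1 * n by apply: le_trans H1 _; rewrite ler_wpM2l // ltW.
have A2 : `|cos y - 1| <= e1 * n by apply: le_trans H2 _; rewrite ler_wpM2l // ltW.
have A3 : `|sin y - y| <= e1 * n by apply: le_trans H3 _; rewrite ler_wpM2l // ltW.
have E1 : `|expR x - 1| <= 2 * n.
  have -> : expR x - 1 = (expR x - 1 - x) + x by ring.
  apply: le_trans (ler_normD _ _) _; have : e1 * n <= n by rewrite ler_piMl.
  lra.
have E2 : `|expR x| <= 3.
  have -> : expR x = (expR x - 1) + 1 by ring.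
  apply: le_trans (ler_normD _ _) _; rewrite normr1; lra.
apply: le_trans (cabs_le_ReIm _) _ => /=.
have B1 : `|expR x * cos y - 1 - x| <= 4 * (e1 * n).
  have -> : expR x * cos y - 1 - x = (expR x - 1 - x) + expR x * (cos y - 1) by ring.
  apply: le_trans (ler_normD _ _) _; rewrite normrM.
  have : `|expR x| * `|cos y - 1| <= 3 * (e1 * n) by rewrite ler_pM.
  lra.
have B2 : `|expR x * sin y - y| <= 3 * (e1 * n) + n * (2 * n).
  have -> : expR x * sin y - y = expR x * (sin y - y) + y * (expR x - 1) by ring.
  apply: le_trans (ler_normD _ _) _; rewrite !normrM.
  by apply: lerD; rewrite ler_pM.
have B3 : n * (2 * n) <= 2 * e1 * n.
  by rewrite mulrA ler_wpM2r // mulrC ler_wpM2l // ltW.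
rewrite oppr0 addr0.
have : 9 * (e1 * n) <= e * n.
  have : e1 * n <= e / 9 * n by rewrite ler_wpM2r.
  lra.
clear -B1 B2 B3; lra.
Qed.

Lemma is_derive_cexp z : is_derive z 1 (@cexp R) (cexp z).
Proof.
apply: is_deriveCP => e e0.
have c0 : 0 < cabs (cexp z) by rewrite cabs_gt0 cexp_neq0.
have e20 : 0 < e / (2 * cabs (cexp z)) by rewrite divr_gt0 // mulr_gt0.
have [d d0 Hd] := cexp_expand e20; exists d => // h h0 hd.
have -> : h^-1 * (cexp (z + h) - cexp z) - cexp z =
    cexp z * (h^-1 * (cexp h - 1 - h)).
  by rewrite cexpD; field.
rewrite !cabsM cabsV; have h0' : 0 < cabs h by rewrite cabs_gt0.
have := Hd h hd => Hh.
apply: (@le_lt_trans _ _ (e / 2)); last lra.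
have -> : e / 2 = cabs (cexp z) * ((cabs h)^-1 * (e / (2 * cabs (cexp z)) * cabs h)).
  by field; rewrite !gt_eqF.
by rewrite ler_wpM2l ?ler_wpM2l ?cabs_ge0 // invr_ge0 ltW.
Qed.

Lemma derivable_comp (f g : Cplx R -> Cplx R) z :
  derivable f z 1 -> derivable g (f z) 1 -> derivable (g \o f) z 1.
Proof.
move=> hf hg.
have hf' := (derivable1_diffP f z).1 hf.
have hg' := (derivable1_diffP g (f z)).1 hg.
have hgf := differentiable_comp hf' hg'.
exact: (derivable1_diffP (g \o f) z).2 hgf.
Qed.

Lemma derivable_mulr_const (c : Cplx R) z : derivable (fun x => c * x) z 1.
Proof.
apply: (@ex_derive _ _ _ _ _ _ c); apply: is_deriveCP => e e0; exists 1 => // h h0 _.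
have -> : h^-1 * (c * (z + h) - c * z) - c = 0 by field.
by rewrite cabs0.
Qed.

Definition ec (x : Cplx R) : Cplx R := cexp (twopii R * x).

Lemma ecD x y : ec (x + y) = ec x * ec y.
Proof. by rewrite /ec mulrDr cexpD. Qed.

Lemma ec0 : ec 0 = 1.
Proof. by rewrite /ec mulr0 cexp0. Qed.

Lemma ec_neq0 x : ec x != 0. Proof. exact: cexp_neq0. Qed.

Lemma ecN x : ec (- x) = (ec x)^-1.
Proof.
by apply: (mulIf (ec_neq0 x)); rewrite -ecD addNr ec0 mulVf ?ec_neq0.
Qed.

Lemma ecB x y : ec (x - y) = ec x / ec y.
Proof. by rewrite ecD ecN. Qed.

Lemma ecMn x n : ec (n%:R * x) = ec x ^+ n.
Proof.
elim: n => [|n IH]; first by rewrite mul0r ec0.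
by rewrite mulrS mulrDl mul1r ecD IH exprS.
Qed.

Lemma ecMz x (n : int) : ec (n%:~R * x) = ec x ^ n.
Proof.
case: n => n; first exact: ecMn.
by rewrite NegzE mulrNz mulNr ecN ecMn.
Qed.

Lemma cabs_ec x : cabs (ec x) = expR (- (pi *+ 2 * complex.Im x)).
Proof. by case: x => a b; rewrite cabs_cexp /= mul0r sub0r. Qed.

Lemma cabs_ec_lt1 x : upper_half_plane x -> cabs (ec x) < 1.
Proof.
rewrite /upper_half_plane /= => x0.
by rewrite cabs_ec -expR0 ltr_expR oppr_lt0 mulr_gt0 // mulrn_wgt0 // pi_gt0.
Qed.

Lemma ec_real (x : R) : ec x%:C%C = (cos (pi *+ 2 * x) +i* sin (pi *+ 2 * x))%C.
Proof. by rewrite /ec /cexp /= !mul0r mulr0 subrr expR0 !mul1r add0r. Qed.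

Lemma ec1 : ec 1 = 1.
Proof. by rewrite (ec_real 1) mulr1 cos2pi sin2pi. Qed.

Lemma ec_int (n : int) : ec n%:~R = 1.
Proof. by rewrite -[n%:~R]mulr1 ecMz ec1 exp1rz. Qed.

Lemma ec_half : ec (1 / 2) = -1.
Proof.
have -> : (1 / 2 : Cplx R) = (1 / 2 : R)%:C%C.
  by rewrite fmorph_div /= rmorph_nat.
rewrite ec_real.
have -> : pi *+ 2 * (1 / 2) = pi :> R by lra.
by rewrite cospi sinpi; apply/eqP; rewrite eq_complex /= oppr0 !eqxx.
Qed.

(** Modulus 1 forces x to be real. After subtraction of the floor, t lies in [0, 1) and cos (2 pi t)
    = 1 gives sin (pi t) = 0, while the sine is positive on (0, pi). *)
Lemma ec_eq1 x : ec x = 1 -> exists n : int, x = n%:~R.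
Proof.
move=> ex; have : cabs (ec x) = 1 by rewrite ex cabs1.
rewrite cabs_ec => /(congr1 (@ln R)); rewrite expRK ln1 => /eqP.
rewrite oppr_eq0 mulf_eq0 mulrn_eq0 /= gt_eqF ?pi_gt0 //= => /eqP Ix.
have xE : x = (complex.Re x)%:C%C by case: x Ix {ex} => a b /= ->.
pose n := Num.floor (complex.Re x); exists n.
have nle : n%:~R <= complex.Re x by exact: floor_le_tmp.
have nlt : complex.Re x < n%:~R + 1 by rewrite -[1 in ltRHS]/(1%:~R) -intrD; exact: floorD1_gt.
have nE : (n%:~R : Cplx R) = (n%:~R : R)%:C%C by exact/esym/(rmorph_int (real_complex R)).
clearbody n.
have : ec (complex.Re x - n%:~R)%:C%C = 1.
  by rewrite rmorphB /= -xE -nE ecB ex ec_int divr1.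
rewrite ec_real.
set t := _ - _ => /eqP; rewrite eq_complex /= => /andP[/eqP ct /eqP st].
have t0 : 0 <= t by rewrite subr_ge0.
have t1 : t < 1 by rewrite ltrBlDl.
suff t00 : t = 0 by rewrite xE nE; congr (_ %:C)%C; apply/eqP; rewrite -subr_eq0 -/t t00.
apply/eqP/negPn/negP => tn0; have tp : 0 < t by rewrite lt_def tn0.
have : 0 < sin (pi * t) by apply: sin_gt0_pi; rewrite mulr_gt0 ?pi_gt0 //= -[ltRHS]mulr1 ltr_pM2l ?pi_gt0.
move: ct; have -> : pi *+ 2 * t = (pi * t) *+ 2 by rewrite mulrnAl.
rewrite cos_mulr2n cos2sin2 => h; have : sin (pi * t) ^+ 2 = 0 by lra.
by move/eqP; rewrite sqrf_eq0 => /eqP ->; rewrite ltxx.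
Qed.

End Derivation.

#[global] Arguments derivable_mulr_const {R} c z.

(** * Absolutely convergent infinite products and their derivatives *)

Section InfiniteProducts.
Context {R : realType}.
Implicit Types (x y z l : Cplx R) (u v : nat -> Cplx R) (al : nat -> R).

(** Stated through tails because the product estimates split at an index K and need a bound on the
    sums beyond K. *)
Definition tail_summable al := (forall n, 0 <= al n) /\
  forall e : R, 0 < e -> exists K : nat, forall M N, (K <= M)%N ->
    \sum_(M <= n < N) al n <= e.

Lemma archi_inv (e : R) : 0 < e -> exists2 K : nat, (0 < K)%N & K%:R^-1 <= e.
Proof.
move=> e0; exists (Num.trunc (e^-1)).+1 => //.
rewrite invf_ple ?posrE ?ltr0n //; exact/ltW/truncnS_gt.
Qed.

Lemma summableZ al (c : R) : 0 <= c -> tail_summable al -> tail_summable (fun n => c * al n).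
Proof.
move=> c0 [al0 H]; split=> [n|e e0]; first exact: mulr_ge0.
have c10 : 0 < c + 1 by rewrite ltr_wpDl.
have [K HK] := H (e / (c + 1)) (divr_gt0 e0 c10); exists K => M N KM.
rewrite -mulr_sumr; apply: le_trans (_ : c * (e / (c + 1)) <= _).
  by rewrite ler_wpM2l // HK.
rewrite mulrCA ler_piMr // ?ltW //.
by rewrite ltr_pdivrMr // mul1r ltrDl.
Qed.

(** Comparison with 1 / (n (n + 1)), whose sum over [M, N) telescopes to 1/M - 1/N. *)
Lemma summable_inv_sqr : tail_summable (fun n => (n.+1%:R ^+ 2)^-1 : R).
Proof.
split=> [n|e /archi_inv[K K0 Ke]]; first by rewrite invr_ge0 sqr_ge0.
exists K => M N KM; have M0 : (0 < M)%N by exact: leq_trans KM.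
apply: le_trans (_ : M%:R^-1 <= _); last first.
  by apply: le_trans Ke; rewrite lef_pV2 ?posrE ?ltr0n // ler_nat.
have [MN|/ltnW NM] := leqP M N; last by rewrite big_geq // invr_ge0.
suff : \sum_(M <= n < N) (n.+1%:R ^+ 2 : R)^-1 <= M%:R^-1 - N%:R^-1.
  by move/le_trans; apply; rewrite gerBl invr_ge0.
elim: N MN => [|N IH]; first by rewrite leqn0 => /eqP M00; rewrite M00 in M0.
rewrite leq_eqVlt => /orP[/eqP <-|]; first by rewrite big_geq // subrr.
rewrite ltnS => MN; rewrite big_nat_recr //=.
have N0 : (0 : R) < N%:R by rewrite ltr0n (leq_trans M0).
have N10 : (0 : R) < N.+1%:R by rewrite ltr0n.
apply: le_trans (lerD (IH MN) (lexx _)) _.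
have -> : M%:R^-1 - N.+1%:R^-1 = M%:R^-1 - N%:R^-1 + (N%:R * N.+1%:R)^-1 :> R.
  rewrite -[N.+1]addn1 natrD in N10 *; field; rewrite !gt_eqF //.
  by rewrite ltr0n.
rewrite lerD2l lef_pV2 ?posrE ?exprn_gt0 ?mulr_gt0 // expr2 ler_pM2r //.
by rewrite ler_nat.
Qed.

Lemma summable_geometric (r : R) : 0 <= r < 1 -> tail_summable (fun n => r ^+ n).
Proof.
move=> /andP[r0 r1]; split=> [n|e e0]; first exact: exprn_ge0.
have r10 : 0 < 1 - r by rewrite subr_gt0.
have sumE M N : \sum_(M <= n < N) r ^+ n <= r ^+ M / (1 - r).
  have [MN|/ltnW NM] := leqP M N; last first.
    by rewrite big_geq // divr_ge0 ?exprn_ge0 // ltW.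
  suff -> : \sum_(M <= n < N) r ^+ n = (r ^+ M - r ^+ N) / (1 - r).
    by rewrite ler_pM2r ?invr_gt0 // gerBl exprn_ge0.
  elim: N MN => [|N IH].
    by rewrite leqn0 => /eqP ->; rewrite big_geq // subrr mul0r.
  rewrite leq_eqVlt => /orP[/eqP <-|]; first by rewrite big_geq // subrr mul0r.
  rewrite ltnS => MN; rewrite big_nat_recr //= IH // exprS; field.
  by rewrite gt_eqF.
have /cvgrPdist_lt/(_ (e * (1 - r))) : (fun n => r ^+ n) @ \oo --> (0 : R).
  by apply: cvg_expr; rewrite ger0_norm.
rewrite mulr_gt0 // => /(_ isT)[K _ HK]; exists K => M N KM.
apply: le_trans (sumE M N) _; rewrite ler_pdivrMr // ltW //.
by have := HK M KM; rewrite /= sub0r normrN ger0_norm // exprn_ge0.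
Qed.

Lemma summable_bounded al : tail_summable al -> exists2 S : R, 0 <= S &
  forall N, \sum_(0 <= n < N) al n <= S.
Proof.
move=> [al0 H]; have [K HK] := H 1 ltr01.
exists (\sum_(0 <= n < K) al n + 1); first by rewrite addr_ge0 // sumr_ge0.
move=> N; have [NK|/ltnW KN] := leqP N K.
  by rewrite (big_cat_nat (leq0n N) NK) //= -addrA lerDl addr_ge0 // sumr_ge0.
by rewrite (big_cat_nat (leq0n K) KN) //= lerD2l HK.
Qed.

Section FiniteProducts.
Context {I : Type}.
Implicit Types (s : seq I) (a : I -> Cplx R) (b : I -> R).

Lemma cabs_prod1D s a b : (forall i, cabs (a i) <= b i) ->
  cabs (\prod_(i <- s) (1 + a i)) <= expR (\sum_(i <- s) b i).
Proof.
move=> ab; elim: s => [|i s IH]; first by rewrite !big_nil cabs1 expR0.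
rewrite !big_cons cabsM expRD ler_pM ?cabs_ge0 //.
apply: le_trans (cabsD _ _) _; rewrite cabs1.
by apply: le_trans (expR_ge1Dx _); rewrite lerD2l.
Qed.

(** The bound 1/2 on the sum keeps the partial products below 2 in modulus, which closes the
    induction. *)
Lemma cabs_prod1D_sub1 s a b : (forall i, cabs (a i) <= b i) ->
  \sum_(i <- s) b i <= 1 / 2 ->
  cabs (\prod_(i <- s) (1 + a i) - 1) <= 2 * \sum_(i <- s) b i.
Proof.
move=> ab; have b0 i : 0 <= b i by apply: le_trans (ab i); exact: cabs_ge0.
elim: s => [|i s IH]; first by rewrite !big_nil subrr cabs0 mulr0.
rewrite !big_cons => h; have h' : \sum_(j <- s) b j <= 1 / 2.
  by apply: le_trans h; rewrite lerDr.
have {}IH := IH h'; set P := \prod_(j <- s) _ in IH *.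
have -> : (1 + a i) * P - 1 = (P - 1) + a i * P by ring.
apply: le_trans (cabsD _ _) _; rewrite cabsM.
have P2 : cabs P <= 2.
  have -> : P = (P - 1) + 1 by ring.
  apply: le_trans (cabsD _ _) _; rewrite cabs1; lra.
have : cabs (a i) * cabs P <= b i * 2 by rewrite ler_pM ?cabs_ge0.
lra.
Qed.

End FiniteProducts.

Lemma prod1D_cat u K N : (K <= N)%N ->
  \prod_(0 <= n < N) (1 + u n) = \prod_(0 <= n < K) (1 + u n) * \prod_(K <= n < N) (1 + u n).
Proof. by move=> KN; rewrite (big_cat_nat (leq0n K) KN). Qed.

Lemma prod_tail u al K (e : R) : (forall n, cabs (u n) <= al n) ->
  e <= 1 / 2 -> (forall M N, (K <= M)%N -> \sum_(M <= n < N) al n <= e) ->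
  forall M N, (K <= M)%N -> cabs (\prod_(M <= n < N) (1 + u n) - 1) <= 2 * e.
Proof.
move=> ual e2 H M N KM; have := H M N KM => h.
apply: le_trans (cabs_prod1D_sub1 ual (le_trans h e2)) _.
by rewrite ler_pM2l.
Qed.

Lemma prod_bounded u al : (forall n, cabs (u n) <= al n) -> tail_summable al ->
  exists2 B : R, 0 < B & forall N, cabs (\prod_(0 <= n < N) (1 + u n)) <= B.
Proof.
move=> ual /summable_bounded[S _ HS]; exists (expR S); first exact: expR_gt0.
by move=> N; apply: le_trans (cabs_prod1D _ ual) _; rewrite ler_expR.
Qed.

Lemma prod_cvg u al : (forall n, cabs (u n) <= al n) -> tail_summable al ->
  exists l, (fun N => \prod_(0 <= n < N) (1 + u n)) @ \oo --> l.
Proof.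
move=> ual sal; have [B B0 HB] := prod_bounded ual sal.
apply: cauchyC_cvg => e e0.
(* The product up to N differs from the product up to K by at most B * 2 e', which is at most e /
   4. *)
pose e' := Num.min (1 / 2) (e / (8 * B)).
have e'0 : 0 < e' by rewrite lt_min !divr_gt0 // mulr_gt0.
have [K HK] := sal.2 e' e'0.
have e'2 : e' <= 1 / 2 by rewrite ge_min lexx.
have e'e : e' * (8 * B) <= e by rewrite -ler_pdivlMr ?mulr_gt0 // ge_min lexx orbT.
have T := prod_tail ual e'2 HK.
have D N : (K <= N)%N -> cabs (\prod_(0 <= n < N) (1 + u n) - \prod_(0 <= n < K) (1 + u n))
    <= e / 4.
  move=> KN; rewrite (prod1D_cat _ KN) -{2}[\prod_(0 <= n < K) _]mulr1 -mulrBr cabsM.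
  apply: le_trans (_ : B * (2 * e') <= _); last by clear -e'e; lra.
  by rewrite ler_pM ?cabs_ge0 // T.
exists K => m n /D Dm /D Dn; set P := \prod_(0 <= n < K) _ in Dm Dn.
have E (a b : Cplx R) : a - b = (a - P) - (b - P) by ring.
rewrite E.
apply: le_lt_trans (cabsB _ _) _; lra.
Qed.

(** Beyond some K all tail products stay within 1/2 of 1, so the partial products keep at least half
    the modulus of the first K factors. *)
Lemma prod_neq0 u al l : (forall n, cabs (u n) <= al n) -> tail_summable al ->
  (forall n, 1 + u n != 0) ->
  (fun N => \prod_(0 <= n < N) (1 + u n)) @ \oo --> l -> l != 0.
Proof.
move=> ual sal un0 ul.
have q0 : (0 : R) < 1 / 4 by lra.
have [K HK] := sal.2 (1 / 4) q0.
have q2 : (1 / 4 : R) <= 1 / 2 by lra.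
have T := prod_tail ual q2 HK.
pose P := \prod_(0 <= n < K) (1 + u n).
have P0 : 0 < cabs P by rewrite cabs_gt0 prodf_seq_neq0; apply/allP => i _; rewrite un0.
have lb N : (K <= N)%N -> cabs P / 2 <= cabs (\prod_(0 <= n < N) (1 + u n)).
  move=> KN; rewrite (prod1D_cat _ KN) cabsM ler_pM2l // -/P.
  have := T K N (leqnn _); set Q := \prod_(K <= _ < _) _ => h.
  have := cabs_sub 1 Q; rewrite cabs1 cabsC; lra.
apply/eqP => l0; rewrite l0 in ul; move/cvgCP: ul => /(_ (cabs P / 2)).
rewrite divr_gt0 // => /(_ isT)[N HN].
have := HN (maxn K N) (leq_maxr _ _); rewrite subr0 => h.
by have := lb (maxn K N) (leq_maxl _ _); rewrite leNgt h.
Qed.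

Lemma cvg_prod_fin (s : seq nat) (u : nat -> nat -> Cplx R) v :
  (forall n, (fun j => u j n) @ \oo --> v n) ->
  (fun j => \prod_(n <- s) (1 + u j n)) @ \oo --> \prod_(n <- s) (1 + v n).
Proof.
move=> uv; elim: s => [|n s IH].
  rewrite big_nil; apply: cvgC_ext (_ : (fun=> 1) @ \oo --> _); last exact: cvgC_cst.
  by move=> n; rewrite big_nil.
rewrite big_cons; apply: cvgC_ext (_ : (fun j => (1 + u j n) * \prod_(n <- s) (1 + u j n)) @ \oo --> _).
  by move=> j; rewrite big_cons.
have h1 := cvgCD (cvgC_cst 1) (uv n).
have h2 := cvgCM h1 IH.
exact h2.
Qed.

(** Tannery's theorem, that is, dominated convergence when the number of factors grows with the
    parameter: [al] controls the tails uniformly, and the first K factors converge one by one. *)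
Lemma tannery_prod (u : nat -> nat -> Cplx R) v al l :
  (forall j n, cabs (u j n) <= al n) -> tail_summable al ->
  (forall n, (fun j => u j n) @ \oo --> v n) ->
  (fun N => \prod_(0 <= n < N) (1 + v n)) @ \oo --> l ->
  (fun N => \prod_(0 <= n < N) (1 + u N n)) @ \oo --> l.
Proof.
move=> ual sal uv vl.
have [S S0 HS] := summable_bounded sal.
have B0 : 0 < expR S by exact: expR_gt0.
have val n : cabs (v n) <= al n by apply: cvgC_cabs_le (uv n) _ => j.
apply/cvgCP => e e0.
pose e' := Num.min (1 / 2) (e / (16 * expR S)).
have e'0 : 0 < e' by rewrite lt_min !divr_gt0 // mulr_gt0.
have [K HK] := sal.2 e' e'0.
have e'2 : e' <= 1 / 2 by rewrite ge_min lexx.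
have e'e : e' * (16 * expR S) <= e by rewrite -ler_pdivlMr ?mulr_gt0 // ge_min lexx orbT.
have e40 : 0 < e / 4 by lra.
have [N1 HN1] := (cvgCP _ _).1 (cvg_prod_fin (s := index_iota 0 K) uv) _ e40.
have [N2 HN2] := (cvgCP _ _).1 vl _ e40.
exists (maxn K (maxn N1 N2)) => N; rewrite !geq_max => /and3P[KN /HN1 h1 /HN2 h2].
have D (w : nat -> Cplx R) : (forall n, cabs (w n) <= al n) ->
    cabs (\prod_(0 <= n < N) (1 + w n) - \prod_(0 <= n < K) (1 + w n)) <= e / 8.
  move=> wal; rewrite (prod1D_cat _ KN) -{2}[\prod_(0 <= n < K) _]mulr1 -mulrBr cabsM.
  apply: le_trans (_ : expR S * (2 * e') <= _); last by clear -e'e; lra.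
  rewrite ler_pM ?cabs_ge0 //; last exact: (prod_tail wal e'2 HK).
  by apply: le_trans (cabs_prod1D _ wal) _; rewrite ler_expR.
have D1 := D (u N) (ual N); have D2 := D v val.
set a := \prod_(0 <= n < N) (1 + u N n) in D1 *.
set b := \prod_(0 <= n < K) (1 + u N n) in D1 h1.
set c := \prod_(0 <= n < N) (1 + v n) in D2 h2.
set d := \prod_(0 <= n < K) (1 + v n) in D2 h1.
have -> : a - l = (a - b) + (b - d) - (c - d) + (c - l) by ring.
apply: le_lt_trans (cabsD _ _) _.
have := cabsB ((a - b) + (b - d)) (c - d); have := cabsD (a - b) (b - d).
lra.
Qed.

Lemma derivable_slopeP (f : Cplx R -> Cplx R) x : derivable f x 1 ->
  exists l, forall e : R, 0 < e -> exists2 d : R, 0 < d &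
    forall h : Cplx R, h != 0 -> cabs h < d -> cabs (h^-1 * (f (x + h) - f x) - l) < e.
Proof.
rewrite /derivable => /cvg_ex[l /cvgrPdist_lt Hl]; exists l => e e0.
have /Hl/nbhs_ballP[r /gt0_complexE[d d0 ->] Hr] : 0 < e%:C%C by rewrite ltcR.
exists d => // h h0 hd.
have := Hr h; rewrite /ball /= sub0r normrN normr_lt_cabs => /(_ hd h0).
by rewrite normr_lt_cabs /shift /= [h *: 1]mulr1 (addrC h) cabsC.
Qed.

(** The difference quotients at x form a Cauchy sequence in N uniformly in h, so the limits N -> oo
    and h -> 0 may be interchanged. *)
Lemma derivable_lim (G : nat -> Cplx R -> Cplx R) (g : Cplx R -> Cplx R) x
    (d : R) (be : nat -> R) : 0 < d -> tail_summable be ->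
  (forall N, derivable (G N) x 1) ->
  (forall h : Cplx R, cabs h < d -> (fun N => G N (x + h)) @ \oo --> g (x + h)) ->
  (forall N (h : Cplx R), h != 0 -> cabs h < d ->
    cabs (h^-1 * (G N.+1 (x + h) - G N.+1 x) - h^-1 * (G N (x + h) - G N x)) <= be N) ->
  derivable g x 1.
Proof.
move=> d0 [be0 sbe] dG Gg Gbe.
pose D N (h : Cplx R) := h^-1 * (G N (x + h) - G N x).
have tail (M N : nat) (h : Cplx R) : h != 0 -> cabs h < d -> (M <= N)%N ->
    cabs (D N h - D M h) <= \sum_(M <= n < N) be n.
  move=> h0 hd; elim: N => [|N IH].
    by rewrite leqn0 => /eqP ->; rewrite subrr cabs0 big_geq.
  rewrite leq_eqVlt => /orP[/eqP <-|]; first by rewrite subrr cabs0 big_geq.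
  rewrite ltnS => MN; rewrite big_nat_recr //=.
  have -> : D N.+1 h - D M h = (D N h - D M h) + (D N.+1 h - D N h) by ring.
  by apply: le_trans (cabsD _ _) _; apply: lerD; [exact: IH|exact: Gbe].
have Dg (h : Cplx R) : h != 0 -> cabs h < d ->
    (fun N => D N h) @ \oo --> h^-1 * (g (x + h) - g x).
  move=> h0 hd; have h1 := Gg h hd.
  have h2 : (fun N => G N x) @ \oo --> g x.
    by have := Gg 0; rewrite addr0 cabs0; apply.
  exact: (cvgCM (cvgC_cst h^-1) (cvgCB h1 h2)).
have [dl Hdl] := choice (fun N => derivable_slopeP (dG N)).
(* Both derivatives are compared with their difference quotients at one small real [h]; each of the
   three gaps is at most [e]. *)
have dle (M N : nat) (e : R) : (M <= N)%N -> 0 < e -> \sum_(M <= n < N) be n <= e ->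
    cabs (dl N - dl M) <= 3 * e.
  move=> MN e0 he; have [r r0 Hr] := Hdl N e e0; have [r' r'0 Hr'] := Hdl M e e0.
  pose t := Num.min (Num.min r r') d / 2.
  have t0 : 0 < t by rewrite divr_gt0 // !lt_min r0 r'0.
  have tlt : [/\ t < r, t < r' & t < d].
    have : t < Num.min (Num.min r r') d by rewrite /t in t0 *; lra.
    by rewrite !lt_min => /andP[/andP[-> ->] ->].
  case: tlt => tr tr' td.
  pose h : Cplx R := t%:C%C.
  have hE : cabs h = t by rewrite cabs_real gtr0_norm.
  have h0 : h != 0 by rewrite -cabs_gt0 hE.
  have H1 := Hr h h0; have H2 := Hr' h h0.
  rewrite hE -/(D N h) -/(D M h) in H1 H2.
  have H3 := tail M N h h0; rewrite hE in H3.
  have {}H1 := H1 tr; have {}H2 := H2 tr'; have {}H3 := le_trans (H3 td MN) he.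
  have -> : dl N - dl M = (D N h - D M h) - (D N h - dl N) + (D M h - dl M) by ring.
  apply: le_trans (cabsD _ _) _; have := cabsB (D N h - D M h) (D N h - dl N).
  lra.
have [l Hl] : exists l, dl @ \oo --> l.
  apply: cauchyC_cvg => e e0; have e8 : 0 < e / 8 by rewrite divr_gt0.
  have [K HK] := sbe _ e8; exists K => m n Km Kn.
  have h1 := dle K m _ Km e8 (HK _ _ (leqnn _)).
  have h2 := dle K n _ Kn e8 (HK _ _ (leqnn _)).
  have -> : dl m - dl n = (dl m - dl K) - (dl n - dl K) by ring.
  apply: le_lt_trans (cabsB _ _) _; lra.
apply: (@ex_derive _ _ _ _ _ _ l); apply: is_deriveCP => e e0.
have e4 : 0 < e / 4 by rewrite divr_gt0.
have [K HK] := sbe _ e4; have [N HN] := (cvgCP _ _).1 Hl _ e4.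
pose M := maxn K N; have [r r0 Hr] := Hdl M _ e4.
exists (Num.min r d); first by rewrite lt_min r0.
move=> h h0; rewrite lt_min => /andP[hr hd].
have H1 : cabs (h^-1 * (g (x + h) - g x) - D M h) <= e / 4.
  have [c Hc] : exists c, (fun N => D (N + M)%N h - D M h) @ \oo --> c /\
     c = h^-1 * (g (x + h) - g x) - D M h.
    eexists; split; last reflexivity.
    have := cvgC_subseq (g := fun n => (n + M)%N) (fun n => leq_addr M n) (Dg h h0 hd).
    by move=> hh; exact: (cvgCB hh (cvgC_cst _)).
  case: Hc => Hc <-; apply: cvgC_cabs_le Hc _ => n.
  apply: le_trans (tail M (n + M)%N h h0 hd (leq_addl _ _)) _.
  by apply: HK; exact: leq_maxl.
have H2 := Hr h h0 hr; rewrite -/(D M h) in H2.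
have H3 := HN M (leq_maxr _ _).
set a := h^-1 * _ in H1 *.
have -> : a - l = (a - D M h) + (D M h - dl M) + (dl M - l) by ring.
apply: le_lt_trans (cabsD _ _) _; have := cabsD (a - D M h) (D M h - dl M).
lra.
Qed.

(** Reduction to [derivable_lim]: by the product rule, the quotients of consecutive partial products
    differ by a bounded multiple of [al N], as soon as the quotients themselves are bounded. *)
Lemma derivable_prod_lim (u : nat -> Cplx R -> Cplx R) (g : Cplx R -> Cplx R) x
    (d : R) al : 0 < d -> tail_summable al ->
  (forall n, derivable (u n) x 1) ->
  (forall n (h : Cplx R), cabs h < d -> cabs (u n (x + h)) <= al n) ->
  (forall n (h : Cplx R), cabs h < d -> cabs (u n (x + h) - u n x) <= al n * cabs h) ->
  (forall h : Cplx R, cabs h < d ->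
    (fun N => \prod_(0 <= n < N) (1 + u n (x + h))) @ \oo --> g (x + h)) ->
  derivable g x 1.
Proof.
move=> d0 sal du ual ulip ug.
have ux n : cabs (u n x) <= al n by have := ual n 0; rewrite cabs0 addr0; apply.
pose G N (w : Cplx R) := \prod_(0 <= n < N) (1 + u n w).
have [S S0 HS] := summable_bounded sal.
have Gb N (h : Cplx R) : cabs h < d -> cabs (G N (x + h)) <= expR (\sum_(0 <= n < N) al n).
  by move=> hd; apply: cabs_prod1D => n; exact: ual.
have GS N (h : Cplx R) : G N.+1 h = G N h * (1 + u N h) by rewrite /G big_nat_recr.
have Gb0 N : cabs (G N x) <= expR (\sum_(0 <= n < N) al n).
  by have := Gb N 0; rewrite cabs0 addr0; apply.
pose D N (h : Cplx R) := h^-1 * (G N (x + h) - G N x).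
pose du' N (h : Cplx R) := h^-1 * (u N (x + h) - u N x).
have du'al N (h : Cplx R) : h != 0 -> cabs h < d -> cabs (du' N h) <= al N.
  move=> h0 hd; rewrite cabsM cabsV mulrC ler_pdivrMr ?cabs_gt0 //; exact: ulip.
have DS N (h : Cplx R) : h != 0 -> D N.+1 h - D N h = D N h * u N (x + h) + G N x * du' N h.
  by move=> h0; rewrite /D /du' !GS; ring.
(* With T the partial sum of [al], the bound T e^T is inductive because T e^T (1 + a) + a e^T <= e^T
   (1 + a) (T + a) and 1 + a <= e^a. *)
have Db N (h : Cplx R) : h != 0 -> cabs h < d ->
    cabs (D N h) <= expR (\sum_(0 <= n < N) al n) * \sum_(0 <= n < N) al n.
  move=> h0 hd; elim: N => [|N IH].
    by rewrite /D /G !big_geq // subrr mulr0 cabs0 mulr0.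
  have -> : D N.+1 h = D N h + (D N h * u N (x + h) + G N x * du' N h).
    by rewrite -DS //; ring.
  have SE : \sum_(0 <= n < N.+1) al n = \sum_(0 <= n < N) al n + al N by rewrite big_nat_recr.
  rewrite SE expRD.
  move: IH (Gb0 N); set T := \sum_(0 <= n < N) al n => IH GN.
  have T0 : 0 <= T by apply: sumr_ge0 => i _; exact: sal.1.
  have a0 : 0 <= al N by exact: sal.1.
  have eT : 0 < expR T by exact: expR_gt0.
  have ea : 1 + al N <= expR (al N) by exact: expR_ge1Dx.
  apply: le_trans (cabsD _ _) _.
  apply: le_trans (_ : expR T * T + (expR T * T * al N + expR T * al N) <= _).
    apply: lerD => //; apply: le_trans (cabsD _ _) _.
    rewrite (cabsM (D N h)) (cabsM (G N x)).
    apply: lerD; apply: ler_pM; rewrite ?cabs_ge0 //; first exact: ual.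
    exact: du'al.
  apply: le_trans (_ : expR T * (1 + al N) * (T + al N) <= _).
    have : 0 <= expR T * al N * al N by rewrite !mulr_ge0 // ltW.
    lra.
  by rewrite ler_wpM2r ?addr_ge0 // ler_pM2l.
have dG N : derivable (G N) x 1.
  elim: N => [|N IH].
    have -> : G 0%N = cst 1 by apply/funext => w; rewrite /G big_geq.
    exact: derivable_cst.
  have -> : G N.+1 = G N * (cst 1 + u N) by apply/funext => w; rewrite GS.
  have h0 : derivable (cst 1 : Cplx R -> Cplx R) x 1 by exact: derivable_cst.
  have h1 := derivableD h0 (du N).
  exact: derivableM IH h1.
have sbe : tail_summable (fun n => (expR S * S + expR S) * al n).
  by apply: summableZ => //; rewrite addr_ge0 ?mulr_ge0 ?expR_ge0.
apply: (derivable_lim d0 sbe dG); first exact: ug.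
move=> N h h0 hd; rewrite -/(D N h) -/(D N.+1 h) DS //.
  rewrite mulrDl; apply: le_trans (cabsD _ _) _; rewrite (cabsM (D N h)) (cabsM (G N x)).
  have eS : expR (\sum_(0 <= n < N) al n) <= expR S by rewrite ler_expR.
  apply: lerD; apply: ler_pM; rewrite ?cabs_ge0 //.
  - apply: le_trans (Db N h h0 hd) _; apply: ler_pM; rewrite ?expR_ge0 //.
    by apply: sumr_ge0 => i _; exact: sal.1.
  - exact: ual.
  - exact: le_trans (Gb0 N) eS.
  - exact: du'al.
Qed.

End InfiniteProducts.

(** * Euler's product for the sine *)

Section EulerSine.
Context {R : realType}.
Implicit Types (x y z w l : Cplx R) (u v : nat -> Cplx R).

(* [sn z] is 2 i sin (pi z). *)
Definition sn z : Cplx R := ec (z / 2) - ec (- (z / 2)).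

Lemma snN z : sn (- z) = - sn z.
Proof. by rewrite /sn mulNr opprK opprB. Qed.

Lemma sn_sqr z : sn z ^+ 2 = ec z + ec (- z) - 2.
Proof.
have e2 w : ec (w / 2) * ec (w / 2) = ec w by rewrite -ecD; congr ec; field.
have e3 : ec (z / 2) * ec (- (z / 2)) = 1 by rewrite -ecD subrr ec0.
by rewrite -[ec z]e2 -[ec (- z)]e2 mulNr /sn sqrrB e3; ring.
Qed.

Lemma sn_mul z : sn z = ec (- (z / 2)) * (ec z - 1).
Proof.
by rewrite /sn mulrBr mulr1 -ecD; congr (ec _ - _); field.
Qed.

Lemma sn_eq0 z : sn z = 0 -> exists n : int, z = n%:~R.
Proof.
rewrite sn_mul => /eqP; rewrite mulf_eq0 (negPf (ec_neq0 _)) /= subr_eq0 => /eqP.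
exact: ec_eq1.
Qed.

Lemma cabs_sn_real (t : R) : cabs (sn t%:C%C) = 2 * `|sin (pi * t)|.
Proof.
have tE : t%:C%C / 2 = (t / 2)%:C%C :> Cplx R by rewrite fmorph_div /= rmorph_nat.
rewrite /sn tE; have -> : - (t / 2)%:C%C = (- (t / 2))%:C%C :> Cplx R by rewrite rmorphN.
rewrite !ec_real mulrN cosN sinN.
have -> : pi *+ 2 * (t / 2) = pi * t by field.
set c := cos _; set s := sin _.
have -> : (c +i* s)%C - (c +i* (- s))%C = (0 +i* (2 * s))%C :> Cplx R.
  by apply/eqP; rewrite eq_complex /= subrr eqxx opprK; apply/eqP; ring.
by rewrite /cabs /= expr0n add0r sqrtr_sqr normrM ger0_norm.
Qed.

(** Write sin x = 2 sin (x/2) cos (x/2) and sin (x/2) = (x/2) cos c by the mean value theorem; both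
    cosines have square at least 1/2, since the doubled angles stay below pi/2. *)
Lemma sin_lower (x : R) : 0 <= x <= pi / 2 -> x / 2 <= sin x.
Proof.
move=> /andP[x0 xp]; have p0 : 0 < pi :> R by exact: pi_gt0.
have cos_half (c : R) : 0 <= c <= x / 2 -> 1 / 2 <= cos c ^+ 2.
  move=> /andP[c0 cx]; have : 0 <= cos (c *+ 2) by apply: cos_ge0_pihalf; lra.
  by rewrite cos_mulr2n; lra.
have cos_pos (c : R) : 0 <= c <= x / 2 -> 0 <= cos c.
  by move=> /andP[c0 cx]; apply: cos_ge0_pihalf; lra.
have x20 : 0 <= x / 2 by lra.
have [c|c cI] := @MVT_segment R sin cos 0 (x / 2) x20 (fun (y : R) _ => is_derive_sin y).
  exact/continuous_subspaceT/continuous_sin.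
rewrite sin0 !subr0 => sE.
have cI' : 0 <= c <= x / 2 by rewrite in_itv in cI.
have xI : 0 <= x / 2 <= x / 2 by rewrite x20 lexx.
have -> : sin x = 2 * (sin (x / 2) * cos (x / 2)).
  have xE : x = x / 2 *+ 2 by lra.
  by rewrite {1}xE sin_mulr2n; ring.
rewrite sE; have := cos_half _ cI'; have := cos_half _ xI.
have := cos_pos _ cI'; have := cos_pos _ xI.
set a := cos c; set b := cos (x / 2) => b0 a0 hb ha.
have ab : 1 / 2 <= a * b.
  have : (1 / 2 : R) ^+ 2 <= (a * b) ^+ 2.
    rewrite [(a * b) ^+ 2]exprMn expr2; have h0 : (0 : R) <= 1 / 2 by lra.
    exact: ler_pM.
  by rewrite ler_pXn2r // nnegrE ?mulr_ge0 //; lra.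
have : x / 2 * (1 / 2) <= x / 2 * (a * b) by rewrite ler_wpM2l.
lra.
Qed.

Lemma cvgC_bounded u l : u @ \oo --> l -> exists2 B : R, 0 < B & forall n, cabs (u n) <= B.
Proof.
move=> /cvgCP/(_ 1 ltr01)[N HN].
exists (cabs l + 1 + \sum_(0 <= n < N) cabs (u n)).
  by rewrite ltr_wpDr ?sumr_ge0 // => [i _|]; rewrite ?cabs_ge0 // ltr_wpDl ?cabs_ge0.
move=> n; have [Nn|nN] := leqP N n.
  have := HN n Nn; have := cabs_sub (u n) l => h1 h2.
  have h3 : 0 <= \sum_(0 <= n < N) cabs (u n) by apply: sumr_ge0 => *; exact: cabs_ge0.
  lra.
have : cabs (u n) <= \sum_(0 <= i < N) cabs (u i).
  rewrite (bigD1_seq n) ?mem_index_iota ?iota_uniq //= lerDl.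
  by apply: sumr_ge0 => i _; exact: cabs_ge0.
have := cabs_ge0 l; lra.
Qed.

Lemma cexp_scaled_cvg w (g : nat -> nat) : (forall n, (n < g n)%N) ->
  (fun n => (g n)%:R * (cexp (w / (g n)%:R) - 1)) @ \oo --> w.
Proof.
move=> gn; apply/cvgCP => e e0.
have w1 : 0 < cabs w + 1 by rewrite ltr_wpDl ?cabs_ge0.
have e1 : 0 < e / (cabs w + 1) by rewrite divr_gt0.
have [d d0 Hd] := cexp_expand e1.
have d1 : 0 < d / (cabs w + 1) by rewrite divr_gt0.
have [K K0 HK] := archi_inv d1; exists K => n Kn.
have g0 : (0 : R) < (g n)%:R by rewrite ltr0n (leq_ltn_trans _ (gn n)).
have gC0 : (g n)%:R != 0 :> Cplx R by rewrite pnatr_eq0 -lt0n (leq_ltn_trans _ (gn n)).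
have nE : cabs (w / (g n)%:R) = cabs w / (g n)%:R by rewrite cabsM cabsV cabs_nat.
have nd : cabs (w / (g n)%:R) < d.
  rewrite nE ltr_pdivrMr //; move: HK; rewrite ler_pdivlMr // => HK.
  have : K%:R <= (g n)%:R :> R by rewrite ler_nat (leq_trans Kn) // ltnW.
  have KR : (0 : R) < K%:R by rewrite ltr0n.
  rewrite mulrC ler_pdivrMr // in HK.
  move=> h; apply: (@lt_le_trans _ _ (d * K%:R)); first lra.
  by rewrite ler_pM2l.
have := Hd _ nd; rewrite nE => h.
have -> : (g n)%:R * (cexp (w / (g n)%:R) - 1) - w =
   (g n)%:R * (cexp (w / (g n)%:R) - 1 - w / (g n)%:R) by field.
rewrite cabsM cabs_nat.
apply: (@le_lt_trans _ _ ((g n)%:R * (e / (cabs w + 1) * (cabs w / (g n)%:R)))).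
  by rewrite ler_pM2l.
have -> : (g n)%:R * (e / (cabs w + 1) * (cabs w / (g n)%:R)) = e * (cabs w / (cabs w + 1)).
  by field; rewrite !gt_eqF.
by rewrite gtr_pMr // ltr_pdivrMr // mul1r ltrDl.
Qed.

Lemma sn_scaled_cvg z (g : nat -> nat) : (forall n, (n < g n)%N) ->
  (fun n => (g n)%:R * sn (z / (g n)%:R)) @ \oo --> twopii R * z.
Proof.
move=> gn; pose w := twopii R * z / 2.
have -> : twopii R * z = w - - w by rewrite /w; field.
have h := cvgCB (cexp_scaled_cvg (w := w) gn) (cexp_scaled_cvg (w := - w) gn).
apply: cvgC_ext _ h => n.
rewrite -mulrBr; congr (_ * _); rewrite opprB addrA subrK /sn /ec /w.
by congr (cexp _ - cexp _); ring.
Qed.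

(** The indices k + 1 and 2 K - k add up to N = 2 K + 1, so for N-th roots of unity the paired
    factors belong to a root and its inverse. *)
Lemma big_pairing (K : nat) (f : nat -> Cplx R) :
  \prod_(1 <= k < (2 * K).+1) f k = \prod_(0 <= k < K) (f k.+1 * f (2 * K - k)%N).
Proof.
rewrite big_add1 /= (@big_cat_nat _ _ _ K) //=; last lia.
rewrite big_split /=; congr (_ * _).
rewrite big_nat_rev /= -{1}[K]add0n big_addn.
have -> : (2 * K - K = K)%N by lia.
rewrite !big_nat; apply: eq_bigr => i /andP[_ iK]; congr (f _); lia.
Qed.

Lemma ec_prim_root N : (0 < N)%N -> N.-primitive_root (ec (1 / N%:R) : Cplx R).
Proof.
move=> N0; have NC : N%:R != 0 :> Cplx R by rewrite pnatr_eq0 -lt0n.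
rewrite /primitive_root_of_unity N0 /=; apply/forallP => i.
rewrite unity_rootE -ecMn mulrA mulr1; apply/eqP.
have [iN|iN] := eqVneq i.+1 N; first by rewrite iN divff // ec1 eqxx.
apply/eqP => /ec_eq1[n /(congr1 (fun x => x * N%:R))].
rewrite divfK // => /eqP.
have -> : (i.+1%:R : Cplx R) = i.+1%:Z%:~R by [].
have -> : (N%:R : Cplx R) = N%:Z%:~R by [].
rewrite -intrM eqr_int => /eqP h.
have : (i.+1 < N)%N by rewrite ltn_neqAle iN ltn_ord.
have : n = 0 \/ 1 <= n \/ n <= -1 by lia.
nia.
Qed.

Lemma sn_finite_prod (K : nat) z : let N := (2 * K).+1 in
  sn z = N%:R * sn (z / N%:R) *
    \prod_(0 <= k < K) (1 - (N%:R * sn (z / N%:R)) ^+ 2 / (N%:R * sn (k.+1%:R / N%:R)) ^+ 2).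
Proof.
move=> N; have NC : N%:R != 0 :> Cplx R by rewrite pnatr_eq0.
have prz := @ec_prim_root N isT; set ze := ec _ in prz.
have zeX k : ze ^+ k = ec (k%:R / N%:R) by rewrite -ecMn mulrA mulr1.
have zeXN k : (k < N)%N -> ze ^+ (N - k) = ec (- (k%:R / N%:R)).
  move=> kN; rewrite zeX natrB 1?ltnW // mulrBl divff // ecB ec1 mul1r ecN //.
have fE := factor_Xn_sub_1 prz.
have fW w : w ^+ N - 1 = (w - 1) * \prod_(1 <= k < N) (w - ze ^+ k).
  move: fE => /(congr1 (fun p : {poly Cplx R} => p.[w])); rewrite !hornerE horner_prod.
  move=> <-; rewrite big_ltn // expr0 !hornerE; congr (_ * _).
  by apply: eq_bigr => i _; rewrite !hornerE.
have pair_prod w : w != 0 -> \prod_(1 <= k < N) (w - ze ^+ k) =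
    w ^+ K * \prod_(0 <= k < K) (w + w^-1 - 2 - sn (k.+1%:R / N%:R) ^+ 2).
  move=> w0; rewrite big_pairing -[K in w ^+ K]subn0 -prodr_const_nat -big_split /=.
  rewrite !big_nat; apply: eq_bigr => k /andP[_ kK].
  have -> : (2 * K - k = N - k.+1)%N by rewrite /N; lia.
  rewrite zeX zeXN; last by rewrite /N; lia.
  rewrite sn_sqr ecN; have e0 := ec_neq0 (k.+1%:R / N%:R : Cplx R).
  by field; rewrite e0.
(* Evaluate 1 + X + ... + X^{N-1}, factored over the nontrivial roots of unity, at X = 1. *)
have prodN : \prod_(0 <= k < K) (- sn (k.+1%:R / N%:R : Cplx R) ^+ 2) = N%:R.
  have : \prod_(1 <= k < N) (1 - ze ^+ k) = N%:R.
    have : 'X^N - 1 = ('X - 1) * \prod_(1 <= k < N) ('X - (ze ^+ k)%:P).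
      by rewrite -fE big_ltn // expr0.
    rewrite subrX1 => /mulfI.
    have X1 : 'X - 1 != 0 :> {poly Cplx R} by rewrite -polyC1 polyXsubC_eq0.
    move=> /(_ X1)/(congr1 (fun p : {poly Cplx R} => p.[1])).
    rewrite horner_sum horner_prod.
    have -> : \sum_(i < N) ('X^i : {poly Cplx R}).[1] = N%:R.
      transitivity (\sum_(i < N) (1 : Cplx R)).
        by apply: eq_bigr => i _; rewrite hornerXn expr1n.
      by rewrite sumr_const card_ord.
    move=> ->.
    by apply: eq_bigr => i _; rewrite !hornerE.
  rewrite pair_prod ?oner_neq0 // expr1n mul1r => hN; rewrite -[RHS]hN.
  apply: eq_bigr => k _; rewrite invr1; ring.
have sn0 k : (0 <= k < K)%N -> sn (k.+1%:R / N%:R : Cplx R) != 0.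
  move=> kK; apply/eqP => s0; move: prodN.
  rewrite (bigD1_seq k) ?mem_index_iota ?iota_uniq //= s0 expr0n oppr0 mul0r => /eqP.
  by rewrite eq_sym (negPf NC).
pose W := ec (z / N%:R); have W0 : W != 0 by exact: ec_neq0.
have WN : W ^+ N = ec z by rewrite -ecMn; congr ec; field.
rewrite [LHS]sn_mul -WN fW pair_prod //.
set P := \prod_(0 <= k < K) (1 - _).
have -> : N%:R * sn (z / N%:R) * P = sn (z / N%:R) * (N%:R * P) by ring.
have -> : N%:R * P = \prod_(0 <= k < K) (- sn (k.+1%:R / N%:R) ^+ 2 *
    (1 - (N%:R * sn (z / N%:R)) ^+ 2 / (N%:R * sn (k.+1%:R / N%:R)) ^+ 2)).
  by rewrite big_split /= prodN.
rewrite {1}[sn (z / N%:R)]sn_mul -/W.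
have -> : ec (- (z / 2)) * ((W - 1) * (W ^+ K *
   \prod_(0 <= k < K) (W + W^-1 - 2 - sn (k.+1%:R / N%:R) ^+ 2))) =
   (ec (- (z / 2)) * W ^+ K) * (W - 1) *
   \prod_(0 <= k < K) (W + W^-1 - 2 - sn (k.+1%:R / N%:R) ^+ 2) by ring.
congr (_ * _ * _).
  rewrite -ecMn -ecD; congr ec; rewrite /N -addn1 natrD natrM in NC *; field.
  exact: NC.
rewrite !big_nat; apply: eq_bigr => k kK.
have s0 := sn0 k kK.
have -> : W + W^-1 - 2 = sn (z / N%:R) ^+ 2 by rewrite sn_sqr -ecN.
field; rewrite s0; exact: NC.
Qed.

Lemma twopii_neq0 : twopii R != 0.
Proof. by rewrite eq_complex /= eqxx /= mulrn_eq0 /= gt_eqF // pi_gt0. Qed.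

Definition sine_partial z N : Cplx R := z * \prod_(0 <= n < N) (1 - z ^+ 2 / n.+1%:R ^+ 2).

(** [tannery_prod] is applied to [sn_finite_prod] as N = 2 j + 1 grows: N sn (z/N) tends to 2 pi i
    z, and N sn (n/N) to 2 pi i n. *)
Lemma euler_sine z : sine_partial z @ \oo --> sn z / twopii R.
Proof.
pose g j := (2 * j).+1; have gn j : (j < g j)%N by rewrite /g; lia.
pose a j : Cplx R := (g j)%:R * sn (z / (g j)%:R).
pose b n j : Cplx R := (g j)%:R * sn (n.+1%:R / (g j)%:R).
have ha : a @ \oo --> twopii R * z by exact: sn_scaled_cvg.
have hb n : b n @ \oo --> twopii R * n.+1%:R by exact: sn_scaled_cvg.
have [B B0 HB] := cvgC_bounded ha.
have t0 := twopii_neq0.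
(* Setting the factors beyond j to 1 makes the bound [al] hold for all indices, and not only for
   those covered by [b_lower]. *)
pose u j n := if (n < j)%N then - (a j ^+ 2 / b n j ^+ 2) else 0 : Cplx R.
pose v n : Cplx R := - (z ^+ 2 / n.+1%:R ^+ 2).
pose al n := B ^+ 2 * (n.+1%:R ^+ 2)^-1 : R.
have sal : tail_summable al by apply: summableZ; [exact: sqr_ge0|exact: summable_inv_sqr].
(* As n + 1 <= j, the angle pi (n + 1) / (2 j + 1) stays below pi / 2, where [sin_lower] applies. *)
have b_lower j n : (n < j)%N -> n.+1%:R <= cabs (b n j).
  move=> nj; rewrite cabsM cabs_nat.
  have g0 : (0 : R) < (g j)%:R by rewrite ltr0n.
  have -> : n.+1%:R / (g j)%:R = (n.+1%:R / (g j)%:R : R)%:C%C :> Cplx R.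
    by rewrite fmorph_div /= !rmorph_nat.
  rewrite cabs_sn_real; set t := n.+1%:R / (g j)%:R.
  have p0 : 0 < pi :> R by exact: pi_gt0.
  have p1 : 1 <= pi :> R by apply: le_trans (pi_ge2 R); lra.
  have t0' : 0 <= t by rewrite divr_ge0.
  have t2 : t <= 1 / 2.
    rewrite /t ler_pdivrMr //.
    have : (2 * n.+1)%:R <= (g j)%:R :> R by rewrite ler_nat /g; lia.
    by rewrite natrM; lra.
  have pt : 0 <= pi * t <= pi / 2.
    rewrite mulr_ge0 ?pi_ge0 //=; have : pi * t <= pi * (1 / 2) by rewrite ler_pM2l.
    lra.
  have := sin_lower pt => h.
  have h2 : t <= 2 * `|sin (pi * t)|.
    have : t <= pi * t by rewrite ler_peMl.
    have := ler_norm (sin (pi * t)); lra.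
  have -> : n.+1%:R = (g j)%:R * t by rewrite /t mulrC divfK // gt_eqF.
  by rewrite ler_pM2l.
have ual j n : cabs (u j n) <= al n.
  rewrite /u; case: ifP => [nj|_]; last by rewrite cabs0 mulr_ge0 ?sqr_ge0 // invr_ge0 sqr_ge0.
  rewrite cabsN cabsM cabsV !cabsX /al.
  have bl := b_lower j n nj.
  have n0 : (0 : R) < n.+1%:R by rewrite ltr0n.
  apply: ler_pM; rewrite ?sqr_ge0 ?invr_ge0 ?sqr_ge0 //.
    by rewrite ler_pXn2r // ?nnegrE ?cabs_ge0 // ltW.
  have b0 := lt_le_trans n0 bl.
  rewrite lef_pV2 ?posrE ?exprn_gt0 //.
  by rewrite ler_pXn2r // ?nnegrE ?cabs_ge0 // ltW.
have uv n : (fun j => u j n) @ \oo --> v n.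
  have n0 : n.+1%:R != 0 :> Cplx R by rewrite pnatr_eq0.
  have tn0 : twopii R * n.+1%:R * (twopii R * n.+1%:R) != 0 by rewrite !mulf_neq0.
  have := cvgCM (cvgCM ha ha) (cvgCV tn0 (cvgCM (hb n) (hb n))) => h.
  have h' := cvgCB (cvgC_cst 0) h.
  have -> : v n = 0 - twopii R * z * (twopii R * z) / (twopii R * n.+1%:R * (twopii R * n.+1%:R)).
    rewrite /v; move: n0; move: (n.+1%:R : Cplx R) => m m0.
    by field; rewrite t0 m0.
  apply: (cvgC_eventually_ext (N := n.+1)) h' => j nj.
  by rewrite /u nj sub0r.
have val n : cabs (v n) <= al n by apply: cvgC_cabs_le (uv n) _ => j.
have [l hl] := prod_cvg val sal.
have hu := tannery_prod ual sal uv hl.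
have : (fun j => a j * \prod_(0 <= n < j) (1 + u j n)) @ \oo --> twopii R * z * l.
  exact: cvgCM ha hu.
have aE j : a j * \prod_(0 <= n < j) (1 + u j n) = sn z.
  rewrite (sn_finite_prod j z); congr (_ * _).
  by rewrite !big_nat; apply: eq_bigr => n /andP[_ nj]; rewrite /u nj.
move=> /(cvgC_ext aE) hs; have -> : sn z / twopii R = z * l.
  by rewrite (cvgC_unique (cvgC_cst _) hs); field.
exact: cvgCM (cvgC_cst z) hl.
Qed.

End EulerSine.

(** * q-Pochhammer symbols and the theta quotient *)

Section QPochhammer.
Context {R : realType}.
Implicit Types (a q x y z w t l : Cplx R).

Lemma qpoch_term_bound a q n : cabs (- (a * q ^+ n)) <= cabs a * cabs q ^+ n.
Proof. by rewrite cabsN cabsM cabsX. Qed.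

Lemma qpoch_summable a q : cabs q < 1 -> tail_summable (fun n => cabs a * cabs q ^+ n).
Proof.
by move=> q1; apply: summableZ; rewrite ?cabs_ge0 //; apply: summable_geometric; rewrite cabs_ge0.
Qed.

Lemma qpoch_cvg a q : cabs q < 1 ->
  (fun N => \prod_(0 <= n < N) (1 - a * q ^+ n)) @ \oo --> qpoch a q.
Proof.
move=> q1; have [l hl] := prod_cvg (qpoch_term_bound a q) (qpoch_summable a q1).
by rewrite /qpoch (cvg_lim _ hl).
Qed.
Arguments qpoch_cvg a {q} q1.

Lemma qpoch_unique a q l : cabs q < 1 ->
  (fun N => \prod_(0 <= n < N) (1 - a * q ^+ n)) @ \oo --> l -> qpoch a q = l.
Proof. by move=> q1 hl; exact: cvgC_unique (qpoch_cvg a q1) hl. Qed.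

Lemma qpoch_shift a q : cabs q < 1 -> qpoch a q = (1 - a) * qpoch (a * q) q.
Proof.
move=> q1; apply: cvgC_unique (cvgCM (cvgC_cst (1 - a)) (qpoch_cvg (a * q) q1)).
have h := cvgC_subseq (g := S) (fun n => leqnSn n) (qpoch_cvg a q1).
apply: cvgC_ext _ h => n /=; rewrite big_nat_recl //= expr0 mulr1; congr (_ * _).
by apply: eq_bigr => i _; rewrite exprS mulrA.
Qed.

Lemma qpoch_neq0 a q : cabs q < 1 -> (forall n, a * q ^+ n != 1) -> qpoch a q != 0.
Proof.
move=> q1 aq; apply: (prod_neq0 (qpoch_term_bound a q) (qpoch_summable a q1)).
  by move=> n; rewrite subr_eq0 eq_sym.
exact: qpoch_cvg.
Qed.

Lemma qpochqq_neq0 q : cabs q < 1 -> qpoch q q != 0.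
Proof.
move=> q1; apply: qpoch_neq0 => // n; apply/eqP => /(congr1 cabs).
rewrite -exprS cabsX cabs1 => h; have : cabs q ^+ n.+1 < 1.
  by rewrite exprn_ilt1 ?cabs_ge0.
by rewrite h ltxx.
Qed.

(** Replacing powers of r by powers of a larger rho turns the usual n r^{n-1} into a purely
    geometric majorant. *)
Lemma cabs_subXX x y n (r rho : R) : cabs x <= r -> cabs y <= r -> 0 <= r -> r < rho ->
  cabs (x ^+ n - y ^+ n) <= cabs (x - y) * (rho ^+ n / (rho - r)).
Proof.
move=> xr yr r0 rrho; have d0 : 0 < rho - r by rewrite subr_gt0.
have rho0 : 0 <= rho by rewrite ltW // (le_lt_trans r0).
rewrite subrXX cabsM ler_wpM2l ?cabs_ge0 //.
apply: le_trans (_ : \sum_(i < n) rho ^+ (n.-1 - i) * r ^+ i <= _).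
  elim/big_ind2 : _ => [|a b c d|i _]; first by rewrite cabs0.
    by move=> h1 h2; apply: le_trans (cabsD _ _) _; exact: lerD.
  rewrite cabsM !cabsX; apply: ler_pM; rewrite ?exprn_ge0 ?cabs_ge0 //.
    by rewrite lerXn2r ?nnegrE ?cabs_ge0 // (le_trans xr) // ltW.
  by rewrite lerXn2r ?nnegrE ?cabs_ge0.
rewrite ler_pdivlMr // mulrC -subrXX lerBlDr lerDl; exact: exprn_ge0.
Qed.

Lemma derivableX_id n z : derivable (fun w : Cplx R => w ^+ n) z 1.
Proof.
elim: n => [|n IH].
  have -> : (fun w : Cplx R => w ^+ 0) = cst 1 by [].
  exact: derivable_cst.
have -> : (fun w : Cplx R => w ^+ n.+1) = (fun w => 1 * w) * (fun w : Cplx R => w ^+ n).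
  by apply/funext => w; rewrite exprS -{1}(mul1r w).
have h1 := derivable_mulr_const (1 : Cplx R) z.
have h2 := derivableM h1 IH.
exact: h2.
Qed.
Arguments derivableX_id n z : clear implicits.

Lemma derivable_constM (c : Cplx R) (f : Cplx R -> Cplx R) z :
  derivable f z 1 -> derivable (fun w => c * f w) z 1.
Proof.
move=> df; have h : derivable (cst c : Cplx R -> Cplx R) z 1 by exact: derivable_cst.
have h2 := derivableM h df.
exact: h2.
Qed.

Lemma derivable_qpoch (c : Cplx R) (r b : nat) x : (0 < b)%N -> cabs x < 1 ->
  derivable (fun s : Cplx R => qpoch (c * s ^+ r) (s ^+ b)) x 1.
Proof.
(* Two radii below 1: [r1] bounds the disc around x, and [r2] is the ratio of the geometric
   majorant. *)
move=> b0 x1; pose d := (1 - cabs x) / 3; pose r1 := cabs x + d; pose r2 := cabs x + 2 * d.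
have d0 : 0 < d by rewrite divr_gt0 // subr_gt0.
have x0 := cabs_ge0 x.
have r12 : r1 < r2 by rewrite /r1 /r2; lra.
have r10 : 0 <= r1 by rewrite /r1; lra.
have r20 : 0 <= r2 by lra.
have r21 : r2 < 1 by rewrite /r2 /d; lra.
have ball (h : Cplx R) : cabs h < d -> cabs (x + h) <= r1.
  by move=> hd; apply: le_trans (cabsD _ _) _; rewrite lerD2l ltW.
pose u n (s : Cplx R) := - (c * s ^+ (r + b * n)).
pose C := cabs c * (1 + (r2 - r1)^-1).
have C0 : 0 <= C by rewrite mulr_ge0 ?cabs_ge0 // addr_ge0 // invr_ge0 subr_ge0 ltW.
have e n : r2 ^+ (r + b * n) <= r2 ^+ n.
  by rewrite ler_wiXn2l // ?ltW // -[leqLHS]add0n leq_add // leq_pmull.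
apply: (@derivable_prod_lim _ u _ x d (fun n => C * r2 ^+ n)) => //.
- by apply: summableZ => //; apply: summable_geometric; rewrite r20.
- move=> n; have -> : u n = (fun w => - c * w ^+ (r + b * n)).
    by apply/funext => s; rewrite /u mulNr.
  have h := derivable_constM (c := - c) (derivableX_id (r + b * n) x).
  exact: h.
- move=> n h hd; rewrite cabsN cabsM cabsX; apply: ler_pM; rewrite ?cabs_ge0 ?exprn_ge0 ?cabs_ge0 //.
    by rewrite /C ler_peMr ?cabs_ge0 // lerDl invr_ge0 subr_ge0 ltW.
  apply: le_trans (e n); rewrite lerXn2r ?nnegrE ?cabs_ge0 //.
  by rewrite (le_trans (ball _ hd)) // ltW.
- move=> n h hd; rewrite /u opprK addrC -mulrBr cabsM.
  have hx := ball 0; rewrite cabs0 addr0 in hx.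
  have := cabs_subXX (r + b * n) (hx d0) (ball h hd) r10 r12.
  have -> : cabs (x - (x + h)) = cabs h by rewrite opprD addrA subrr sub0r cabsN.
  move=> hle; apply: le_trans (_ : cabs c * (cabs h * (r2 ^+ n / (r2 - r1))) <= _).
    rewrite ler_wpM2l ?cabs_ge0 //; apply: le_trans hle _.
    by rewrite ler_wpM2l ?cabs_ge0 // ler_pM2r ?invr_gt0 ?subr_gt0.
  rewrite /C; have : 0 <= cabs c * r2 ^+ n * cabs h by rewrite !mulr_ge0 ?cabs_ge0 ?exprn_ge0.
  lra.
- move=> h hd; have q1 : cabs ((x + h) ^+ b) < 1.
    by rewrite cabsX exprn_ilt1 ?cabs_ge0 // ?gtn_eqF // (le_lt_trans (ball _ hd)) // (lt_trans r12).
  apply: cvgC_ext _ (qpoch_cvg (c * (x + h) ^+ r) q1) => N.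
  by apply: eq_bigr => n _; rewrite /u exprD exprM mulrA.
Qed.

(* A constant multiple of theta_1 / eta^3: weight -1, index 1/2. *)
Definition thK z t : Cplx R :=
  sn z * (qpoch (ec t * ec z) (ec t) * qpoch (ec t / ec z) (ec t)) / qpoch (ec t) (ec t) ^+ 2.

Lemma thKN z t : thK (- z) t = - thK z t.
Proof. by rewrite /thK snN ecN invrK !mulNr [X in _ * X / _]mulrC. Qed.

Lemma thK_add1 z t : thK (z + 1) t = - thK z t.
Proof.
rewrite /thK ecD ec1 mulr1; have -> : sn (z + 1) = - sn z.
  rewrite !sn_mul ecD ec1 mulr1.
  have -> : - ((z + 1) / 2) = - (z / 2) - 1 / 2 by field.
  by rewrite ecB ec_half invrN1 mulrN1 mulNr.
by rewrite !mulNr.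
Qed.

(** Adding t to z drops the first factor of one q-Pochhammer symbol and gives a new first factor to
    the other; these two factors and the ratio of the [sn] terms make up the multiplier. *)
Lemma thK_addt z t : upper_half_plane t -> thK (z + t) t = - ec (- (t / 2) - z) * thK z t.
Proof.
move=> /cabs_ec_lt1 q1; rewrite /thK; set q := ec t in q1 *.
rewrite [RHS]mulrA; congr (_ / _); rewrite ecD -/q; set w := ec z.
have w0 : w != 0 by exact: ec_neq0.
have q0 : q != 0 by exact: ec_neq0.
have -> : q / (w * q) = w^-1 by field; rewrite w0.
rewrite [qpoch w^-1 q]qpoch_shift // [qpoch (q * w) q]qpoch_shift //.
rewrite [w^-1 * q]mulrC [q * w * q]mulrC [w * q]mulrC !sn_mul ecD -/q -/w.
have -> : ec (- ((z + t) / 2)) = ec (- (t / 2) - z) * ec (z / 2).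
  by rewrite -ecD; congr ec; field.
have -> : ec (- (z / 2)) = ec (z / 2) / w.
  by rewrite -ecB; congr ec; field.
have -> : q * (q * w) = q * w * q by ring.
by field.
Qed.

Lemma thK_period z t : thK z (t + 1) = thK z t.
Proof. by rewrite /thK ecD ec1 mulr1. Qed.

Lemma thK_0 t : thK 0 t = 0.
Proof. by rewrite /thK /sn mul0r oppr0 subrr !mul0r. Qed.

Definition off_lattice t z := forall m n : int, z != m%:~R * t + n%:~R.

Lemma thK_neq0 z t : upper_half_plane t -> off_lattice t z -> thK z t != 0.
Proof.
move=> ht zt; have q1 := cabs_ec_lt1 ht.
have expE n : ec t ^+ n = ec (n%:R * t) by rewrite ecMn.
rewrite /thK; apply: mulf_neq0; last by rewrite invr_eq0 expf_neq0 // qpochqq_neq0.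
apply: mulf_neq0; last apply: mulf_neq0.
- apply/eqP => /sn_eq0[n zn]; have := zt 0 n; rewrite mul0r add0r zn eqxx //.
- apply: qpoch_neq0 => // n; rewrite -mulrA mulrCA -exprS expE -ecD.
  apply/eqP => /ec_eq1[k hk]; have /negP := zt (- (n.+1%:Z)) k; apply.
  apply/eqP; rewrite mulrNz mulNr -hk; ring.
- apply: qpoch_neq0 => // n; rewrite -mulrA mulrCA -exprS expE -ecN -ecD.
  apply/eqP => /ec_eq1[k hk]; have /negP := zt n.+1%:Z (- k); apply.
  apply/eqP; rewrite mulrNz -hk; ring.
Qed.

(** Rewrites one step of the q-product as the contribution of the lattice rows through (m + 1) t and
    - (m + 1) t, to which Euler's product applies. *)
Lemma sn_ratio z t m : upper_half_plane t ->
  sn (m.+1%:R * t + z) * sn (m.+1%:R * t - z) / sn (m.+1%:R * t) ^+ 2 =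
  (1 - ec t * ec z * ec t ^+ m) * (1 - ec t / ec z * ec t ^+ m) / (1 - ec t * ec t ^+ m) ^+ 2.
Proof.
move=> /cabs_ec_lt1 q1; set x := m.+1%:R * t.
have xE : ec t * ec t ^+ m = ec x by rewrite -exprS -ecMn.
rewrite !sn_mul ecB ecD.
have -> : ec t * ec z * ec t ^+ m = ec x * ec z by rewrite -xE; ring.
have -> : ec t / ec z * ec t ^+ m = ec x / ec z by rewrite -xE; ring.
rewrite xE; set c := ec (- (x / 2)); have c0 : c != 0 by exact: ec_neq0.
have -> : ec (- ((x + z) / 2)) = c / ec (z / 2) by rewrite -ecB; congr ec; field.
have -> : ec (- ((x - z) / 2)) = c * ec (z / 2) by rewrite -ecD; congr ec; field.
have h0 : ec (z / 2) != 0 by exact: ec_neq0.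
have z0 : ec z != 0 by exact: ec_neq0.
have x0 : ec x - 1 != 0.
  rewrite subr_eq0; apply/eqP => /(congr1 cabs); rewrite -xE -exprS cabsX cabs1 => h.
  have : cabs (ec t) ^+ m.+1 < 1 by rewrite exprn_ilt1 ?cabs_ge0.
  by rewrite h ltxx.
have x0' : 1 - ec x != 0 by rewrite -opprB oppr_eq0.
by field; rewrite h0 z0 x0 x0' c0.
Qed.

Lemma thK_sine_prod z t : upper_half_plane t ->
  (fun M => sn z * \prod_(0 <= m < M)
     (sn (m.+1%:R * t + z) * sn (m.+1%:R * t - z) / sn (m.+1%:R * t) ^+ 2)) @ \oo --> thK z t.
Proof.
move=> ht; have q1 := cabs_ec_lt1 ht.
have h1 := qpoch_cvg (ec t * ec z) q1; have h2 := qpoch_cvg (ec t / ec z) q1.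
have h3 := qpoch_cvg (ec t) q1; have n0 := qpochqq_neq0 q1.
have n02 : qpoch (ec t) (ec t) * qpoch (ec t) (ec t) != 0 by rewrite mulf_neq0.
have h := cvgCM (cvgC_cst (sn z)) (cvgCM (cvgCM h1 h2) (cvgCV n02 (cvgCM h3 h3))).
rewrite /thK -mulrA expr2; apply: cvgC_ext _ h => M; congr (_ * _).
rewrite -!big_split /= -prodfV -big_split /=.
by apply: eq_bigr => m _; rewrite sn_ratio // expr2.
Qed.

End QPochhammer.

#[global] Arguments derivableX_id {R} n z.
#[global] Arguments qpoch_cvg {R} a {q} q1.

(** * Interchange of the two limits of a double product *)

Section DoubleProducts.
Context {R : realType}.
Implicit Types (x y z w l : Cplx R).

(** Unlike [cabs_prod1D_sub1] this requires no smallness, and for bounded sums it stays linear in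
    the majorant, so that products along one index are summable in the other. *)
Lemma cabs_prod1D_sub1_exp I (s : seq I) (a : I -> Cplx R) (b : I -> R) :
  (forall i, cabs (a i) <= b i) ->
  cabs (\prod_(i <- s) (1 + a i) - 1) <= \sum_(i <- s) b i * expR (\sum_(i <- s) b i).
Proof.
move=> ab; have b0 i : 0 <= b i by apply: le_trans (ab i); exact: cabs_ge0.
rewrite -mulr_suml; elim: s => [|i s IH]; first by rewrite !big_nil subrr cabs0 mul0r.
have := cabs_prod1D s ab; rewrite !big_cons; move: IH.
set P := \prod_(j <- s) _; set T := \sum_(j <- s) _ => IH PT.
have T0 : 0 <= T by exact: sumr_ge0.
have -> : (1 + a i) * P - 1 = (P - 1) + a i * P by ring.
apply: le_trans (cabsD _ _) _; rewrite cabsM.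
apply: le_trans (_ : (b i + T) * expR T <= _).
  have : cabs (a i) * cabs P <= b i * expR T by rewrite ler_pM ?cabs_ge0.
  by rewrite mulrDl; lra.
by rewrite ler_wpM2l ?addr_ge0 // ler_expR lerDr.
Qed.

Lemma prod_order_exchange (r : nat -> nat -> Cplx R) (C : R) (al : nat -> R)
    (rw cl : nat -> Cplx R) (rinf cinf : Cplx R) :
  0 <= C -> tail_summable al -> (forall n, al n <= 1) ->
  (forall m n, cabs (r m n) <= C * (al m * al n)) ->
  (forall M, (fun N => \prod_(0 <= m < M.+1) \prod_(0 <= n < N.+1) (1 + r m n)) @ \oo --> rw M) ->
  rw @ \oo --> rinf ->
  (forall N, (fun M => \prod_(0 <= m < M.+1) \prod_(0 <= n < N.+1) (1 + r m n)) @ \oo --> cl N) ->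
  cl @ \oo --> cinf ->
  rinf = cinf.
Proof.
move=> C0 sal al1 rC.
have al0 := sal.1; have [S S0 HS] := summable_bounded sal.
(* Tannery: both iterated products agree with the diagonal one. *)
have diag (p : nat -> nat -> Cplx R) (c : nat -> Cplx R) (cinf' : Cplx R) :
    (forall m n, cabs (p m n) <= C * (al m * al n)) ->
    (forall N, (fun M => \prod_(0 <= n < N.+1) \prod_(0 <= m < M.+1) (1 + p m n)) @ \oo --> c N) ->
    c @ \oo --> cinf' ->
    (fun j => \prod_(0 <= n < j) \prod_(0 <= m < j) (1 + p m n)) @ \oo --> cinf'.
  move=> pC hc hcinf.
  have spn n : tail_summable (fun m => C * al n * al m).
    by apply: summableZ => //; rewrite mulr_ge0.
  have pn n m : cabs (p m n) <= C * al n * al m by rewrite -mulrA [al n * _]mulrC.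
  have [b hb] := choice (fun n => prod_cvg (pn n) (spn n)).
  pose u j n := \prod_(0 <= m < j) (1 + p m n) - 1.
  (* Comes from T e^T with T <= C * al n * S; in the exponent [al n] is bounded by 1. *)
  pose K := C * S * expR (C * S).
  have K0 : 0 <= K by rewrite !mulr_ge0 // expR_ge0.
  have ual j n : cabs (u j n) <= K * al n.
    apply: le_trans (cabs_prod1D_sub1_exp _ (pn n)) _.
    rewrite -mulr_suml -mulr_sumr.
    have CS0 : 0 <= C * S by rewrite mulr_ge0.
    have h1 : C * al n * \sum_(0 <= m < j) al m <= C * al n * S.
      by rewrite ler_wpM2l ?mulr_ge0.
    have h2 : C * al n * S <= C * S.
      by rewrite mulrAC ler_piMr.
    apply: le_trans (_ : C * al n * S * expR (C * S) <= _).
      apply: ler_pM; rewrite ?expR_ge0 ?mulr_ge0 ?sumr_ge0 //.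
      by rewrite ler_expR; apply: le_trans h2.
    rewrite /K le_eqVlt; apply/orP; left; apply/eqP; ring.
  have sK : tail_summable (fun n => K * al n) by exact: summableZ.
  have uv n : (fun j => u j n) @ \oo --> b n - 1 by exact: cvgCB (hb n) (cvgC_cst 1).
  have val n : cabs (b n - 1) <= K * al n by apply: cvgC_cabs_le (uv n) _ => j.
  have [l hl] := prod_cvg val sK.
  have cE N : c N = \prod_(0 <= n < N.+1) (1 + (b n - 1)).
    apply: cvgC_unique (hc N) _.
    have h := cvg_prod_fin (s := index_iota 0 N.+1) uv.
    have h' := cvgC_subseq (g := succn) (fun n => leqnSn n) h.
    by apply: cvgC_ext _ h' => M /=; apply: eq_bigr => n _; rewrite /u addrC subrK.
  have -> : cinf' = l.
    apply: cvgC_unique hcinf _.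
    have h' := cvgC_subseq (g := succn) (fun n => leqnSn n) hl.
    by apply: cvgC_ext _ h' => M /=; rewrite cE.
  have h := tannery_prod ual sK uv hl.
  by apply: cvgC_ext _ h => j; apply: eq_bigr => n _; rewrite /u addrC subrK.
move=> hrw hrinf hcl hcinf.
have d1 := diag (fun m n => r n m) rw rinf.
have d2 := diag r cl cinf.
apply: cvgC_unique (d1 _ hrw hrinf) _.
  by move=> m n; rewrite [al m * _]mulrC.
apply: cvgC_ext _ (d2 rC _ hcinf) => [j|N].
  by rewrite exchange_big.
by apply: cvgC_ext _ (hcl N) => M; rewrite exchange_big.
Qed.

End DoubleProducts.

(** * Lower bounds for lattice points *)

Section Lattice.
Context {R : realType}.
Implicit Types (x y z w t v : Cplx R).

Lemma upper_neq0 t : upper_half_plane t -> t != 0.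
Proof.
by rewrite /upper_half_plane /= => h; apply/eqP => t0; rewrite t0 /= ltxx in h.
Qed.

Lemma Im_real_lin t (a b : R) : complex.Im (a%:C%C * t + b%:C%C) = a * complex.Im t.
Proof. by case: t => x y /=; rewrite mul0r !addr0. Qed.

Lemma natr_complexE (n : nat) : (n%:R : Cplx R) = (n%:R : R)%:C%C.
Proof. exact/esym/(rmorph_nat (real_complex R)). Qed.

Lemma intr_complexE (n : int) : (n%:~R : Cplx R) = (n%:~R : R)%:C%C.
Proof. exact/esym/(rmorph_int (real_complex R)). Qed.

(** The imaginary part of w = m t + n bounds |m|, and n = w - m t then bounds |n|. As one of them is
    at least 1, also d (|m| + 1) / 2 and d (|n| + 1) / 2 are at most |w|. The product form fits the
    majorant of [prod_order_exchange]. *)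
Lemma lattice_lower t : upper_half_plane t -> exists2 e : R, 0 < e &
  forall m n : int, (m != 0) || (n != 0) ->
    e * ((`|m|.+1)%N%:R * (`|n|.+1)%N%:R) <= cabs (m%:~R * t + n%:~R) ^+ 2.
Proof.
rewrite /upper_half_plane /= => y0; set y := complex.Im t in y0.
pose D := 1 + y + cabs t; have D0 : 0 < D by rewrite /D; have := cabs_ge0 t; lra.
pose d := y / D; have d0 : 0 < d by rewrite divr_gt0.
exists (d ^+ 2 / 4) => [|m n mn]; first by rewrite divr_gt0 ?exprn_gt0.
set w := _ + _.
have h1 : `|m|%N%:R * y <= cabs w.
  have := Im_le_cabs w; rewrite /w !intr_complexE Im_real_lin normrM (gtr0_norm y0).
  by rewrite -intr_norm -abszE.
have h2 : `|n|%N%:R <= cabs w + `|m|%N%:R * cabs t.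
  have -> : (`|n|%N%:R : R) = cabs (n%:~R : Cplx R) by rewrite cabs_int -abszE.
  have -> : (n%:~R : Cplx R) = w - m%:~R * t by rewrite /w; ring.
  by apply: le_trans (cabsB _ _) _; rewrite cabsM cabs_int -abszE.
have t0 := cabs_ge0 t; have w0 := cabs_ge0 w.
have dm : d * `|m|%N%:R <= cabs w.
  rewrite /d mulrAC ler_pdivrMr //; apply: le_trans (_ : cabs w <= _); first by rewrite mulrC.
  by rewrite ler_peMr // /D; lra.
have dn : d * `|n|%N%:R <= cabs w.
  rewrite /d mulrAC ler_pdivrMr //.
  apply: le_trans (_ : y * (cabs w + `|m|%N%:R * cabs t) <= _).
    by rewrite ler_pM2l.
  have : `|m|%N%:R * y * cabs t <= cabs w * cabs t by rewrite ler_wpM2r.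
  rewrite /D; lra.
set a : R := `|m|%N%:R in dm h1 h2 *; set b : R := `|n|%N%:R in dn h2 *.
have a0 : 0 <= a by exact: ler0n. have b0 : 0 <= b by exact: ler0n.
rewrite -[`|m|.+1%:R]natr1 -[`|n|.+1%:R]natr1 -/a -/b.
have ab : 1 <= a \/ 1 <= b.
  by case/orP: mn => h; [left|right]; rewrite /a /b ler1n absz_gt0.
have dab : d * ((a + 1) / 2) <= cabs w /\ d * ((b + 1) / 2) <= cabs w.
  have hd1 : 1 <= a -> d <= d * a by move=> h; rewrite ler_peMr // ltW.
  have hd2 : 1 <= b -> d <= d * b by move=> h; rewrite ler_peMr // ltW.
  case: ab => [/hd1|/hd2] h; split; lra.
have -> : d ^+ 2 / 4 * ((a + 1) * (b + 1)) = (d * ((a + 1) / 2)) * (d * ((b + 1) / 2)).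
  by field.
have hp c : 0 <= c -> 0 <= d * ((c + 1) / 2).
  by move=> c0; rewrite mulr_ge0 ?ltW // divr_gt0 //; lra.
by rewrite expr2; apply: ler_pM; rewrite ?hp //; case: dab.
Qed.

Lemma lattice_neq0 t (m n : int) : upper_half_plane t -> (m != 0) || (n != 0) ->
  m%:~R * t + n%:~R != 0.
Proof.
move=> /lattice_lower[e e0 H] mn; apply/eqP => h; have := H m n mn.
by rewrite h cabs0 expr0n /= leNgt mulr_gt0 // mulr_gt0.
Qed.

Definition inv_factor v w : R := (cabs (1 - v ^+ 2 / w ^+ 2))^-1.

(** If |w|^2 >= 2 |v|^2, the inverse is at most 2. The remaining w lie in a finite box by
    [lattice_lower], and the sum T over this box bounds each of their values; where the factor
    vanishes, its inverse is 0 by convention. *)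
Lemma inv_factor_bound t v : upper_half_plane t ->
  exists2 D : R, 0 < D & forall (m n : nat) (s : bool), (m != 0%N) || (n != 0%N) ->
    inv_factor v (m%:R * t + (-1) ^+ s * n%:R) <= D.
Proof.
move=> ht; have [e e0 He] := lattice_lower ht.
have v0 := cabs_ge0 v.
pose B := (Num.trunc (2 * cabs v ^+ 2 / e)).+1.
pose om (m n : nat) (s : bool) : Cplx R := m%:R * t + (-1) ^+ s * n%:R.
pose T := \sum_(0 <= m < B) \sum_(0 <= n < B) (inv_factor v (om m n false) + inv_factor v (om m n true)).
have if0 w : 0 <= inv_factor v w by rewrite invr_ge0 cabs_ge0.
have T0 : 0 <= T by apply: sumr_ge0 => m _; apply: sumr_ge0 => n _; rewrite addr_ge0.
exists (2 + T) => [|m n s mn]; first by lra.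
rewrite -/(om m n s).
have := He m (((-1) ^+ s) * n%:Z).
have -> : absz ((-1) ^+ s * n%:Z) = n by rewrite abszMsign absz_nat.
have -> : (m : int) != 0 = (m != 0%N) by [].
have -> : (-1) ^+ s * n%:Z != 0 = (n != 0%N) by rewrite mulf_eq0 signr_eq0.
have -> : m%:~R * t + ((-1) ^+ s * n%:Z)%:~R = om m n s :> Cplx R.
  by rewrite /om intrM rmorphXn rmorphN1.
move=> /(_ mn) low; set w := om m n s in low *.
have mn0 : (0 : R) < m.+1%:R * n.+1%:R by rewrite mulr_gt0.
have [big|small] := leP (2 * cabs v ^+ 2) (cabs w ^+ 2).
  have w20 : 0 < cabs w ^+ 2 by apply: lt_le_trans low; rewrite mulr_gt0.
  have : cabs (v ^+ 2 / w ^+ 2) <= 1 / 2.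
    by rewrite cabsM cabsV !cabsX ler_pdivrMr //; lra.
  have := cabs_sub 1 (v ^+ 2 / w ^+ 2); rewrite cabs1 => h1 h2.
  have h3 : 2^-1 <= cabs (1 - v ^+ 2 / w ^+ 2) by lra.
  apply: le_trans (_ : 2 <= _); last by lra.
  rewrite /inv_factor -[leRHS]invrK lef_pV2 ?posrE //; lra.
have mnB : m.+1%:R * n.+1%:R < B%:R :> R.
  have : m.+1%:R * n.+1%:R < 2 * cabs v ^+ 2 / e.
    by rewrite ltr_pdivlMr // mulrC; apply: le_lt_trans low small.
  move=> h; apply: lt_trans h _; exact: truncnS_gt.
rewrite -natrM ltr_nat in mnB.
have mB : (m < B)%N by nia. have nB : (n < B)%N by nia.
apply: le_trans (_ : T <= _); last by lra.
rewrite /T (bigD1_seq m) ?mem_index_iota ?iota_uniq //=.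
rewrite (bigD1_seq n) ?mem_index_iota ?iota_uniq //=.
apply: le_trans (_ : inv_factor v (om m n false) + inv_factor v (om m n true) <= _).
  by rewrite /w; case: (s); rewrite ?lerDl ?lerDr.
rewrite -addrA lerDl addr_ge0 ?sumr_ge0 // => [i _|i _]; first by rewrite addr_ge0.
by apply: sumr_ge0 => j _; rewrite addr_ge0.
Qed.

End Lattice.

(** * The inversion formula for the theta quotient *)

Section Inversion.
Context {R : realType}.
Implicit Types (x y z u v w t : Cplx R).

(* The factors of z prod' (1 - z^2 / w^2), one w taken from each pair {w, -w} of
   the lattice Z t + Z; those of w = m t + n and w = m t - n are grouped. *)
Definition cell t z (m n : nat) : Cplx R :=
  if m == 0%N then if n == 0%N then z else 1 - z ^+ 2 / n%:R ^+ 2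
  else if n == 0%N then 1 - z ^+ 2 / (m%:R * t) ^+ 2
  else (1 - z ^+ 2 / (m%:R * t + n%:R) ^+ 2) * (1 - z ^+ 2 / (m%:R * t - n%:R) ^+ 2).

Definition rect t z M N : Cplx R :=
  \prod_(0 <= m < M.+1) \prod_(0 <= n < N.+1) cell t z m n.

Lemma nat_lattice_neq0 t (m n : nat) (s : bool) : upper_half_plane t ->
  (m != 0%N) || (n != 0%N) -> m%:R * t + (-1) ^+ s * n%:R != 0.
Proof.
move=> ht mn; have := @lattice_neq0 R t m ((-1) ^+ s * n%:Z) ht.
rewrite intrM rmorphXn rmorphN1; apply.
by rewrite mulf_eq0 signr_eq0.
Qed.

(** Both sides are the product of (a + n + z) (a + n - z) / (a + n)^2 over |n| <= N, with a = (m +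
    1) t. *)
Lemma sine_partial_ratio t z m N : upper_half_plane t ->
  sine_partial (m.+1%:R * t + z) N * sine_partial (m.+1%:R * t - z) N /
    sine_partial (m.+1%:R * t) N ^+ 2 =
  \prod_(0 <= n < N.+1) cell t z m.+1 n.
Proof.
move=> ht; rewrite big_nat_recl //= /cell /=; set a := m.+1%:R * t.
have a0 : a != 0.
  by have := @nat_lattice_neq0 t m.+1 0 false ht isT; rewrite mulr0 addr0.
have ap n : a + n.+1%:R != 0.
  by have := @nat_lattice_neq0 t m.+1 n.+1 false ht isT; rewrite expr0 mul1r.
have am n : a - n.+1%:R != 0.
  by have := @nat_lattice_neq0 t m.+1 n.+1 true ht isT; rewrite expr1 mulN1r.
rewrite /sine_partial.
have -> (A B D : Cplx R) : (a + z) * A * ((a - z) * B) / (a * D) ^+ 2 =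
    ((a + z) * (a - z) / a ^+ 2) * (A * B / D ^+ 2).
  (* For D = 0 both sides are 0, since the inverse of 0 is 0. *)
  by have [->|D0] := eqVneq D 0; [rewrite mulr0 expr0n /= invr0 !mulr0|field; rewrite a0 D0].
congr (_ * _); first by field.
rewrite -prodrXl -prodfV -!big_split /=.
apply: eq_bigr => n _; have n0 : n.+1%:R != 0 :> Cplx R by rewrite pnatr_eq0.
move: (ap n) (am n) n0; move: (n.+1%:R : Cplx R) => k h1 h2 k0.
have h3 : k - a != 0 by rewrite -opprB oppr_eq0.
have h4 : k + a != 0 by rewrite addrC.
have d0 : 1 - a ^+ 2 / k ^+ 2 != 0.
  have -> : 1 - a ^+ 2 / k ^+ 2 = (k - a) * (k + a) / k ^+ 2 by field.
  by rewrite !mulf_neq0 ?invr_eq0 ?expf_neq0.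
have e0 : k ^+ 2 - a ^+ 2 != 0 by rewrite subr_sqr mulf_neq0.
by field; rewrite h1 h2 k0 -?expr2 e0.
Qed.

Lemma rect_sine t z M N : upper_half_plane t ->
  rect t z M N = sine_partial z N * \prod_(0 <= m < M)
    (sine_partial (m.+1%:R * t + z) N * sine_partial (m.+1%:R * t - z) N /
      sine_partial (m.+1%:R * t) N ^+ 2).
Proof.
move=> ht; rewrite /rect big_nat_recl //; congr (_ * _).
  by rewrite big_nat_recl.
by apply: eq_bigr => m _; rewrite sine_partial_ratio.
Qed.

Definition rect_row t z M : Cplx R := sn z / twopii R * \prod_(0 <= m < M)
  (sn (m.+1%:R * t + z) * sn (m.+1%:R * t - z) / sn (m.+1%:R * t) ^+ 2).

Lemma sn_lattice_neq0 t z m : off_lattice t z -> sn (m%:R * t + z) != 0.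
Proof.
move=> zt; apply/eqP => /sn_eq0[n hn]; have /negP := zt (- m%:Z) n; apply.
by apply/eqP; rewrite mulrNz mulNr -hn addrA addNr add0r.
Qed.

Lemma sn_multiple_neq0 t m : upper_half_plane t -> sn (m.+1%:R * t) != 0.
Proof.
move=> ht; apply/eqP => /sn_eq0[n hn].
have := @lattice_neq0 R t m.+1%:Z (- n) ht isT.
by rewrite mulrNz -hn subrr eqxx.
Qed.

Lemma off_latticeN t z : off_lattice t z -> off_lattice t (- z).
Proof.
move=> zt m n; have := zt (- m) (- n); rewrite !mulrNz mulNr -opprD.
by apply: contra => /eqP <-; rewrite opprK.
Qed.

Lemma rect_row_neq0 t z M : upper_half_plane t -> off_lattice t z -> rect_row t z M != 0.
Proof.
move=> ht zt; rewrite /rect_row; apply: mulf_neq0.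
  rewrite mulf_neq0 // ?invr_eq0 ?twopii_neq0 //.
  by have := sn_lattice_neq0 0 zt; rewrite mul0r add0r.
rewrite prodf_seq_neq0; apply/allP => m _; apply/implyP => _.
apply: mulf_neq0; last by rewrite invr_eq0 expf_neq0 // sn_multiple_neq0.
apply: mulf_neq0; first exact: sn_lattice_neq0.
exact: sn_lattice_neq0 (off_latticeN zt).
Qed.

Lemma rect_cvg_row t z M : upper_half_plane t -> rect t z M @ \oo --> rect_row t z M.
Proof.
move=> ht; have t0 := twopii_neq0 (R := R).
pose U N m := sine_partial (m.+1%:R * t + z) N * sine_partial (m.+1%:R * t - z) N /
      sine_partial (m.+1%:R * t) N ^+ 2 - 1.
pose V m := sn (m.+1%:R * t + z) * sn (m.+1%:R * t - z) / sn (m.+1%:R * t) ^+ 2 - 1.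
have UV m : (fun N => U N m) @ \oo --> V m.
  have s0 := sn_multiple_neq0 m ht.
  have n0 : sn (m.+1%:R * t) / twopii R * (sn (m.+1%:R * t) / twopii R) != 0.
    by rewrite !mulf_neq0 ?invr_eq0.
  have e1 := euler_sine (z := m.+1%:R * t + z); have e2 := euler_sine (z := m.+1%:R * t - z).
  have e3 := euler_sine (z := m.+1%:R * t).
  have h := cvgCB (cvgCM (cvgCM e1 e2) (cvgCV n0 (cvgCM e3 e3))) (cvgC_cst 1).
  have -> : V m = sn (m.+1%:R * t + z) / twopii R * (sn (m.+1%:R * t - z) / twopii R) /
     (sn (m.+1%:R * t) / twopii R * (sn (m.+1%:R * t) / twopii R)) - 1.
    by rewrite /V; move: s0 t0; move: (sn _) (twopii R) => a b a0 b0; field; rewrite a0 b0.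
  exact: h.
have h := cvgCM (euler_sine (z := z)) (cvg_prod_fin (s := index_iota 0 M) UV).
have -> : rect_row t z M = sn z / twopii R * \prod_(n <- index_iota 0 M) (1 + V n).
  by congr (_ * _); apply: eq_bigr => m _; rewrite /V addrCA subrr addr0.
apply: cvgC_ext _ h => N; rewrite rect_sine //.
by congr (_ * _); apply: eq_bigr => m _; rewrite /U addrCA subrr addr0.
Qed.

Lemma rect_row_cvg t z : upper_half_plane t -> rect_row t z @ \oo --> thK z t / twopii R.
Proof.
move=> ht; have h := cvgCM (thK_sine_prod (z := z) ht) (cvgC_cst (twopii R)^-1).
by apply: cvgC_ext _ h => M; rewrite /rect_row mulrAC.
Qed.

(** Division by t maps Z t + Z onto the lattice of -1/t and exchanges m and n up to sign. All cells
    are homogeneous of degree 0 except the corner cell z, whence the single factor t. *)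
Lemma cell_inversion t z m n : t != 0 ->
  cell t z m n = (if (m == 0%N) && (n == 0%N) then t else 1) * cell (- t^-1) (z / t) n m.
Proof.
move=> t0; rewrite /cell; have [m0|m0] := eqVneq m 0%N; have [n0|n0] := eqVneq n 0%N => /=.
- by field.
- rewrite mul1r; have : n%:R != 0 :> Cplx R by rewrite pnatr_eq0.
  by move: (n%:R : Cplx R) => k k0; congr (_ - _); field; rewrite t0 k0.
- rewrite mul1r; have : m%:R != 0 :> Cplx R by rewrite pnatr_eq0.
  by move: (m%:R : Cplx R) => k k0; congr (_ - _); field; rewrite t0 k0.
rewrite mul1r mulrC; move: (m%:R : Cplx R) (n%:R : Cplx R) => a b.
have -> : b * - t^-1 + a = (a * t - b) / t by field.
have -> : b * - t^-1 - a = - ((a * t + b) / t) by field.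
have E w : z ^+ 2 / w ^+ 2 = (z / t) ^+ 2 / (w / t) ^+ 2.
  have [->|w0] := eqVneq w 0; first by rewrite mul0r expr0n /= invr0 !mulr0.
  by field; rewrite t0 w0.
by rewrite sqrrN -!E.
Qed.

Lemma rect_inversion t z M N : t != 0 -> rect t z M N = t * rect (- t^-1) (z / t) N M.
Proof.
move=> t0; rewrite /rect exchange_big /=.
transitivity (\prod_(0 <= n < N.+1) \prod_(0 <= m < M.+1)
   ((if (m == 0%N) && (n == 0%N) then t else 1) * cell (- t^-1) (z / t) n m)).
  by apply: eq_bigr => n _; apply: eq_bigr => m _; exact: cell_inversion.
transitivity (\prod_(0 <= n < N.+1) ((\prod_(0 <= m < M.+1)
   (if (m == 0%N) && (n == 0%N) then t else 1)) * \prod_(0 <= m < M.+1) cell (- t^-1) (z / t) n m)).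
  by apply: eq_bigr => n _; rewrite big_split.
rewrite big_split /=; congr (_ * _).
rewrite big_nat_recl //= big_nat_recl //= big1 ?mulr1; last by [].
by rewrite big1 ?mulr1 // => n _; rewrite big1 // => m _; rewrite andbF.
Qed.

(* With z^2 + u^2 = v^2 the terms of order w^-2 cancel, so that the product of
   these ratios over the lattice converges absolutely. *)
Lemma ratio_factor z u v w : z ^+ 2 + u ^+ 2 = v ^+ 2 -> w != 0 -> 1 - v ^+ 2 / w ^+ 2 != 0 ->
  (1 - z ^+ 2 / w ^+ 2) * (1 - u ^+ 2 / w ^+ 2) / (1 - v ^+ 2 / w ^+ 2) - 1 =
  (z * u) ^+ 2 / (w ^+ 2) ^+ 2 / (1 - v ^+ 2 / w ^+ 2).
Proof.
move=> E w0 d0.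
have -> : (1 - z ^+ 2 / w ^+ 2) * (1 - u ^+ 2 / w ^+ 2) =
   (1 - v ^+ 2 / w ^+ 2) + (z * u) ^+ 2 / (w ^+ 2) ^+ 2.
  by rewrite -E; field.
by rewrite mulrDl divff // addrAC subrr add0r.
Qed.

Lemma off_lattice_factor t v m n (s : bool) : upper_half_plane t -> off_lattice t v ->
  (m != 0%N) || (n != 0%N) -> 1 - v ^+ 2 / (m%:R * t + (-1) ^+ s * n%:R) ^+ 2 != 0.
Proof.
move=> ht vt mn; have w0 := @nat_lattice_neq0 t m n s ht mn.
have E : (m%:R * t + (-1) ^+ s * n%:R : Cplx R) = m%:Z%:~R * t + ((-1) ^+ s * n%:Z)%:~R.
  by rewrite intrM rmorphXn rmorphN1.
set w := _ + _ in w0 E *.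
have -> : 1 - v ^+ 2 / w ^+ 2 = (w - v) * (w + v) / w ^+ 2 by field.
rewrite mulf_neq0 ?invr_eq0 ?expf_neq0 // mulf_neq0 //.
  by rewrite subr_eq0 eq_sym E vt.
by rewrite -[v]opprK subr_eq0 eq_sym E; apply: off_latticeN.
Qed.

Lemma rect_ratio_bound t z u v : upper_half_plane t -> off_lattice t v ->
  z ^+ 2 + u ^+ 2 = v ^+ 2 -> exists2 C : R, 0 <= C & forall m n,
  cabs (cell t z m n * cell t u m n / cell t v m n - 1) <=
    C * ((m.+1%:R ^+ 2)^-1 * (n.+1%:R ^+ 2)^-1).
Proof.
move=> ht vt E; have [e e0 He] := lattice_lower ht; have [D D0 HD] := inv_factor_bound v ht.
pose om (m n : nat) (s : bool) : Cplx R := m%:R * t + (-1) ^+ s * n%:R.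
pose C1 := cabs (z * u) ^+ 2 * D / e ^+ 2.
have C10 : 0 <= C1 by rewrite !mulr_ge0 ?exprn_ge0 ?cabs_ge0 ?invr_ge0 ?exprn_ge0 // ltW.
pose rho w := (1 - z ^+ 2 / w ^+ 2) * (1 - u ^+ 2 / w ^+ 2) / (1 - v ^+ 2 / w ^+ 2) - 1.
have Hrho m n s : (m != 0%N) || (n != 0%N) ->
    cabs (rho (om m n s)) <= C1 * ((m.+1%:R ^+ 2)^-1 * (n.+1%:R ^+ 2)^-1).
  move=> mn; rewrite /rho ratio_factor //; last exact: off_lattice_factor.
    have w0 := @nat_lattice_neq0 t m n s ht mn.
    have low : e * (m.+1%:R * n.+1%:R) <= cabs (om m n s) ^+ 2.
      have := He m ((-1) ^+ s * n%:Z).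
      have -> : absz ((-1) ^+ s * n%:Z) = n by rewrite abszMsign.
      rewrite intrM rmorphXn rmorphN1; apply.
      by rewrite mulf_eq0 signr_eq0.
    have p0 : 0 < e * (m.+1%:R * n.+1%:R) by rewrite !mulr_gt0.
    rewrite cabsM cabsV -/(inv_factor v (om m n s)) cabsM cabsV !cabsX.
    have -> : C1 * ((m.+1%:R ^+ 2)^-1 * (n.+1%:R ^+ 2)^-1) =
       cabs (z * u) ^+ 2 / (e * (m.+1%:R * n.+1%:R)) ^+ 2 * D.
      rewrite /C1; have : m.+1%:R != 0 :> R by rewrite pnatr_eq0.
      have : n.+1%:R != 0 :> R by rewrite pnatr_eq0.
      move: (m.+1%:R : R) (n.+1%:R : R) => a b b0 a0.
      by field; rewrite a0 b0 gt_eqF.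
    apply: ler_pM; rewrite ?HD ?mulr_ge0 ?invr_ge0 ?exprn_ge0 ?cabs_ge0 //.
    rewrite ler_wpM2l ?exprn_ge0 ?cabs_ge0 // lef_pV2 ?posrE ?exprn_gt0 //.
      by rewrite lerXn2r ?nnegrE ?exprn_ge0 ?cabs_ge0 // ltW.
    by rewrite cabs_gt0.
  exact: nat_lattice_neq0.
(* The first term is the corner cell; the others come from rho1 + rho2 + rho1 rho2 for the grouped
   points m t + n and m t - n. *)
pose C := cabs (z * u / v - 1) + (2 * C1 + C1 * C1).
have C11 : 0 <= C1 * C1 by exact: mulr_ge0.
have C0 : 0 <= C by have := cabs_ge0 (z * u / v - 1); rewrite /C; lra.
exists C => // m n.
have ale k : 0 <= (k.+1%:R ^+ 2 : R)^-1 <= 1.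
  rewrite invr_ge0 sqr_ge0 /= invf_le1 ?exprn_gt0 ?ltr0n // expr_ge1 // ?ler0n //.
  by rewrite ler1n.
have /andP[m0 m1] := ale m; have /andP[n0 n1] := ale n.
have {}Hrho sg := Hrho m n sg.
move: m0 m1 n0 n1 Hrho; set am := (m.+1%:R ^+ 2)^-1; set an := (n.+1%:R ^+ 2)^-1 => m0 m1 n0 n1 Hrho.
have A0 : 0 <= am * an by exact: mulr_ge0.
have A1 : am * an <= 1 by rewrite mulr_ile1.
have [mn|mn] := boolP ((m == 0%N) && (n == 0%N)).
  case/andP: mn => /eqP mE /eqP nE; rewrite /am /an mE nE /cell /= expr1n invr1 !mulr1.
  by rewrite /C lerDl; lra.
have mn' : (m != 0%N) || (n != 0%N) by rewrite -negb_and.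
have {}Hrho sg := Hrho sg mn'.
have C1A : 0 <= C1 * (am * an) by exact: mulr_ge0.
have [mn0|mn0] := boolP ((m == 0%N) || (n == 0%N)).
  have cE x : cell t x m n = 1 - x ^+ 2 / (om m n false) ^+ 2.
    rewrite /cell /om expr0 mul1r; case/orP: mn0 mn' => /eqP ->.
      by rewrite eqxx /= => /negPf ->; rewrite mul0r add0r.
    by rewrite eqxx orbF => /negPf ->; rewrite addr0.
  rewrite !cE; apply: le_trans (Hrho false) _; rewrite ler_wpM2r //.
  have := cabs_ge0 (z * u / v - 1); have : 0 <= C1 * C1 by exact: mulr_ge0.
  rewrite /C; lra.
have cE x : cell t x m n = (1 - x ^+ 2 / (om m n false) ^+ 2) * (1 - x ^+ 2 / (om m n true) ^+ 2).
  rewrite /cell /om expr0 mul1r expr1 mulN1r; move: mn0; rewrite negb_or => /andP[].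
  by move=> /negPf -> /negPf ->.
have -> : cell t z m n * cell t u m n / cell t v m n - 1 =
   rho (om m n false) + rho (om m n true) + rho (om m n false) * rho (om m n true).
  rewrite !cE /rho !invfM; ring.
apply: le_trans (cabsD _ _) _; rewrite cabsM.
have := cabsD (rho (om m n false)) (rho (om m n true)).
have h1 := Hrho false; have h2 := Hrho true.
have : cabs (rho (om m n false)) * cabs (rho (om m n true)) <= C1 * (am * an) * C1.
  apply: ler_pM; rewrite ?cabs_ge0 //; apply: le_trans h2 _.
  by rewrite ler_piMr.
have := cabs_ge0 (z * u / v - 1) => h3.
have : 0 <= cabs (z * u / v - 1) * (am * an) by exact: mulr_ge0.
rewrite /C; lra.
Qed.

Lemma upper_inv t : upper_half_plane t -> upper_half_plane (- t^-1).
Proof.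
move=> ht; have t0 := upper_neq0 ht; move: ht t0; rewrite /upper_half_plane /=.
case: t => x y /= y0 _; rewrite opprK divr_gt0 //.
by rewrite ltr_wpDl ?sqr_ge0 // exprn_gt0.
Qed.

Lemma off_lattice_inv t v : t != 0 -> off_lattice t v -> off_lattice (- t^-1) (v / t).
Proof.
move=> t0 vt m n; have := vt n (- m); apply: contra => /eqP h.
by rewrite -[v](divfK t0) h mulrNz; apply/eqP; field.
Qed.

Lemma rect_ratio_cvg_row t z u v M : upper_half_plane t -> off_lattice t v ->
  (fun N => rect t z M N * rect t u M N / rect t v M N) @ \oo -->
    rect_row t z M * rect_row t u M / rect_row t v M.
Proof.
move=> ht vt; have n0 := rect_row_neq0 M ht vt.
have h1 := rect_cvg_row (z := z) (M := M) ht.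
have h2 := rect_cvg_row (z := u) (M := M) ht.
have h3 := rect_cvg_row (z := v) (M := M) ht.
exact: (cvgCM (cvgCM h1 h2) (cvgCV n0 h3)).
Qed.

Lemma rect_row_ratio_cvg t z u v : upper_half_plane t -> off_lattice t v ->
  (fun M => rect_row t z M * rect_row t u M / rect_row t v M) @ \oo -->
    thK z t * thK u t / thK v t / twopii R.
Proof.
move=> ht vt; have n0 := thK_neq0 ht vt; have t0 := twopii_neq0 (R := R).
have n1 : thK v t / twopii R != 0 by rewrite mulf_neq0 // invr_eq0.
have h1 := rect_row_cvg (z := z) ht.
have h2 := rect_row_cvg (z := u) ht.
have h3 := rect_row_cvg (z := v) ht.
have -> : thK z t * thK u t / thK v t / twopii R =
   thK z t / twopii R * (thK u t / twopii R) / (thK v t / twopii R).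
  by field; rewrite t0 n0.
exact: (cvgCM (cvgCM h1 h2) (cvgCV n1 h3)).
Qed.

(** By [rect_inversion] the rectangles for t and -1/t agree up to the factor t with M and N
    exchanged, so the two sides are the two iterated limits of one double product. Of the factors t,
    two come from the numerator and one from the denominator. *)
Lemma thK_ratio_inversion t z u v : upper_half_plane t -> off_lattice t v ->
  z ^+ 2 + u ^+ 2 = v ^+ 2 ->
  thK z t * thK u t / thK v t =
  t * (thK (z / t) (- t^-1) * thK (u / t) (- t^-1) / thK (v / t) (- t^-1)).
Proof.
move=> ht vt E; have t0 := upper_neq0 ht; have tp0 := twopii_neq0 (R := R).
have ht' := upper_inv ht; have vt' := off_lattice_inv t0 vt.
have [C C0 HC] := rect_ratio_bound ht vt E.
pose r m n := cell t z m n * cell t u m n / cell t v m n - 1.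
pose al n := (n.+1%:R ^+ 2)^-1 : R.
have al1 n : al n <= 1.
  by rewrite /al invf_le1 ?exprn_gt0 ?ltr0n // expr_ge1 ?ler0n // ler1n.
have QE M N : \prod_(0 <= m < M.+1) \prod_(0 <= n < N.+1) (1 + r m n) =
    rect t z M N * rect t u M N / rect t v M N.
  rewrite /rect -prodfV -!big_split /=; apply: eq_bigr => m _.
  rewrite -prodfV -!big_split /=; apply: eq_bigr => n _.
  by rewrite /r addrCA subrr addr0.
pose cl N := t * (rect_row (- t^-1) (z / t) N * rect_row (- t^-1) (u / t) N /
   rect_row (- t^-1) (v / t) N).
have h : thK z t * thK u t / thK v t / twopii R =
   t * (thK (z / t) (- t^-1) * thK (u / t) (- t^-1) / thK (v / t) (- t^-1) / twopii R).
  apply: (prod_order_exchange (r := r) (al := al) (cl := cl) C0 summable_inv_sqr al1 HC _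
    (rect_row_ratio_cvg (z := z) (u := u) ht vt)).
  - move=> M; apply: cvgC_ext _ (rect_ratio_cvg_row (z := z) (u := u) (M := M) ht vt) => N.
    by rewrite QE.
  - move=> N; have hh := cvgCM (cvgC_cst t)
      (rect_ratio_cvg_row (z := z / t) (u := u / t) (M := N) ht' vt').
    apply: cvgC_ext _ hh => M; rewrite QE !(rect_inversion _ M N t0).
    by rewrite invfM; move: (rect _ _ _ _)^-1 => q; field.
  - exact: cvgCM (cvgC_cst t) (rect_row_ratio_cvg ht' vt').
by move: h; rewrite mulrA => /(mulIf _); apply; rewrite invr_eq0.
Qed.

Lemma thK_addn z t (n : nat) : thK (z + n%:R) t = (-1) ^+ n * thK z t.
Proof.
elim: n => [|n IH]; first by rewrite addr0 mul1r.
by rewrite -natr1 addrA thK_add1 IH exprS mulN1r mulNr.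
Qed.

Lemma thK_addz z t (n : int) : thK (z + n%:~R) t = (-1) ^ n * thK z t.
Proof.
case: n => n; first exact: thK_addn.
rewrite NegzE mulrNz -[z in RHS](subrK (n.+1%:~R)) thK_addn mulrA.
have -> : (-1) ^ (- n.+1%:Z) = (-1) ^+ n.+1 :> Cplx R.
  by rewrite -invr_expz -exprVn invrN1.
by rewrite -exprD addnn -mul2n exprM sqrrN expr1n expr1n mul1r.
Qed.

Lemma thK_addnt z t (n : nat) : upper_half_plane t ->
  thK (z + n%:R * t) t = (-1) ^+ n * ec (- (n%:R ^+ 2 * t / 2) - n%:R * z) * thK z t.
Proof.
move=> ht; elim: n => [|n IH].
  have -> : - (0%:R ^+ 2 * t / 2) - 0%:R * z = 0 by ring.
  by rewrite mul0r addr0 expr0 ec0 !mul1r.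
rewrite -natr1 mulrDl mul1r addrA thK_addt // IH [(-1) ^+ n.+1]exprS.
set k : Cplx R := n%:R.
have -> : ec (- ((k + 1) ^+ 2 * t / 2) - (k + 1) * z) =
   ec (- (t / 2) - (z + k * t)) * ec (- (k ^+ 2 * t / 2) - k * z).
  by rewrite -ecD; congr ec; field.
ring.
Qed.

Lemma thK_lattice t (m n : int) : upper_half_plane t -> thK (m%:~R * t + n%:~R) t = 0.
Proof.
move=> ht; have H (k : nat) (j : int) : thK (j%:~R + k%:R * t) t = 0.
  by rewrite thK_addnt // -[j%:~R]add0r thK_addz thK_0 !mulr0.
case: m => k; first by rewrite addrC; exact: H.
have -> : (Negz k)%:~R * t + n%:~R = - ((- n)%:~R + k.+1%:R * t).
  by rewrite NegzE !mulrNz; ring.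
by rewrite thKN H oppr0.
Qed.

(** Write y = a t + b with a, b real. If the point were m t + n, then 2 a = k (2 m - k) and b = k n
    would be multiples of k; for k > |2 a| + |b| both would vanish. *)
Lemma off_lattice_multiple t y : upper_half_plane t -> y != 0 ->
  exists2 k : nat, (0 < k)%N & off_lattice t (y / k%:R + k%:R * t / 2).
Proof.
move=> ht y0; pose a := complex.Im y / complex.Im t.
have yt : 0 < complex.Im t := ht.
pose b := complex.Re (y - a%:C%C * t).
have yE : y = a%:C%C * t + b%:C%C.
  have h : complex.Im (y - a%:C%C * t) = 0.
    by rewrite /a; case: (y) (t) yt => y1 y2 [t1 t2] /= yt; field; rewrite gt_eqF.
  have hb : y - a%:C%C * t = b%:C%C by rewrite /b; case: (y - _) h => p q /= ->.
  by rewrite -hb addrC subrK.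
pose k := (Num.trunc (`|2 * a| + `|b|)).+1; exists k => // m n; apply/eqP => E.
have kb : `|2 * a| + `|b| < k%:R by exact: truncnS_gt.
have kC0 : k%:R != 0 :> Cplx R by rewrite pnatr_eq0.
have {}E : a%:C%C * t + b%:C%C = (k%:R * (m%:~R - k%:R / 2))%:C%C * t + (k%:R * n%:~R)%:C%C.
  rewrite -yE !rmorphM rmorphB /= -!intr_complexE -!natr_complexE fmorph_div /= rmorph_nat -natr_complexE.
  have -> : y = k%:R * (y / k%:R + k%:R * t / 2) - k%:R ^+ 2 * t / 2 by field.
  by rewrite E; field.
have Ea : a = k%:R * (m%:~R - k%:R / 2).
  have := congr1 (@complex.Im R) E; rewrite !Im_real_lin => /mulIf; apply.
  by rewrite gt_eqF.
have Eb : b = k%:R * n%:~R by move: E; rewrite Ea => /addrI [].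
have k0 : (0 : R) < k%:R by rewrite ltr0n.
have small (x : R) (j : int) : `|x| < k%:R -> x = k%:R * j%:~R -> x = 0.
  move=> xk xE; move: xk; rewrite xE normrM gtr0_norm // -{2}[k%:R]mulr1 ltr_pM2l //.
  rewrite -intr_norm -[1]/(1%:~R) ltr_int => h.
  have -> : j = 0 by lia.
  by rewrite mulr0.
have a0 : 2 * a = 0.
  apply: (small _ (2 * m - k%:Z)); first by have := normr_ge0 b; lra.
  by rewrite Ea rmorphB rmorphM /=; field.
have b0 : b = 0 by apply: (small _ n) Eb; have := normr_ge0 (2 * a); lra.
have a00 : a = 0 by lra.
by move: y0; rewrite yE a00 b0 mul0r add0r eqxx.
Qed.

(* In thK_ratio_inversion take v = u + k t: the quasi-periods turn both
   quotients thK u / thK v into explicit factors. *)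
Theorem thK_inversion z t : upper_half_plane t ->
  t * thK (z / t) (- t^-1) = ec (z ^+ 2 / (2 * t)) * thK z t.
Proof.
move=> ht; have t0 := upper_neq0 ht; have ht' := upper_inv ht.
have [[m [n zE]]|zt] := pselect (exists m n : int, z = m%:~R * t + n%:~R).
  have -> : z / t = (- n)%:~R * - t^-1 + m%:~R by rewrite zE mulrNz; field.
  by rewrite zE !thK_lattice // !mulr0.
have {}zt : off_lattice t z.
  by move=> m n; apply/eqP => h; apply: zt; exists m, n.
have z0 : z != 0 by have := zt 0 0; rewrite mul0r addr0.
have y0 : z ^+ 2 / (2 * t) != 0 by rewrite mulf_neq0 ?expf_neq0 // invr_eq0 mulf_neq0.
have [k k0 vt] := off_lattice_multiple ht y0.
have kC0 : k%:R != 0 :> Cplx R by rewrite pnatr_eq0 -lt0n.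
(* Here v + u = z^2 / (k t) and v - u = k t, so v^2 - u^2 = z^2. *)
set v := _ + _ in vt; pose u := z ^+ 2 / (2 * t) / k%:R - k%:R * t / 2.
have vE : v = u + k%:R * t by rewrite /v /u; field; rewrite t0 kC0.
have E : z ^+ 2 + u ^+ 2 = v ^+ 2 by rewrite /v /u; field; rewrite t0 kC0.
have Kv := thK_neq0 ht vt; have Kv' := thK_neq0 ht' (off_lattice_inv t0 vt).
have H := thK_ratio_inversion ht vt E.
have K1 : thK v t = (-1) ^+ k * ec (- (k%:R ^+ 2 * t / 2) - k%:R * u) * thK u t.
  by rewrite vE thK_addnt.
have K2 : thK (v / t) (- t^-1) = (-1) ^+ k * thK (u / t) (- t^-1).
  have -> : v / t = u / t + k%:R by rewrite vE; field.
  exact: thK_addn.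
rewrite K1 in Kv H; rewrite K2 in Kv' H.
have sgn0 : (-1) ^+ k != 0 :> Cplx R by rewrite signr_eq0.
have Ku : thK u t != 0 by apply: contraNneq Kv => ->; rewrite mulr0.
have Ku' : thK (u / t) (- t^-1) != 0 by apply: contraNneq Kv' => ->; rewrite mulr0.
have e0 := ec_neq0 (- (k%:R ^+ 2 * t / 2) - k%:R * u).
have -> : ec (z ^+ 2 / (2 * t)) = (ec (- (k%:R ^+ 2 * t / 2) - k%:R * u))^-1.
  by rewrite -ecN; congr ec; rewrite /u; field; rewrite t0 kC0.
move: H sgn0 Ku Ku' e0; clear.
move: (ec _) (thK u t) (thK (u / t) _) ((-1) ^+ k) (thK (z / t) _) (thK z t).
move=> c A B s P Q H s0 A0 B0 c0.
have -> : t * P = t * (P * B / (s * B)) * s by field; rewrite s0 B0.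
by rewrite -H; field; rewrite c0 A0 s0.
Qed.

End Inversion.

(** * Action of SL_2(Z), and eta squared through 2-torsion *)

Section Modular.
Context {R : realType}.
Implicit Types (x y z u v w t q : Cplx R).

(* Generation of SL_2(Z) by S and T, acting on the right. *)
Lemma sl2_ind (P : int -> int -> int -> int -> Prop) :
  P 1 0 0 1 ->
  (forall a b c d : int, a * d - b * c = 1 -> P a b c d -> P a (a + b) c (c + d)) ->
  (forall a b c d : int, a * d - b * c = 1 -> P a b c d -> P a (b - a) c (d - c)) ->
  (forall a b c d : int, a * d - b * c = 1 -> P a b c d -> P b (- a) d (- c)) ->
  forall a b c d : int, a * d - b * c = 1 -> P a b c d.
Proof.
move=> P1 PT PT' PS.
have PTn (k a b c d : int) : a * d - b * c = 1 -> P a b c d -> P a (b + k * a) c (d + k * c).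
  case: k => k.
    elim: k a b c d => [|k IH] a b c d h p; first by rewrite !mul0r !addr0.
    have := PT _ _ _ _ _ (IH _ _ _ _ h p).
    have -> : a + (b + k%:Z * a) = b + k.+1%:Z * a by lia.
    have -> : c + (d + k%:Z * c) = d + k.+1%:Z * c by lia.
    by apply; lia.
  rewrite NegzE; elim: k a b c d => [|k IH] a b c d h p.
    by have := PT' _ _ _ _ h p; rewrite !mulN1r.
  have := PT' _ _ _ _ _ (IH _ _ _ _ h p).
  have -> : b + - (k.+1)%:Z * a - a = b + - (k.+2)%:Z * a by lia.
  have -> : d + - (k.+1)%:Z * c - c = d + - (k.+2)%:Z * c by lia.
  by apply; lia.
have PS2 (a b c d : int) : a * d - b * c = 1 -> P a b c d -> P (- a) (- b) (- c) (- d).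
  by move=> h p; apply: (PS b (- a) d (- c)); [lia|exact: PS].
have PS' (a b c d : int) : a * d - b * c = 1 -> P b (- a) d (- c) -> P a b c d.
  move=> h p; have := PS _ _ _ _ _ (PS2 _ _ _ _ _ p); rewrite !opprK; apply; lia.
have main (n : nat) : forall a b c d : int, (`|c| <= n)%N -> a * d - b * c = 1 -> P a b c d.
  elim: n => [|n IH] a b c d cn h.
    have c0 : c = 0 by lia.
    rewrite c0 mulr0 subr0 in h *.
    have [[-> ->]|[-> ->]] : (a = 1 /\ d = 1) \/ (a = -1 /\ d = -1).
      have : (a %| 1)%Z by apply/dvdzP; exists d; rewrite mulrC.
      rewrite dvdz1 => /eqP a1; have [aE|aE] : a = 1 \/ a = -1 by lia.
        by left; split => //; rewrite aE mul1r in h.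
      by right; split => //; rewrite aE mulN1r in h; lia.
      by have := PTn b 1 0 0 1 erefl P1; rewrite mulr1 mulr0 add0r addr0.
    have p := PS2 1 0 0 1 erefl P1; rewrite oppr0 in p.
    by have := PTn (- b) (-1) 0 0 (-1) erefl p; rewrite mulrN mulr1 opprK mulr0 addr0 add0r.
  have [c0|c0] := eqVneq c 0; first by apply: IH => //; rewrite c0.
  (* Euclid's algorithm on the bottom row: a power of T reduces d modulo c, and S moves the
     remainder to the lower left, where the induction on |c| applies. *)
  pose k : int := - (d %/ c)%Z.
  have dE : d + k * c = (d %% c)%Z by rewrite {1}(divz_eq d c) /k; ring.
  have dlt : (absz (d + k * c)%R < absz c)%N.
    rewrite dE; have := modz_ge0 d c0; have := ltz_mod d c0; lia.
  have h' : a * (d + k * c) - (b + k * a) * c = 1 by rewrite -h; ring.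
  have p : P (b + k * a) (- a) (d + k * c) (- c) by apply: IH; [lia|rewrite -h'; ring].
  have := PTn (- k) _ _ _ _ h' (PS' _ _ _ _ h' p).
  have -> : b + k * a + - k * a = b by ring.
  by have -> : d + k * c + - k * c = d by ring.
by move=> a b c d; exact: (main `|c|%N).
Qed.

Definition den (c d : int) t : Cplx R := c%:~R * t + d%:~R.
Definition mob (a b c d : int) t : Cplx R := (a%:~R * t + b%:~R) / den c d t.

Lemma den_neq0 (a b c d : int) t : a * d - b * c = 1 -> upper_half_plane t -> den c d t != 0.
Proof.
move=> h ht; apply: lattice_neq0 => //; apply/negPn; rewrite negb_or !negbK.
apply/negP => /andP[/eqP c0 /eqP d0]; move: h; rewrite c0 d0 !mulr0; lia.
Qed.

Lemma upper_add1 t (n : int) : upper_half_plane t -> upper_half_plane (t + n%:~R).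
Proof. by rewrite /upper_half_plane /= intr_complexE; case: t => x y /=; rewrite addr0. Qed.

Lemma mobT (a b c d : int) t (n : int) : mob a (b + n * a) c (d + n * c) t = mob a b c d (t + n%:~R).
Proof.
rewrite /mob /den !intrD !intrM; congr (_ / _); ring.
Qed.

Lemma denT (c d : int) t (n : int) : den c (d + n * c) t = den c d (t + n%:~R).
Proof. by rewrite /den intrD intrM; ring. Qed.

Lemma denS (c d : int) t : t != 0 -> den d (- c) t = t * den c d (- t^-1).
Proof. by move=> t0; rewrite /den mulrNz; field. Qed.

Lemma mobS (a b c d : int) t : t != 0 -> mob b (- a) d (- c) t = mob a b c d (- t^-1).
Proof.
move=> t0; rewrite /mob denS //.
have -> : b%:~R * t + (- a)%:~R = t * (a%:~R * - t^-1 + b%:~R) by rewrite mulrNz; field.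
by rewrite -mulf_div divff // mul1r.
Qed.

Lemma mob1 t : mob 1 0 0 1 t = t.
Proof. by rewrite /mob /den mul1r mul0r add0r addr0 divr1. Qed.

Lemma den1 t : den 0 1 t = 1.
Proof. by rewrite /den mul0r add0r. Qed.

Lemma upper_mob (a b c d : int) : a * d - b * c = 1 ->
  forall t, upper_half_plane t -> upper_half_plane (mob a b c d t).
Proof.
move: a b c d; apply: sl2_ind => [t|a b c d h IH t ht|a b c d h IH t ht|a b c d h IH t ht].
- by rewrite mob1.
- have := mobT a b c d t 1; rewrite !mul1r [b + a]addrC [d + c]addrC => ->.
  exact/IH/upper_add1.
- have := mobT a b c d t (-1); rewrite !mulN1r => ->.
  exact/IH/upper_add1.
rewrite mobS ?upper_neq0 //; exact/IH/upper_inv.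
Qed.

(** The law of a Jacobi form of weight -1 and index 1/2, with trivial multiplier. It propagates
    along T by [thK_period] and along S by [thK_inversion]. *)
Lemma thK_modular (a b c d : int) : a * d - b * c = 1 ->
  forall z t, upper_half_plane t ->
  thK (z / den c d t) (mob a b c d t) =
  (den c d t)^-1 * ec (c%:~R * z ^+ 2 / (2 * den c d t)) * thK z t.
Proof.
move: a b c d; apply: sl2_ind => [z t ht|a b c d h IH z t ht|a b c d h IH z t ht|a b c d h IH z t ht].
- by rewrite mob1 den1 divr1 invr1 !mul0r ec0 !mul1r.
- have hm := mobT a b c d t 1; have hd := denT c d t 1.
  rewrite !mul1r [b + a]addrC [d + c]addrC in hm hd; rewrite hm hd IH; last exact: upper_add1.
  by rewrite thK_period.
- have hm := mobT a b c d t (-1); have hd := denT c d t (-1).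
  rewrite !mulN1r in hm hd; rewrite hm hd IH; last exact: upper_add1.
  by rewrite -(thK_period z (t + (-1)%:~R)) -addrA addNr addr0.
have t0 := upper_neq0 ht; have ht' := upper_inv ht.
rewrite mobS //; have d0 := den_neq0 h ht'; have dE := denS c d t0.
set D := den c d (- t^-1) in d0 dE *.
have -> : z / den d (- c) t = z / t / D by rewrite dE; field; rewrite t0 d0.
have H := IH (z / t) _ ht'; rewrite -/D in H.
have H2 : thK (z / t) (- t^-1) = t^-1 * (ec (z ^+ 2 / (2 * t)) * thK z t).
  by rewrite -thK_inversion // mulKf.
rewrite H H2.
have -> : ec (d%:~R * z ^+ 2 / (2 * den d (- c) t)) =
    ec (c%:~R * (z / t) ^+ 2 / (2 * D)) * ec (z ^+ 2 / (2 * t)).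
  rewrite -ecD; congr ec.
  have dd : d%:~R = D + c%:~R / t by rewrite /D /den; field.
  by rewrite dE dd; field; rewrite t0 d0.
by rewrite dE [(t * D)^-1]invfM; ring.
Qed.

(* The square of the Dedekind eta function. *)
Definition eta2 t : Cplx R := ec (t / 12) * qpoch (ec t) (ec t) ^+ 2.

Lemma eta2_neq0 t : upper_half_plane t -> eta2 t != 0.
Proof.
by move=> ht; rewrite mulf_neq0 ?ec_neq0 // expf_neq0 // qpochqq_neq0 // cabs_ec_lt1.
Qed.

Lemma qpoch_sqr_base x q : cabs q < 1 ->
  qpoch x q * qpoch (- x) q = qpoch (x ^+ 2) (q ^+ 2).
Proof.
move=> q1; apply/esym/qpoch_unique; first by rewrite cabsX exprn_ilt1 ?cabs_ge0.
apply: cvgC_ext _ (cvgCM (qpoch_cvg x q1) (qpoch_cvg (- x) q1)) => N.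
by rewrite -big_split /=; apply: eq_bigr => n _; rewrite -exprM mulnC exprM; ring.
Qed.

Lemma qpoch_cube_base x q w : cabs q < 1 -> 1 + w + w ^+ 2 = 0 ->
  qpoch x q * qpoch (w * x) q * qpoch (w ^+ 2 * x) q = qpoch (x ^+ 3) (q ^+ 3).
Proof.
move=> q1 hw; apply/esym/qpoch_unique; first by rewrite cabsX exprn_ilt1 ?cabs_ge0.
apply: cvgC_ext _ (cvgCM (cvgCM (qpoch_cvg x q1) (qpoch_cvg (w * x) q1)) (qpoch_cvg (w ^+ 2 * x) q1)) => N.
rewrite -!big_split /=; apply: eq_bigr => n _; rewrite -exprM mulnC exprM.
have -> : x ^+ 3 * (q ^+ n) ^+ 3 = (x * q ^+ n) ^+ 3 by rewrite exprMn.
rewrite -!mulrA; set y := x * _.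
have w3 : w ^+ 3 = 1.
  apply/eqP; rewrite -subr_eq0; apply/eqP; rewrite -[RHS](mulr0 (w - 1)) -hw; ring.
transitivity (1 - y * (1 + w + w ^+ 2) + w * y ^+ 2 * (1 + w + w ^+ 2) - w ^+ 3 * y ^+ 3).
  ring.
by rewrite w3 hw; ring.
Qed.

Lemma qpoch_split2 x q : cabs q < 1 -> qpoch x (q ^+ 2) * qpoch (x * q) (q ^+ 2) = qpoch x q.
Proof.
move=> q1; have q21 : cabs (q ^+ 2) < 1 by rewrite cabsX exprn_ilt1 ?cabs_ge0.
have h := cvgC_subseq (g := fun n => (2 * n)%N) (fun n => leq_pmull n (isT : (0 < 2)%N)) (qpoch_cvg x q1).
apply: cvgC_unique (cvgCM (qpoch_cvg x q21) (qpoch_cvg (x * q) q21)) _.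
apply: cvgC_ext _ h => N /=; elim: N => [|N IH]; first by rewrite !big_geq // mulr1.
rewrite mulnS !big_nat_recr //= IH -!exprM [q ^+ (2 * N).+1]exprS; ring.
Qed.

Lemma qpoch_split3 x q : cabs q < 1 ->
  qpoch x (q ^+ 3) * qpoch (x * q) (q ^+ 3) * qpoch (x * q ^+ 2) (q ^+ 3) = qpoch x q.
Proof.
move=> q1; have q31 : cabs (q ^+ 3) < 1 by rewrite cabsX exprn_ilt1 ?cabs_ge0.
have h := cvgC_subseq (g := fun n => (3 * n)%N) (fun n => leq_pmull n (isT : (0 < 3)%N)) (qpoch_cvg x q1).
apply: cvgC_unique (cvgCM (cvgCM (qpoch_cvg x q31) (qpoch_cvg (x * q) q31)) (qpoch_cvg (x * q ^+ 2) q31)) _.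
apply: cvgC_ext _ h => N /=; elim: N => [|N IH]; first by rewrite !big_geq // !mulr1.
rewrite mulnS !big_nat_recr //= IH -!exprM [q ^+ (3 * N).+2]exprS [q ^+ (3 * N).+1]exprS; ring.
Qed.

Lemma thK_qpoch z t : upper_half_plane t ->
  thK z t = - ec (- (z / 2)) * (qpoch (ec z) (ec t) * qpoch (ec t / ec z) (ec t)) /
    qpoch (ec t) (ec t) ^+ 2.
Proof.
move=> /cabs_ec_lt1 q1; rewrite /thK sn_mul [qpoch (ec z) _]qpoch_shift // [ec z * _]mulrC.
congr (_ / _); ring.
Qed.

Lemma thK_sub1 z t : thK (z - 1) t = - thK z t.
Proof. by rewrite -[z in RHS](subrK 1) thK_add1 opprK. Qed.

(* The product of thK over the nonzero 2-torsion points is eta^-6, and over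
   half of the nonzero 3-torsion points eta^-8, up to elementary factors; as
   t |-> -1/t permutes torsion points, dividing gives the transformation of eta^2. *)
Definition torsion2 t := ec (t / 4) * thK (1 / 2) t * thK (t / 2) t * thK ((t + 1) / 2) t.

(** Euler's identity between partitions into distinct and into odd parts: (q; q) times (-q; q) is
    (q^2; q^2), which the odd factors complete to (q; q) again. *)
Lemma euler_odd_distinct q : cabs q < 1 -> qpoch (- q) q * qpoch q (q ^+ 2) = 1.
Proof.
move=> q1; have n0 := qpochqq_neq0 q1; apply: (mulIf n0); rewrite mul1r.
rewrite mulrAC [X in X * _]mulrC qpoch_sqr_base // -[in RHS](qpoch_split2 q q1) -expr2.
by rewrite mulrC.
Qed.

(** The three values contain the squares of (-q; q), (h; q), (-h; q) with h^2 = q, the q-products of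
    the Weber functions, whose product is 1 by [euler_odd_distinct]. *)
Lemma torsion2_eta2 t : upper_half_plane t ->
  torsion2 t * eta2 t ^+ 3 = sn (1 / 2) * ec (- (1 / 4)).
Proof.
move=> ht; have q1 := cabs_ec_lt1 ht; have n0 := qpochqq_neq0 q1.
pose h := ec (t / 2); have hE : ec t = h ^+ 2 by rewrite /h -ecMn; congr ec; field.
have h0 : h != 0 by exact: ec_neq0.
have wE : ec ((t + 1) / 2) = - h.
  by rewrite mulrDl ecD ec_half mulrN1.
have k1 : thK (1 / 2) t = sn (1 / 2) * qpoch (- ec t) (ec t) ^+ 2 / qpoch (ec t) (ec t) ^+ 2.
  by rewrite /thK ec_half invrN1 mulrN1 expr2.
have k2 : thK (t / 2) t = - ec (- (t / 4)) * qpoch h (ec t) ^+ 2 / qpoch (ec t) (ec t) ^+ 2.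
  rewrite thK_qpoch // -/h; have -> : ec t / h = h by rewrite hE; field.
  by have -> : - (t / 2 / 2) = - (t / 4) by field.
have k3 : thK ((t + 1) / 2) t = - ec (- ((t + 1) / 4)) * qpoch (- h) (ec t) ^+ 2 / qpoch (ec t) (ec t) ^+ 2.
  rewrite thK_qpoch // wE; have -> : ec t / - h = - h by rewrite hE; field.
  by have -> : - ((t + 1) / 2 / 2) = - ((t + 1) / 4) by field.
have e1 : qpoch (- ec t) (ec t) * (qpoch h (ec t) * qpoch (- h) (ec t)) = 1.
  by rewrite qpoch_sqr_base // -hE euler_odd_distinct.
rewrite /torsion2 k1 k2 k3 /eta2.
have -> : ec (- ((t + 1) / 4)) = ec (- (t / 4)) * ec (- (1 / 4)).
  by rewrite -ecD; congr ec; field.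
have e2 : ec (t / 12) ^+ 3 = ec (t / 4) by rewrite -ecMn; congr ec; field.
rewrite exprMn e2 [ec (- (t / 4))]ecN; have t40 := ec_neq0 (t / 4).
have -> : sn (1 / 2) * ec (- (1 / 4)) = sn (1 / 2) * ec (- (1 / 4)) *
   (qpoch (- ec t) (ec t) * (qpoch h (ec t) * qpoch (- h) (ec t))) ^+ 2.
  by rewrite e1 expr1n mulr1.
move: (ec (t / 4)) t40 (qpoch (ec t) (ec t)) n0 => e e0 Q Q0.
by field; rewrite e0 Q0.
Qed.

(** The inversion exchanges 1/2 with t/2 and fixes (t + 1)/2, up to signs and a shift by 1; [E]
    collects the exponential factors. *)
Lemma torsion2_inversion t : upper_half_plane t ->
  torsion2 (- t^-1) = t ^- 3 * ec (- (1 / 4)) * torsion2 t.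
Proof.
move=> ht; have t0 := upper_neq0 ht.
have H z : thK (z / t) (- t^-1) = t^-1 * (ec (z ^+ 2 / (2 * t)) * thK z t).
  by rewrite -thK_inversion // mulKf.
have H1 : thK (1 / 2) (- t^-1) = t^-1 * (ec ((t / 2) ^+ 2 / (2 * t)) * thK (t / 2) t).
  by rewrite -H; have -> : t / 2 / t = 1 / 2 by field.
have H2 : thK (- t^-1 / 2) (- t^-1) = t^-1 * (ec ((- (1 / 2)) ^+ 2 / (2 * t)) * - thK (1 / 2) t).
  by rewrite -thKN -H; have -> : - (1 / 2) / t = - t^-1 / 2 by field.
have H3 : thK ((- t^-1 + 1) / 2) (- t^-1) =
    t^-1 * (ec (((t + 1) / 2 - 1) ^+ 2 / (2 * t)) * - thK ((t + 1) / 2) t).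
  rewrite -thK_sub1 -H; have -> : ((t + 1) / 2 - 1) / t = (- t^-1 + 1) / 2 by field.
  by [].
have E : ec (- (1 / 4)) * ec (t / 4) = ec (- t^-1 / 4) * ec ((t / 2) ^+ 2 / (2 * t)) *
   ec ((- (1 / 2)) ^+ 2 / (2 * t)) * ec (((t + 1) / 2 - 1) ^+ 2 / (2 * t)).
  by rewrite -!ecD; congr ec; field.
transitivity (t ^- 3 * (ec (- (1 / 4)) * ec (t / 4)) * thK (1 / 2) t * thK (t / 2) t * thK ((t + 1) / 2) t);
  last by rewrite /torsion2; ring.
rewrite /torsion2 H1 H2 H3 E -exprVn; ring.
Qed.

Lemma eta2_cube_inversion t : upper_half_plane t ->
  eta2 (- t^-1) ^+ 3 = t ^+ 3 * ec (1 / 4) * eta2 t ^+ 3.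
Proof.
move=> ht; have t0 := upper_neq0 ht.
have h1 := torsion2_eta2 ht; have h2 := torsion2_eta2 (upper_inv ht).
rewrite torsion2_inversion // -h1 ecN in h2.
have c0 : sn (1 / 2) * ec (- (1 / 4)) != 0 :> Cplx R.
  rewrite mulf_neq0 ?ec_neq0 //; apply/eqP => /sn_eq0[n] /eqP.
  have -> : (1 / 2 == n%:~R :> Cplx R) = (1 == (n * 2)%:~R :> Cplx R).
    by rewrite intrM -(inj_eq (mulIf (_ : (2 : Cplx R) != 0))) // divfK.
  rewrite -[1]/(1%:~R) eqr_int => /eqP; lia.
have n0 : torsion2 t != 0.
  by apply: contraNneq c0 => n0; rewrite -h1 n0 mul0r.
have e0 := ec_neq0 (1 / 4 : Cplx R).
apply: (mulfI n0); move: (torsion2 t) (eta2 (- t^-1)) (eta2 t) (ec (1 / 4)) n0 e0 h2 => T A B e n0 e0 h2.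
transitivity (t ^+ 3 * e * (t ^- 3 * e^-1 * T * A ^+ 3)).
  by field; rewrite t0 e0.
by rewrite h2; ring.
Qed.

End Modular.

(** * Eta squared through 3-torsion, and its transformation law *)

Section Torsion3.
Context {R : realType}.
Implicit Types (x y z u v w t q : Cplx R).

(** One point from each pair of opposite nonzero 3-torsion points; the exponential makes the product
    a constant multiple of the inverse fourth power of [eta2]. *)
Definition torsion3 t :=
  ec (t / 6) * thK (1 / 3) t * thK (t / 3) t * thK ((t + 1) / 3) t * thK ((t - 1) / 3) t.

Lemma ec_third_sum : 1 + ec (1 / 3) + ec (1 / 3) ^+ 2 = 0 :> Cplx R.
Proof.
set w := ec (1 / 3).
have w3 : w ^+ 3 = 1.
  rewrite -ecMn; have -> : 3%:R * (1 / 3) = 1 :> Cplx R by field. exact: ec1.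
have w1 : w - 1 != 0.
  rewrite subr_eq0; apply/eqP => /ec_eq1[n] /eqP.
  have -> : (1 / 3 == n%:~R :> Cplx R) = (1 == (n * 3)%:~R :> Cplx R).
    by rewrite intrM -(inj_eq (mulIf (_ : (3 : Cplx R) != 0))) // divfK.
  rewrite -[1]/(1%:~R) eqr_int => /eqP; lia.
apply: (mulfI w1); rewrite mulr0; transitivity (w ^+ 3 - 1); first by ring.
by rewrite w3 subrr.
Qed.

(** The factors at x, w x, w^2 x, with w a primitive cube root of unity, combine into (x^3; q^3);
    for x^3 = q, q^2, q^3 these cover the three residue classes of exponents and recombine to (q;
    q). *)
Lemma torsion3_eta2 t : upper_half_plane t ->
  torsion3 t * eta2 t ^+ 4 = - sn (1 / 3).
Proof.
move=> ht; have q1 := cabs_ec_lt1 ht; have n0 := qpochqq_neq0 q1.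
pose h := ec (t / 3); have hE : ec t = h ^+ 3 by rewrite /h -ecMn; congr ec; field.
have h0 : h != 0 by exact: ec_neq0.
pose w : Cplx R := ec (1 / 3); have w0 : w != 0 by exact: ec_neq0.
have hw := ec_third_sum; rewrite -/w in hw.
have w3 : w ^+ 3 = 1.
  rewrite -ecMn; have -> : 3%:R * (1 / 3) = 1 :> Cplx R by field. exact: ec1.
have wV : w^-1 = w ^+ 2 by apply: (mulfI w0); rewrite divff // -exprS.
set q := ec t in q1 n0 hE *; set Q := qpoch q q in n0.
have k0 : thK (1 / 3) t = sn (1 / 3) * (qpoch (w * q) q * qpoch (w ^+ 2 * q) q) / Q ^+ 2.
  by rewrite /thK -/q -/w wV [q * w]mulrC [q * _]mulrC.
have k1 : thK (t / 3) t = - ec (- (t / 3 / 2)) * (qpoch h q * qpoch (h ^+ 2) q) / Q ^+ 2.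
  rewrite thK_qpoch // -/h -/q; have -> : q / h = h ^+ 2 by rewrite hE; field.
  by [].
have k2 : thK ((t + 1) / 3) t =
    - ec (- ((t + 1) / 3 / 2)) * (qpoch (w * h) q * qpoch (w ^+ 2 * h ^+ 2) q) / Q ^+ 2.
  rewrite thK_qpoch // -/q mulrDl ecD -/h -/w.
  have -> : q / (h * w) = w ^+ 2 * h ^+ 2 by rewrite hE invfM wV; field.
  by rewrite [h * w]mulrC.
have k3 : thK ((t - 1) / 3) t =
    - ec (- ((t - 1) / 3 / 2)) * (qpoch (w ^+ 2 * h) q * qpoch (w * h ^+ 2) q) / Q ^+ 2.
  rewrite thK_qpoch // -/q mulrBl ecB -/h -/w wV.
  have -> : q / (h * w ^+ 2) = w * h ^+ 2 by rewrite hE -wV; field; rewrite w0 h0.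
  by rewrite [h * w ^+ 2]mulrC.
have E0 : Q * (qpoch (w * q) q * qpoch (w ^+ 2 * q) q) = qpoch (q ^+ 3) (q ^+ 3).
  by rewrite mulrA; exact: qpoch_cube_base.
have E1 : qpoch h q * qpoch (w * h) q * qpoch (w ^+ 2 * h) q = qpoch q (q ^+ 3).
  by rewrite (qpoch_cube_base h q1 hw) -hE.
have E2 : qpoch (h ^+ 2) q * qpoch (w * h ^+ 2) q * qpoch (w ^+ 2 * h ^+ 2) q = qpoch (q * q) (q ^+ 3).
  have -> : q * q = (h ^+ 2) ^+ 3 by rewrite hE; ring.
  exact: qpoch_cube_base.
have E3 : qpoch q (q ^+ 3) * qpoch (q * q) (q ^+ 3) * qpoch (q ^+ 3) (q ^+ 3) = Q.
  rewrite -[RHS](qpoch_split3 q q1); congr (_ * _ * qpoch _ _); ring.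
have eE : ec (- (t / 3 / 2)) * ec (- ((t + 1) / 3 / 2)) * ec (- ((t - 1) / 3 / 2)) * ec (t / 6) *
   ec (t / 12) ^+ 4 = 1.
  rewrite -ecMn -!ecD; set x := (X in ec X); have -> : x = 0 by rewrite /x; field.
  exact: ec0.
rewrite /torsion3 /eta2 -/q -/Q k0 k1 k2 k3.
move: eE E0 E1 E2 E3 n0; clear k0 k1 k2 k3; clearbody Q; clearbody q h w.
move: (qpoch (w * q) q) (qpoch (w ^+ 2 * q) q) (qpoch h q) (qpoch (w * h) q)
  (qpoch (w ^+ 2 * h) q) (qpoch (h ^+ 2) q) (qpoch (w * h ^+ 2) q) (qpoch (w ^+ 2 * h ^+ 2) q)
  (qpoch q (q ^+ 3)) (qpoch (q * q) (q ^+ 3)) (qpoch (q ^+ 3) (q ^+ 3)).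
move: (ec (- (t / 3 / 2))) (ec (- ((t + 1) / 3 / 2))) (ec (- ((t - 1) / 3 / 2))) (ec (t / 6))
  (ec (t / 12)) (sn (1 / 3)); clear.
move=> e1 e2 e3 e6 e12 s a1 a2 b1 b2 b3 c1 c2 c3 d1 d2 d3 eE E0 E1 E2 E3 Q0.
have WQ : Q * (a1 * a2) * (b1 * b2 * b3) * (c1 * c2 * c3) = Q.
  by rewrite E0 E1 E2 -[RHS]E3; ring.
transitivity (- s * (e1 * e2 * e3 * e6 * e12 ^+ 4) *
  (Q * (a1 * a2) * (b1 * b2 * b3) * (c1 * c2 * c3) / Q)).
  by field; rewrite Q0.
by rewrite eE WQ divff // !mulr1.
Qed.

(** Up to sign, the inversion exchanges 1/3 with t/3 and (t + 1)/3 with (t - 1)/3. *)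
Lemma torsion3_inversion t : upper_half_plane t ->
  torsion3 (- t^-1) = t ^- 4 * torsion3 t.
Proof.
move=> ht; have t0 := upper_neq0 ht.
have H z : thK (z / t) (- t^-1) = t^-1 * (ec (z ^+ 2 / (2 * t)) * thK z t).
  by rewrite -thK_inversion // mulKf.
have H1 : thK (1 / 3) (- t^-1) = t^-1 * (ec ((t / 3) ^+ 2 / (2 * t)) * thK (t / 3) t).
  by rewrite -H; have -> : t / 3 / t = 1 / 3 by field.
have H2 : thK (- t^-1 / 3) (- t^-1) = t^-1 * (ec ((- (1 / 3)) ^+ 2 / (2 * t)) * - thK (1 / 3) t).
  by rewrite -thKN -H; have -> : - (1 / 3) / t = - t^-1 / 3 by field.
have H3 : thK ((- t^-1 + 1) / 3) (- t^-1) =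
    t^-1 * (ec (((t - 1) / 3) ^+ 2 / (2 * t)) * thK ((t - 1) / 3) t).
  by rewrite -H; have -> : (t - 1) / 3 / t = (- t^-1 + 1) / 3 by field.
have H4 : thK ((- t^-1 - 1) / 3) (- t^-1) =
    t^-1 * (ec ((- ((t + 1) / 3)) ^+ 2 / (2 * t)) * - thK ((t + 1) / 3) t).
  by rewrite -thKN -H; have -> : - ((t + 1) / 3) / t = (- t^-1 - 1) / 3 by field.
have E : ec (t / 6) = ec (- t^-1 / 6) * ec ((t / 3) ^+ 2 / (2 * t)) *
   ec ((- (1 / 3)) ^+ 2 / (2 * t)) * ec (((t - 1) / 3) ^+ 2 / (2 * t)) *
   ec ((- ((t + 1) / 3)) ^+ 2 / (2 * t)).
  by rewrite -!ecD; congr ec; field.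
transitivity (t ^- 4 * ec (t / 6) * thK (1 / 3) t * thK (t / 3) t * thK ((t + 1) / 3) t *
  thK ((t - 1) / 3) t); last by rewrite /torsion3; ring.
rewrite /torsion3 H1 H2 H3 H4 E -exprVn; ring.
Qed.

Lemma eta2_fourth_inversion t : upper_half_plane t ->
  eta2 (- t^-1) ^+ 4 = t ^+ 4 * eta2 t ^+ 4.
Proof.
move=> ht; have t0 := upper_neq0 ht.
have h1 := torsion3_eta2 ht; have h2 := torsion3_eta2 (upper_inv ht).
rewrite torsion3_inversion // -h1 in h2.
have c0 : - sn (1 / 3) != 0 :> Cplx R.
  rewrite oppr_eq0; apply/eqP => /sn_eq0[n] /eqP.
  have -> : (1 / 3 == n%:~R :> Cplx R) = (1 == (n * 3)%:~R :> Cplx R).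
    by rewrite intrM -(inj_eq (mulIf (_ : (3 : Cplx R) != 0))) // divfK.
  rewrite -[1]/(1%:~R) eqr_int => /eqP; lia.
have n0 : torsion3 t != 0.
  by apply: contraNneq c0 => n0; rewrite -h1 n0 mul0r.
apply: (mulfI n0); move: (torsion3 t) (eta2 (- t^-1)) (eta2 t) n0 h2 => T A B n0 h2.
transitivity (t ^+ 4 * (t ^- 4 * T * A ^+ 4)); first by field.
by rewrite h2; ring.
Qed.

Lemma eta2_inversion t : upper_half_plane t -> eta2 (- t^-1) = t * ec (- (1 / 4)) * eta2 t.
Proof.
move=> ht; have t0 := upper_neq0 ht; have n0 := eta2_neq0 ht; have n1 := eta2_neq0 (upper_inv ht).
have h3 := eta2_cube_inversion ht; have h4 := eta2_fourth_inversion ht.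
have e0 := ec_neq0 (1 / 4 : Cplx R).
rewrite ecN; move: (eta2 (- t^-1)) (eta2 t) (ec (1 / 4)) n1 e0 h3 h4 => A B e A0 e0 h3 h4.
apply: (mulfI (expf_neq0 3 A0)); rewrite -exprSr h4 h3.
by field.
Qed.

(** T and its inverse contribute e^{2 pi i / 12} and its inverse, S contributes -i. The twelfth
    power is what is recorded of the multiplier, because the exponent of [eta2] is divisible by 12
    when 24 divides T. *)
Lemma eta2_modular (a b c d : int) : a * d - b * c = 1 ->
  exists2 chi : Cplx R, chi ^+ 12 = 1 &
  forall t, upper_half_plane t -> eta2 (mob a b c d t) = chi * den c d t * eta2 t.
Proof.
have ec12 (x : Cplx R) (n : int) : 12 * x = n%:~R -> ec x ^+ 12 = 1.
  by move=> h; rewrite -ecMn h ec_int.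
have etaT t (n : int) : eta2 (t + n%:~R) = ec (n%:~R / 12) * eta2 t.
  by rewrite /eta2 ecD ec_int mulr1 mulrDl ecD; ring.
move: a b c d; apply: sl2_ind => [|a b c d h [x x12 IH]|a b c d h [x x12 IH]|a b c d h [x x12 IH]].
- by exists 1; rewrite ?expr1n // => t ht; rewrite mob1 den1 !mul1r.
- exists (x * ec (1%:~R / 12)) => [|t ht].
    by rewrite exprMn x12 mul1r; apply: (ec12 _ 1); field.
  have hm := mobT a b c d t 1; have hd := denT c d t 1.
  rewrite !mul1r [b + a]addrC [d + c]addrC in hm hd.
  rewrite hm hd IH; last exact: upper_add1.
  by rewrite etaT; ring.
- exists (x * ec ((-1)%:~R / 12)) => [|t ht].
    by rewrite exprMn x12 mul1r; apply: (ec12 _ (-1)); field.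
  have hm := mobT a b c d t (-1); have hd := denT c d t (-1).
  rewrite !mulN1r in hm hd.
  rewrite hm hd IH; last exact: upper_add1.
  by rewrite etaT; ring.
exists (x * ec (- (1 / 4))) => [|t ht].
  by rewrite exprMn x12 [LHS]mul1r; apply: (ec12 (- (1 / 4)) (- 3%:Z)); rewrite mulrNz; field.
have t0 := upper_neq0 ht.
rewrite mobS // denS // IH; last exact: upper_inv.
by rewrite eta2_inversion //; ring.
Qed.

End Torsion3.

(** * Generalized eta products and their expansions *)

Section EtaProducts.
Context {R : realType}.
Implicit Types (x y z u v w t q s : Cplx R) (p r : nat) (a : nat -> int).

(** The power q^x as a function of t rather than of q, so that no branch has to be chosen. *)
Definition er (x : rat) t : Cplx R := ec (ratr x * t).

Lemma erD (x y : rat) t : er (x + y) t = er x t * er y t.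
Proof. by rewrite /er rmorphD mulrDl ecD. Qed.

Lemma er_neq0 (x : rat) t : er x t != 0.
Proof. exact: ec_neq0. Qed.

Lemma er0 t : er 0 t = 1.
Proof. by rewrite /er rmorph0 mul0r ec0. Qed.

Lemma erMz (x : rat) (n : int) t : er (x * n%:~R) t = er x t ^ n.
Proof. by rewrite -ecMz /er rmorphM /= ratr_int; congr ec; ring. Qed.

Lemma er_shift (x : rat) t s : er x (t + s) = er x t * er x s.
Proof. by rewrite /er mulrDr ecD. Qed.

Lemma prod_er (I : Type) (s : seq I) (f : I -> rat) (a : I -> int) t :
  \prod_(i <- s) er (f i) t ^ a i = er (\sum_(i <- s) f i * (a i)%:~R) t.
Proof.
elim: s => [|i s IH]; first by rewrite !big_nil er0.
by rewrite !big_cons erD IH erMz.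
Qed.

Lemma prod_expfz (F : fieldType) (I : Type) (s : seq I) (x : F) (a : I -> int) : x != 0 ->
  \prod_(i <- s) x ^ a i = x ^ (\sum_(i <- s) a i).
Proof.
by move=> x0; elim: s => [|i s IH]; rewrite ?big_nil // !big_cons IH expfzDr.
Qed.

Lemma floor_divz (j : int) p : (0 < p)%N -> Num.floor (j%:~R / p%:R : rat) = (j %/ p)%Z.
Proof.
move=> p0; have pQ : (0 : rat) < p%:R by rewrite ltr0n.
have pz : (p : int) != 0 by rewrite -lt0n in p0 *; lia.
apply: floor_def; rewrite ler_pdivlMr // ltr_pdivrMr //.
have -> : (p%:R : rat) = p%:Z%:~R by [].
rewrite -!intrM ler_int ltr_int; have := divz_eq j p; have := modz_ge0 j pz.
have := ltz_mod j pz; lia.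
Qed.

Lemma frac_part_divz (j : int) p : (0 < p)%N ->
  frac_part (j%:~R / p%:R) = (j %% p)%Z%:~R / p%:R.
Proof.
move=> p0; rewrite /frac_part floor_divz //.
have pQ : p%:R != 0 :> rat by rewrite pnatr_eq0 -lt0n.
rewrite {1}(divz_eq j p) intrD intrM; field; exact: pQ.
Qed.

(* Up to sign and a power of eta (p t), the i-th generalized eta function of level p. *)
Definition kap p (i : int) t : Cplx R :=
  ec (i%:~R ^+ 2 * t / (2 * p%:R)) * thK (i%:~R * t) (p%:R * t).

Lemma upper_natM p t : (0 < p)%N -> upper_half_plane t -> upper_half_plane (p%:R * t).
Proof.
rewrite /upper_half_plane /= natr_complexE => p0; case: t => x y /= y0.
by rewrite mul0r addr0 mulr_gt0 // ltr0n.
Qed.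

Lemma upper_natV p t : (0 < p)%N -> upper_half_plane t -> upper_half_plane (t / p%:R).
Proof.
move=> p0; rewrite /upper_half_plane /= mulrC natr_complexE -fmorphV /=; case: t => x y /= y0.
by rewrite mul0r addr0 mulr_gt0 // invr_gt0 ltr0n.
Qed.

(** The exponential in [kap] completes the square against the quasi-period of [thK], so that only a
    sign survives. *)
Lemma kap_addp p (i : int) t : (0 < p)%N -> upper_half_plane t ->
  kap p (i + p%:Z) t = - kap p i t.
Proof.
move=> p0 ht; have pC : p%:R != 0 :> Cplx R by rewrite pnatr_eq0 -lt0n.
rewrite /kap intrD; have -> : (p%:Z%:~R : Cplx R) = p%:R by [].
have -> : (i%:~R + p%:R) * t = i%:~R * t + p%:R * t by ring.
rewrite thK_addt; last exact: upper_natM.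
move: (i%:~R : Cplx R) (p%:R : Cplx R) pC => j k k0.
have -> : ec ((j + k) ^+ 2 * t / (2 * k)) =
   ec (j ^+ 2 * t / (2 * k)) / ec (- (k * t / 2) - j * t).
  by rewrite -ecB; congr ec; field.
have := ec_neq0 (- (k * t / 2) - j * t); set e := ec (- _ - _) => e0.
by rewrite mulrA mulrN divfK // mulNr.
Qed.

Lemma kap_addpz p (i m : int) t : (0 < p)%N -> upper_half_plane t ->
  kap p (i + m * p%:Z) t = (-1) ^ m * kap p i t.
Proof.
move=> p0 ht; have H (n : nat) (j : int) : kap p (j + n%:Z * p%:Z) t = (-1) ^+ n * kap p j t.
  elim: n => [|n IH]; first by rewrite mul0r addr0 mul1r.
  by rewrite -addn1 PoszD mulrDl mul1r addrA kap_addp // IH addn1 exprS mulN1r mulNr.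
case: m => n; first exact: H.
rewrite NegzE -[in RHS](subrK (n.+1%:Z * p%:Z) i) H mulrA mulNr.
have -> : (-1) ^ (- n.+1%:Z) = (-1) ^+ n.+1 :> Cplx R.
  by rewrite -invr_expz -exprVn invrN1.
by rewrite -exprD addnn -mul2n exprM sqrrN expr1n expr1n mul1r.
Qed.

Lemma kap_qpoch p r t : (0 < r < p)%N -> upper_half_plane t ->
  kap p r t = - ec ((r%:R ^+ 2 / (2 * p%:R) - r%:R / 2) * t) *
    (qpoch (ec t ^+ r) (ec t ^+ p) * qpoch (ec t ^+ (p - r)) (ec t ^+ p)) /
    qpoch (ec t ^+ p) (ec t ^+ p) ^+ 2.
Proof.
move=> /andP[r0 rp] ht; have p0 : (0 < p)%N by exact: ltn_trans rp.
have pC : p%:R != 0 :> Cplx R by rewrite pnatr_eq0 -lt0n.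
rewrite /kap thK_qpoch; last exact: upper_natM.
have -> : (r%:Z%:~R : Cplx R) = r%:R by [].
have q0 := ec_neq0 t.
rewrite !ecMn -expfB // mulrA mulrA mulrN -ecD.
by congr (- ec _ * _ / _); field.
Qed.

(** Half of T, hence the exponent of the square of eta. It exceeds the modular weight a_0 / 2 by the
    sum of the a_i because each [kap] has weight -1. *)
Definition wt p a : int := (a 0%N %/ 2)%Z + \sum_(1 <= i < (p.-1)./2.+1) a i.

Definition kap_product p a (n : int) t : Cplx R :=
  eta2 (p%:R * t) ^ wt p a * \prod_(1 <= i < (p.-1)./2.+1) kap p (i%:Z * n) t ^ a i.

(* The order of [kap_product p a n] at infinity, in powers of e^{2 pi i t}. *)
Definition cusp_order p a (n : int) : rat :=
  p%:R / 24 * (exponent_sum p a)%:~R - frac_sum p a n.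

(** What remains of the expansion after the power of q: for n prime to p, a holomorphic function of
    s = e^{2 pi i t} without zeros on the unit disc. *)
Definition cusp_unit p a (n : int) s : Cplx R :=
  qpoch (s ^+ p) (s ^+ p) ^ a 0%N * \prod_(1 <= i < (p.-1)./2.+1)
    (qpoch (s ^+ absz (i%:Z * n %% p)%Z) (s ^+ p) *
     qpoch (s ^+ (p - absz (i%:Z * n %% p)%Z)) (s ^+ p)) ^ a i.

Lemma exponent_sum_wt p a : (2 %| a 0%N)%Z -> exponent_sum p a = 2 * wt p a.
Proof. by move=> /divzK a0; rewrite /exponent_sum /wt mulrDr -{1}a0; ring. Qed.

(** For r = j mod p and x = r/p the exponent r^2/(2 p) - r/2 equals - (p/2) x (1 - x), the source of
    the terms of [frac_sum]. *)
Lemma kap_residue p (j : int) t : (0 < p)%N -> ~~ (p %| j)%Z -> upper_half_plane t ->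
  let x := frac_part (j%:~R / p%:R) in
  kap p j t = (- (-1) ^ (j %/ p)%Z) * er (- (p%:R / 2 * (x * (1 - x)))) t *
   (qpoch (ec t ^+ absz (j %% p)%Z) (ec t ^+ p) *
     qpoch (ec t ^+ (p - absz (j %% p)%Z)) (ec t ^+ p)) * qpoch (ec t ^+ p) (ec t ^+ p) ^ (-2).
Proof.
move=> p0 pj ht x; have pz : (p : int) != 0 by lia.
have pC : p%:R != 0 :> Cplx R by rewrite pnatr_eq0 -lt0n.
have [r rE] : exists r : nat, (j %% p)%Z = r%:Z.
  by exists (absz (j %% p)%Z); rewrite gez0_abs // modz_ge0.
have rp : (0 < r < p)%N.
  have := ltz_mod j pz; have := modz_ge0 j pz; rewrite rE => h1 h2.
  have : r != 0%N by apply: contra pj => /eqP r0; apply/dvdz_mod0P; rewrite rE r0.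
  lia.
have xE : x = r%:R / p%:R by rewrite /x frac_part_divz // rE.
rewrite {1}(divz_eq j p) addrC kap_addpz // rE kap_qpoch // absz_nat.
have -> : er (- (p%:R / 2 * (x * (1 - x)))) t = ec ((r%:R ^+ 2 / (2 * p%:R) - r%:R / 2) * t).
  rewrite /er xE rmorphN !rmorphM rmorphB rmorphM /= !fmorphV !rmorph_nat rmorph1.
  by congr ec; field.
have -> : qpoch (ec t ^+ p) (ec t ^+ p) ^ (-2) = (qpoch (ec t ^+ p) (ec t ^+ p) ^+ 2)^-1 by [].
by rewrite -!mulrA !mulNr mulrN.
Qed.

Lemma qpp_neq0 p s : (0 < p)%N -> cabs s < 1 -> qpoch (s ^+ p) (s ^+ p) != 0.
Proof.
by move=> p0 s1; apply: qpochqq_neq0; rewrite cabsX exprn_ilt1 ?cabs_ge0 // -lt0n.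
Qed.

Lemma half_range p i : prime p -> (5 <= p)%N -> i \in index_iota 1 (p.-1)./2.+1 -> (0 < i < p)%N.
Proof. by rewrite mem_index_iota => pp p5 /andP[-> h]; lia. Qed.

Lemma ndvdz_mul p i (n : int) : prime p -> (0 < i < p)%N -> ~~ (p %| n)%Z -> ~~ (p %| i%:Z * n)%Z.
Proof.
move=> pp /andP[i0 ip]; rewrite !dvdzE abszM !absz_nat Euclid_dvdM // negb_or => ->.
by rewrite andbT gtnNdvd.
Qed.

Lemma kap_product_expansion p a (n : int) : prime p -> (5 <= p)%N -> (2 %| a 0%N)%Z ->
  ~~ (p %| n)%Z -> exists2 c : Cplx R, c != 0 & forall t, upper_half_plane t ->
  kap_product p a n t = c * er (cusp_order p a n) t * cusp_unit p a n (ec t).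
Proof.
move=> pp p5 a0 pn; have p0 : (0 < p)%N by exact: prime_gt0.
exists (\prod_(1 <= i < (p.-1)./2.+1) (- (-1) ^ (i%:Z * n %/ p)%Z) ^ a i).
  rewrite prodf_seq_neq0; apply/allP => i _; apply/implyP => _.
  by rewrite expfz_neq0 // oppr_eq0 expfz_neq0 // oppr_eq0 oner_neq0.
move=> t ht; have q1 := cabs_ec_lt1 ht; have Q0 := qpp_neq0 p0 q1.
rewrite /kap_product /cusp_unit.
set Q := qpoch (ec t ^+ p) (ec t ^+ p) in Q0 *.
pose x i := frac_part ((i%:Z * n)%:~R / p%:R).
pose b i := qpoch (ec t ^+ absz (i%:Z * n %% p)%Z) (ec t ^+ p) *
     qpoch (ec t ^+ (p - absz (i%:Z * n %% p)%Z)) (ec t ^+ p).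
have -> : \prod_(1 <= i < (p.-1)./2.+1) kap p (i%:Z * n) t ^ a i =
   (\prod_(1 <= i < (p.-1)./2.+1) (- (-1) ^ (i%:Z * n %/ p)%Z) ^ a i) *
   er (- frac_sum p a n) t * (\prod_(1 <= i < (p.-1)./2.+1) b i ^ a i) *
   Q ^ (-2 * \sum_(1 <= i < (p.-1)./2.+1) a i).
  have -> : - frac_sum p a n =
      \sum_(1 <= i < (p.-1)./2.+1) (- (p%:R / 2 * (x i * (1 - x i)))) * (a i)%:~R.
    rewrite /frac_sum mulr_sumr -sumrN; apply: eq_bigr => i _ /=.
    by rewrite /x intrM; ring.
  have Q2 : Q ^ (-2) != 0 by rewrite expfz_neq0.
  have -> : Q ^ (-2 * \sum_(1 <= i < (p.-1)./2.+1) a i) =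
      \prod_(1 <= i < (p.-1)./2.+1) (Q ^ (-2)) ^ a i.
    by rewrite prod_expfz // exprz_exp.
  rewrite -prod_er -!big_split /=; apply: eq_big_seq => i ih.
  have pin := ndvdz_mul pp (half_range pp p5 ih) pn.
  by rewrite (kap_residue p0 pin ht) -/(x i) -/(b i) -/Q !expfzMl.
have -> : eta2 (p%:R * t) = er (p%:R / 12) t * Q ^ 2.
  rewrite /eta2 ecMn -/Q; congr (_ * _).
  by rewrite /er fmorph_div /= !rmorph_nat; congr ec; ring.
have -> : cusp_order p a n = p%:R / 12 * (wt p a)%:~R - frac_sum p a n.
  by rewrite /cusp_order exponent_sum_wt // intrM; field.
rewrite expfzMl -erMz erD exprz_exp.
(* [eta2] contributes Q^T and each [kap] contributes Q^-2; the total exponent T - 2 sum a_i is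
   a_0. *)
have -> : Q ^ a 0%N = Q ^ (2 * wt p a) * Q ^ (-2 * \sum_(1 <= i < (p.-1)./2.+1) a i).
  rewrite -expfzDr //; congr (Q ^ _); rewrite -exponent_sum_wt // /exponent_sum; ring.
rewrite -/b; ring.
Qed.

(* The image of [kap_product p a n] under t |-> -1/t, up to a constant. *)
Definition zero_cusp p a (n : int) t : Cplx R :=
  eta2 (t / p%:R) ^ wt p a *
  \prod_(1 <= i < (p.-1)./2.+1) thK (- ((i%:Z * n)%:~R / p%:R)) (t / p%:R) ^ a i.

Definition zero_cusp_unit p a (n : int) s : Cplx R :=
  qpoch s s ^ a 0%N * \prod_(1 <= i < (p.-1)./2.+1)
    (qpoch (ec (- ((i%:Z * n)%:~R / p%:R)) * s) s * qpoch (ec ((i%:Z * n)%:~R / p%:R) * s) s) ^ a i.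

Lemma sn_frac_neq0 p (j : int) : (0 < p)%N -> ~~ (p %| j)%Z -> sn (j%:~R / p%:R : Cplx R) != 0.
Proof.
move=> p0 pj; apply/eqP => /sn_eq0[k /eqP].
have pC : p%:R != 0 :> Cplx R by rewrite pnatr_eq0 -lt0n.
rewrite -(inj_eq (mulIf pC)) divfK //.
have -> : (p%:R : Cplx R) = p%:Z%:~R by [].
rewrite -intrM eqr_int => /eqP jE; move/negP: pj; apply.
by apply/dvdzP; exists k.
Qed.

(** The first arguments of [thK] no longer depend on t, so only [eta2] contributes a power of q, and
    the order is the same for every n. *)
Lemma zero_cusp_expansion p a (n : int) : prime p -> (5 <= p)%N -> (2 %| a 0%N)%Z ->
  ~~ (p %| n)%Z -> exists2 c : Cplx R, c != 0 & forall t, upper_half_plane t ->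
  zero_cusp p a n t = c * er ((exponent_sum p a)%:~R / (24 * p%:R)) t *
    zero_cusp_unit p a n (ec (t / p%:R)).
Proof.
move=> pp p5 a0 pn; have p0 : (0 < p)%N by exact: prime_gt0.
have pC : p%:R != 0 :> rat by rewrite pnatr_eq0 -lt0n.
exists (\prod_(1 <= i < (p.-1)./2.+1) sn (- ((i%:Z * n)%:~R / p%:R)) ^ a i).
  rewrite prodf_seq_neq0; apply/allP => i ih; apply/implyP => _.
  rewrite expfz_neq0 // snN oppr_eq0 sn_frac_neq0 //.
  exact: ndvdz_mul pp (half_range pp p5 ih) pn.
move=> t ht; have ht' := upper_natV p0 ht; have q1 := cabs_ec_lt1 ht'.
rewrite /zero_cusp /zero_cusp_unit; set q := ec (t / p%:R) in q1 *.
have Q0 := qpochqq_neq0 q1; set Q := qpoch q q in Q0 *.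
pose b i := qpoch (ec (- ((i%:Z * n)%:~R / p%:R)) * q) q * qpoch (ec ((i%:Z * n)%:~R / p%:R) * q) q.
have -> : \prod_(1 <= i < (p.-1)./2.+1) thK (- ((i%:Z * n)%:~R / p%:R)) (t / p%:R) ^ a i =
   (\prod_(1 <= i < (p.-1)./2.+1) sn (- ((i%:Z * n)%:~R / p%:R)) ^ a i) *
   (\prod_(1 <= i < (p.-1)./2.+1) b i ^ a i) *
   Q ^ (-2 * \sum_(1 <= i < (p.-1)./2.+1) a i).
  have Q2 : Q ^ (-2) != 0 by rewrite expfz_neq0.
  have -> : Q ^ (-2 * \sum_(1 <= i < (p.-1)./2.+1) a i) =
      \prod_(1 <= i < (p.-1)./2.+1) (Q ^ (-2)) ^ a i.
    by rewrite prod_expfz // exprz_exp.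
  rewrite -!big_split /=; apply: eq_big_seq => i ih.
  have -> : thK (- ((i%:Z * n)%:~R / p%:R)) (t / p%:R) =
      sn (- ((i%:Z * n)%:~R / p%:R)) * b i * Q ^ (-2).
    rewrite /thK -/q -/Q /b [q * _]mulrC -ecN opprK [q * _]mulrC.
    by have -> : Q ^ (-2) = (Q ^+ 2)^-1 by [].
  by rewrite !expfzMl.
have -> : eta2 (t / p%:R) = er (12 * p%:R)^-1 t * Q ^ 2.
  rewrite /eta2 -/q -/Q; congr (_ * _).
  rewrite /er fmorphV rmorphM /= !rmorph_nat; congr ec.
  have pC' : p%:R != 0 :> Cplx R by rewrite pnatr_eq0 -lt0n.
  by field.
have -> : (exponent_sum p a)%:~R / (24 * p%:R) = (12 * p%:R)^-1 * (wt p a)%:~R :> rat.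
  by rewrite exponent_sum_wt // intrM; field.
rewrite expfzMl -erMz exprz_exp.
have -> : Q ^ a 0%N = Q ^ (2 * wt p a) * Q ^ (-2 * \sum_(1 <= i < (p.-1)./2.+1) a i).
  rewrite -expfzDr //; congr (Q ^ _); rewrite -exponent_sum_wt // /exponent_sum; ring.
rewrite -/b; ring.
Qed.

Lemma eta_product_expansion p a t : prime p -> (5 <= p)%N ->
  eta_product p a t = er (cusp_order p a 1) t * cusp_unit p a 1 (ec t).
Proof.
move=> pp p5; rewrite /eta_product /= -/(ec t).
have -> : cexp (twopii R * ratr (ell p a) * t) = er (cusp_order p a 1) t.
  by rewrite -mulrA.
rewrite -mulrA /cusp_unit; apply: congr1; apply: congr1; apply: eq_big_seq => i ih.
have /andP[i0 ip] := half_range pp p5 ih.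
have -> : (i%:Z * 1 %% p)%Z = i by rewrite mulr1 modz_small //; lia.
by rewrite absz_nat.
Qed.

End EtaProducts.

(** * Transformation laws, zeros and derivatives of the products *)

Section Transformations.
Context {R : realType}.
Implicit Types (x y z u v w t q s : Cplx R) (p r : nat) (a : nat -> int).

(** [thK_modular] is applied to (A, p B; C, D) at p t. The integer i B in the numerator gives the
    sign, and by the determinant relation the exponential of [thK_modular] cancels against the
    prefactor of [kap] up to a constant. *)
Lemma kap_modular p (i A B C D : int) t : (0 < p)%N -> A * D - B * (p%:Z * C) = 1 ->
  upper_half_plane t ->
  kap p i (mob A B (p%:Z * C) D t) = (den (p%:Z * C) D t)^-1 *
    (ec (i%:~R ^+ 2 * A%:~R * B%:~R / (2 * p%:R)) * (-1) ^ (i * B)) * kap p (i * A) t.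
Proof.
move=> p0 h ht; have pC : p%:R != 0 :> Cplx R by rewrite pnatr_eq0 -lt0n.
have d0 := den_neq0 h ht; have htp := upper_natM p0 ht.
have pzE : (p%:Z%:~R : Cplx R) = p%:R by [].
have dE : den C D (p%:R * t) = den (p%:Z * C) D t by rewrite /den intrM pzE; ring.
have mE : p%:R * mob A B (p%:Z * C) D t = mob A (p%:Z * B) C D (p%:R * t).
  by rewrite /mob dE intrM pzE; field.
have h' : A * D - (p%:Z * B) * C = 1 by rewrite -h; ring.
have hC : A%:~R * D%:~R - B%:~R * (p%:R * C%:~R) = 1 :> Cplx R.
  by rewrite -pzE -!intrM -intrB h.
rewrite /kap mE.
have -> : i%:~R * mob A B (p%:Z * C) D t =
    (i%:~R * A%:~R * t + (i * B)%:~R) / den C D (p%:R * t).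
  by rewrite /mob dE intrM; field.
rewrite thK_modular // thK_addz dE [(i * A)%:~R]intrM.
set Z := i%:~R * A%:~R * t + (i * B)%:~R.
have -> : ec (i%:~R ^+ 2 * mob A B (p%:Z * C) D t / (2 * p%:R)) =
    ec (i%:~R ^+ 2 * A%:~R * B%:~R / (2 * p%:R)) *
    ec ((i%:~R * A%:~R) ^+ 2 * t / (2 * p%:R)) / ec (C%:~R * Z ^+ 2 / (2 * den (p%:Z * C) D t)).
  rewrite -ecD -ecB; congr ec; rewrite /Z intrM /mob.
  move: d0; rewrite /den intrM pzE.
  move: (i%:~R : Cplx R) (A%:~R : Cplx R) (B%:~R : Cplx R) (C%:~R : Cplx R) (D%:~R : Cplx R)
    (p%:R : Cplx R) hC pC => I a b c d k hC k0 d0.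
  have aE : a * (k * c * t + d) = 1 + k * c * (a * t + b) by rewrite -hC; ring.
  transitivity (I ^+ 2 * (a * (k * c * t + d)) * (a * t + b) / (2 * k * (k * c * t + d)) -
     c * (I * a * t + I * b) ^+ 2 / (2 * (k * c * t + d))).
    by rewrite aE; field; rewrite k0 d0.
  by field; rewrite k0 d0.
have e0 := ec_neq0 (C%:~R * Z ^+ 2 / (2 * den (p%:Z * C) D t)).
have alg (e1 e2 e3 s T d : Cplx R) : e1 != 0 ->
    e2 * e3 / e1 * (d^-1 * e1 * (s * T)) = d^-1 * (e2 * s) * (e3 * T).
  move=> e10; transitivity (e2 * e3 * (e1^-1 * e1) * d^-1 * s * T); first by ring.
  by rewrite mulVf // mulr1; ring.
exact: alg.
Qed.

(** The prefactor of [kap] cancels the exponential of [thK_inversion] exactly. *)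
Lemma kap_inversion p (i : int) t : (0 < p)%N -> upper_half_plane t ->
  kap p i (- t^-1) = p%:R / t * thK (- (i%:~R / p%:R)) (t / p%:R).
Proof.
move=> p0 ht; have pC : p%:R != 0 :> Cplx R by rewrite pnatr_eq0 -lt0n.
have t0 := upper_neq0 ht; have ht' := upper_natV p0 ht.
rewrite /kap; have -> : i%:~R * - t^-1 = - (i%:~R / p%:R) / (t / p%:R) :> Cplx R.
  by field; rewrite t0 pC.
have -> : p%:R * - t^-1 = - (t / p%:R)^-1 by field; rewrite t0 pC.
have := thK_inversion (- (i%:~R / p%:R)) ht'.
move: (thK (- _ / _) _) => T hT.
have -> : T = p%:R / t * (t / p%:R * T) by field; rewrite t0 pC.
have alg (e1 e2 k K : Cplx R) : e1 * (k * (e2 * K)) = k * (e1 * e2) * K by ring.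
rewrite hT alg -ecD.
have -> : i%:~R ^+ 2 * - t^-1 / (2 * p%:R) + (- (i%:~R / p%:R)) ^+ 2 / (2 * (t / p%:R)) = 0 :> Cplx R.
  by field; rewrite t0 pC.
by rewrite ec0 mulr1.
Qed.

Definition weight a : int := (a 0%N %/ 2)%Z.

Lemma kap_product_modular p a (A B C D : int) : (0 < p)%N -> A * D - B * (p%:Z * C) = 1 ->
  exists2 chi : Cplx R, chi ^+ 12 = 1 & forall t, upper_half_plane t ->
  kap_product p a 1 (mob A B (p%:Z * C) D t) =
    chi ^ wt p a * (\prod_(1 <= i < (p.-1)./2.+1)
      (ec (i%:R ^+ 2 * A%:~R * B%:~R / (2 * p%:R)) * (-1) ^ (i%:Z * B)) ^ a i) *
    den (p%:Z * C) D t ^ weight a * kap_product p a A t.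
Proof.
move=> p0 h; have h' : A * D - (p%:Z * B) * C = 1 by rewrite -h; ring.
have [chi chi12 Hchi] := eta2_modular (R := R) h'; exists chi => // t ht.
have pzE : (p%:Z%:~R : Cplx R) = p%:R by [].
have d0 := den_neq0 h ht.
have dE : den C D (p%:R * t) = den (p%:Z * C) D t by rewrite /den intrM pzE; ring.
have mE : p%:R * mob A B (p%:Z * C) D t = mob A (p%:Z * B) C D (p%:R * t).
  by rewrite /mob dE intrM pzE; field.
have Hchit := Hchi _ (upper_natM p0 ht); rewrite dE in Hchit.
pose S := \sum_(1 <= i < (p.-1)./2.+1) a i.
pose E := \prod_(1 <= i < (p.-1)./2.+1)
      (ec (i%:R ^+ 2 * A%:~R * B%:~R / (2 * p%:R)) * (-1) ^ (i%:Z * B) : Cplx R) ^ a i.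
pose K := \prod_(1 <= i < (p.-1)./2.+1) kap p (i%:Z * A) t ^ a i.
transitivity ((chi * den (p%:Z * C) D t * eta2 (p%:R * t)) ^ wt p a *
    (den (p%:Z * C) D t ^ (- S) * E * K)).
  rewrite /kap_product mE Hchit; apply: congr1.
  have dV0 : (den (p%:Z * C) D t)^-1 != 0 by rewrite invr_eq0.
  have -> : den (p%:Z * C) D t ^ (- S) =
      \prod_(1 <= i < (p.-1)./2.+1) (den (p%:Z * C) D t)^-1 ^ a i.
    by rewrite prod_expfz // -exprz_inv.
  rewrite /E /K -!big_split /=; apply: eq_bigr => i _.
  by rewrite mulr1 kap_modular // !expfzMl.
rewrite /kap_product -/K -/E; move: (eta2 _) E K (den _ _ _) d0 => e E K d d0.
have -> : weight a = wt p a + - S by rewrite /wt addrK.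
rewrite !expfzMl [d ^ (_ + _)]expfzDr //.
by move: (d ^ wt p a) (d ^ (- S)) (chi ^ _) (e ^ _) => x1 x2 x3 x4; ring.
Qed.

Lemma kap_product_inversion p a (n : int) : (0 < p)%N ->
  exists2 c : Cplx R, c != 0 & forall t, upper_half_plane t ->
  kap_product p a n (- t^-1) = c * t ^ weight a * zero_cusp p a n t.
Proof.
move=> p0; have pC : p%:R != 0 :> Cplx R by rewrite pnatr_eq0 -lt0n.
exists (ec (- (1 / 4)) ^ wt p a * p%:R ^ (- weight a)) => [|t ht].
  by rewrite mulf_neq0 // expfz_neq0 // ec_neq0.
have t0 := upper_neq0 ht; have ht' := upper_natV p0 ht.
have tE : p%:R * - t^-1 = - (t / p%:R)^-1 by field; rewrite t0 pC.
have x0 : t / p%:R != 0 by rewrite mulf_neq0 // invr_eq0.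
pose S := \sum_(1 <= i < (p.-1)./2.+1) a i.
pose K := \prod_(1 <= i < (p.-1)./2.+1) thK (- ((i%:Z * n)%:~R / p%:R)) (t / p%:R) ^ a i.
transitivity ((t / p%:R * ec (- (1 / 4)) * eta2 (t / p%:R)) ^ wt p a * ((t / p%:R) ^ (- S) * K)).
  rewrite /kap_product tE eta2_inversion //; apply: congr1.
  have y0 : p%:R / t != 0 by rewrite mulf_neq0 // invr_eq0.
  have -> : (t / p%:R) ^ (- S) = \prod_(1 <= i < (p.-1)./2.+1) (p%:R / t) ^ a i.
    by rewrite prod_expfz // -exprz_inv invfM invrK mulrC.
  by rewrite /K -!big_split /=; apply: eq_bigr => i _; rewrite kap_inversion // expfzMl.
rewrite /zero_cusp -/K; move: (eta2 _) K (ec _) => e K c.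
have -> : p%:R ^ (- weight a) = p%:R^-1 ^ weight a :> Cplx R by rewrite -exprz_inv.
have E : t ^ weight a * p%:R^-1 ^ weight a = (t / p%:R) ^ wt p a * (t / p%:R) ^ (- S).
  by rewrite -expfzMl -expfzDr // /wt addrK.
transitivity (c ^ wt p a * (t ^ weight a * p%:R^-1 ^ weight a) * (e ^ wt p a * K)).
  rewrite E [(t / p%:R * c * e) ^ _]expfzMl [(t / p%:R * c) ^ _]expfzMl.
  by move: ((t / p%:R) ^ wt p a) ((t / p%:R) ^ (- S)) (c ^ _) (e ^ _) => x1 x2 x3 x4; ring.
by move: (c ^ _) (t ^ _) (p%:R^-1 ^ _) (e ^ _) => x1 x2 x3 x4; ring.
Qed.

Lemma derivable_exprn (f : Cplx R -> Cplx R) (n : nat) x :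
  derivable f x 1 -> derivable (fun s => f s ^+ n) x 1.
Proof.
move=> df; exact: (derivable_comp df (derivableX_id n (f x))).
Qed.

Lemma derivable_exprz (f : Cplx R -> Cplx R) (n : int) x : f x != 0 ->
  derivable f x 1 -> derivable (fun s => f s ^ n) x 1.
Proof.
move=> f0 df; case: n => n; first exact: derivable_exprn.
have h := derivable_exprn (n := n.+1) df.
have h0 : f x ^+ n.+1 != 0 by rewrite expf_neq0.
have -> : (fun s => f s ^ Negz n) = (fun s => (f s ^+ n.+1)^-1) by [].
have h2 := derivableV (f := fun s => f s ^+ n.+1) h0 h.
exact: h2.
Qed.

Lemma derivable_mul (f g : Cplx R -> Cplx R) x :
  derivable f x 1 -> derivable g x 1 -> derivable (fun s => f s * g s) x 1.
Proof. by move=> df dg; have h := derivableM df dg; exact: h. Qed.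

Lemma derivable_prod (I : eqType) (l : seq I) (f : I -> Cplx R -> Cplx R) x :
  (forall i, i \in l -> derivable (f i) x 1) ->
  derivable (fun s => \prod_(i <- l) f i s) x 1.
Proof.
elim: l => [|i l IH] H.
  have -> : (fun s => \prod_(i <- [::]) f i s) = cst 1 by apply/funext => s; rewrite big_nil.
  exact: derivable_cst.
have -> : (fun s => \prod_(j <- i :: l) f j s) = (fun s => f i s * \prod_(j <- l) f j s).
  by apply/funext => s; rewrite big_cons.
apply: derivable_mul; first by apply: H; rewrite mem_head.
by apply: IH => j jl; apply: H; rewrite in_cons jl orbT.
Qed.

Lemma qpoch_pow_neq0 (c s : Cplx R) (r b : nat) : cabs c <= 1 -> cabs s < 1 -> (0 < r)%N -> (0 < b)%N ->
  qpoch (c * s ^+ r) (s ^+ b) != 0.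
Proof.
move=> c1 s1 r0 b0; apply: qpoch_neq0.
  by rewrite cabsX exprn_ilt1 ?cabs_ge0 // -lt0n.
move=> n; apply/eqP => /(congr1 cabs); rewrite -mulrA -exprM -exprD cabsM cabsX cabs1 => h.
have : cabs s ^+ (r + b * n) < 1.
  by rewrite exprn_ilt1 ?cabs_ge0 // -lt0n addn_gt0 r0.
have : cabs c * cabs s ^+ (r + b * n) <= cabs s ^+ (r + b * n).
  by rewrite ler_piMl // exprn_ge0 // cabs_ge0.
rewrite h; lra.
Qed.

Lemma qpoch_pow1_neq0 (s : Cplx R) (r b : nat) : cabs s < 1 -> (0 < r)%N -> (0 < b)%N ->
  qpoch (s ^+ r) (s ^+ b) != 0.
Proof. by move=> *; rewrite -[s ^+ r]mul1r qpoch_pow_neq0 // cabs1. Qed.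

Lemma derivable_qpoch1 (r b : nat) x : (0 < b)%N -> cabs x < 1 ->
  derivable (fun s : Cplx R => qpoch (s ^+ r) (s ^+ b)) x 1.
Proof.
move=> b0 x1; have := derivable_qpoch (c := 1) (r := r) b0 x1.
have -> // : (fun s : Cplx R => qpoch (1 * s ^+ r) (s ^+ b)) = (fun s => qpoch (s ^+ r) (s ^+ b)).
by apply/funext => s; rewrite mul1r.
Qed.

Lemma residue_range p i (n : int) : prime p -> (5 <= p)%N -> ~~ (p %| n)%Z ->
  i \in index_iota 1 (p.-1)./2.+1 -> (0 < absz (i%:Z * n %% p)%Z < p)%N.
Proof.
move=> pp p5 pn ih; have := ndvdz_mul pp (half_range pp p5 ih) pn.
have pz : (p : int) != 0 by lia.
have := ltz_mod (i%:Z * n) pz; have := modz_ge0 (i%:Z * n) pz => h1 h2 h3.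
have : (i%:Z * n %% p)%Z != 0 by apply: contra h3 => /eqP/dvdz_mod0P.
lia.
Qed.

Lemma cusp_unit_neq0 p a (n : int) x : prime p -> (5 <= p)%N -> ~~ (p %| n)%Z ->
  cabs x < 1 -> cusp_unit p a n x != 0.
Proof.
move=> pp p5 pn x1; have p0 := prime_gt0 pp.
rewrite /cusp_unit mulf_neq0 ?expfz_neq0 ?qpp_neq0 //.
rewrite prodf_seq_neq0; apply/allP => i ih; apply/implyP => _.
have /andP[r0 rp] := residue_range pp p5 pn ih.
by rewrite expfz_neq0 // mulf_neq0 // qpoch_pow1_neq0 // subn_gt0.
Qed.

Lemma derivable_cusp_unit p a (n : int) x : prime p -> (5 <= p)%N -> ~~ (p %| n)%Z ->
  cabs x < 1 -> derivable (cusp_unit p a n) x 1.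
Proof.
move=> pp p5 pn x1; have p0 := prime_gt0 pp.
apply: derivable_mul.
  by apply: derivable_exprz; [exact: qpp_neq0|exact: derivable_qpoch1].
apply: derivable_prod => i ih; have /andP[r0 rp] := residue_range pp p5 pn ih.
apply: derivable_exprz.
  by rewrite mulf_neq0 // qpoch_pow1_neq0 // subn_gt0.
by apply: derivable_mul; exact: derivable_qpoch1.
Qed.

Lemma cabs_ec_frac (j : int) p : cabs (ec (j%:~R / p%:R : Cplx R)) = 1.
Proof.
have -> : (j%:~R / p%:R : Cplx R) = (j%:~R / p%:R : R)%:C%C.
  by rewrite fmorph_div /= intr_complexE natr_complexE.
by rewrite cabs_ec /= mulr0 oppr0 expR0.
Qed.

Lemma zero_cusp_unit_neq0 p a (n : int) x : cabs x < 1 -> zero_cusp_unit p a n x != 0.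
Proof.
move=> x1; rewrite /zero_cusp_unit mulf_neq0 ?expfz_neq0 ?qpochqq_neq0 //.
rewrite prodf_seq_neq0; apply/allP => i ih; apply/implyP => _.
rewrite expfz_neq0 // mulf_neq0 //.
  have := @qpoch_pow_neq0 (ec (- ((i%:Z * n)%:~R / p%:R))) x 1 1; apply => //.
  by rewrite ecN cabsV cabs_ec_frac invr1.
have := @qpoch_pow_neq0 (ec ((i%:Z * n)%:~R / p%:R)) x 1 1; apply => //.
by rewrite cabs_ec_frac.
Qed.

Lemma derivable_zero_cusp_unit p a (n : int) x : cabs x < 1 ->
  derivable (zero_cusp_unit p a n) x 1.
Proof.
move=> x1; apply: derivable_mul.
  by apply: derivable_exprz; [exact: qpochqq_neq0|exact: (derivable_qpoch1 (r := 1) (b := 1) isT x1)].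
apply: derivable_prod => i ih; apply: derivable_exprz.
  apply: mulf_neq0.
    have := @qpoch_pow_neq0 (ec (- ((i%:Z * n)%:~R / p%:R))) x 1 1; apply => //.
    by rewrite ecN cabsV cabs_ec_frac invr1.
  have := @qpoch_pow_neq0 (ec ((i%:Z * n)%:~R / p%:R)) x 1 1; apply => //.
  by rewrite cabs_ec_frac.
apply: derivable_mul.
  exact: (derivable_qpoch (r := 1) (b := 1) (c := ec (- ((i%:Z * n)%:~R / p%:R))) isT x1).
exact: (derivable_qpoch (r := 1) (b := 1) (c := ec ((i%:Z * n)%:~R / p%:R)) isT x1).
Qed.

End Transformations.

(** * Holomorphy at a cusp and the sign of the order *)

Section Cusps.
Context {R : realType}.
Implicit Types (x y z u v w t q s c : Cplx R) (f B F : Cplx R -> Cplx R).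

Lemma unit_disc_cabs s : unit_disc s <-> cabs s < 1.
Proof. by rewrite /unit_disc /= -[1]/(1%:C%C) normr_lt_cabs. Qed.

Lemma cexp_ec t (h : nat) : cexp (twopii R * t / h%:R) = ec (t / h%:R).
Proof. by rewrite /ec mulrA. Qed.

Lemma er_numden (lam : rat) t : er lam t = ec ((numq lam)%:~R * t / (denq lam)%:~R).
Proof. by rewrite /er /ratr; congr ec; ring. Qed.

Lemma holomorphic_at_infty_of f c (lam : rat) (M : nat) B : (0 < M)%N -> 0 <= lam ->
  (forall x, cabs x < 1 -> derivable B x 1) ->
  (forall t, upper_half_plane t -> f t = c * er lam t * B (ec (t / M%:R))) ->
  holomorphic_at_infty f.
Proof.
move=> M0 lam0 dB fE.
have MC : M%:R != 0 :> Cplx R by rewrite pnatr_eq0 -lt0n.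
have [n nE] : exists n : nat, numq lam = n%:Z.
  by exists (absz (numq lam)); rewrite gez0_abs // numq_ge0.
have [d dE] : exists d : nat, denq lam = d%:Z.
  by exists (absz (denq lam)); rewrite gez0_abs // ltW // denq_gt0.
have d0 : (0 < d)%N by have := denq_gt0 lam; rewrite dE.
have dC : d%:R != 0 :> Cplx R by rewrite pnatr_eq0 -lt0n.
(* In s = e^{2 pi i t / (M d)} both q^lam = s^(M n) and e^{2 pi i t / M} = s^d are nonnegative
   integral powers. *)
exists (M * d)%N; first by rewrite muln_gt0 M0.
exists (fun s => c * (s ^+ (M * n) * B (s ^+ d))).
  move=> s /unit_disc_cabs s1; apply: derivable_constM; apply: derivable_mul.
    exact: derivableX_id.
  have sd : cabs (s ^+ d) < 1 by rewrite cabsX exprn_ilt1 ?cabs_ge0 // -lt0n.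
  exact: (derivable_comp (derivableX_id d s) (dB _ sd)).
move=> t ht; rewrite fE // cexp_ec -!ecMn er_numden nE dE -mulrA.
have -> : n%:Z%:~R * t / d%:Z%:~R = (M * n)%:R * (t / (M * d)%:R) :> Cplx R.
  by rewrite !natrM; have -> : n%:Z%:~R = n%:R :> Cplx R by []; field; rewrite MC dC.
by have -> : d%:R * (t / (M * d)%:R) = t / M%:R :> Cplx R by rewrite natrM; field; rewrite MC dC.
Qed.

Lemma derivable_lipschitz f x : derivable f x 1 -> exists L d : R,
  [/\ 0 < L, 0 < d & forall h : Cplx R, cabs h < d -> cabs (f (x + h) - f x) <= L * cabs h].
Proof.
move=> /derivable_slopeP[l /(_ 1 ltr01)[d d0 H]].
exists (cabs l + 1), d; split => // [|h hd]; first by have := cabs_ge0 l; lra.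
have [->|h0] := eqVneq h 0; first by rewrite addr0 subrr cabs0 mulr0.
have hp : 0 < cabs h by rewrite cabs_gt0.
have -> : f (x + h) - f x = (h^-1 * (f (x + h) - f x) - l + l) * h by field.
rewrite cabsM ler_pM2r //; apply: le_trans (cabsD _ _) _; rewrite addrC lerD2l ltW //.
exact: H.
Qed.

(** Along t = i y the extension F stays bounded and B stays away from 0, whereas q^lam would grow
    exponentially for negative lam. *)
Lemma order_at_infty_ge0 f c (lam : rat) (M : nat) B : holomorphic_at_infty f -> c != 0 ->
  (0 < M)%N -> derivable B 0 1 -> B 0 != 0 ->
  (forall t, upper_half_plane t -> f t = c * er lam t * B (ec (t / M%:R))) -> 0 <= lam.
Proof.
move=> [h h0 [F dF fF]] c0 M0 dB B0 fE; rewrite leNgt; apply/negP => lam0.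
have dF0 : derivable F 0 1 by apply: dF; apply/unit_disc_cabs; rewrite cabs0.
have [L1 [d1 [L10 d10 H1]]] := derivable_lipschitz dF0.
have [L2 [d2 [L20 d20 H2]]] := derivable_lipschitz dB.
pose K := cabs (F 0) + L1 * d1.
have K0 : 0 < K by rewrite /K ltr_wpDl ?cabs_ge0 // mulr_gt0.
pose e := Num.min d2 (cabs (B 0) / (2 * L2)).
have bp : 0 < cabs (B 0) by rewrite cabs_gt0.
have e0 : 0 < e by rewrite /e lt_min d20 divr_gt0 // mulr_gt0.
have e2 : e <= d2 by rewrite /e ge_min lexx.
have eB : e * L2 <= cabs (B 0) / 2.
  have : e <= cabs (B 0) / (2 * L2) by rewrite /e ge_min lexx orbT.
  by rewrite ler_pdivlMr ?mulr_gt0 //; lra.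
clearbody e; have cp : 0 < cabs c by rewrite cabs_gt0.
have pip : 0 < pi :> R by exact: pi_gt0.
have hp : (0 : R) < h%:R by rewrite ltr0n.
have Mp : (0 : R) < M%:R by rewrite ltr0n.
pose mu : R := - ratr lam; have mu0 : 0 < mu by rewrite /mu oppr_gt0 ltrq0.
(* The summands bring e^{2 pi i t/h} within d1 of 0, bring e^{2 pi i t/M} within e of 0, and make
   |f| exceed K. Since e^z >= 1 + z, linear terms are enough. *)
pose y : R := h%:R / d1 + M%:R / e + 2 * K / (cabs c * cabs (B 0) * mu).
have y1 : 0 < h%:R / d1 by rewrite divr_gt0.
have y2 : 0 < M%:R / e by rewrite divr_gt0.
have y3 : 0 < 2 * K / (cabs c * cabs (B 0) * mu) by rewrite divr_gt0 ?mulr_gt0.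
have y0 : 0 < y by rewrite /y !addr_gt0.
have pi2 : pi *+ 2 = 2 * pi :> R by rewrite mulr_natl.
have pi1 : 1 <= 2 * pi :> R by have := pi_ge2 R; lra.
pose t : Cplx R := (0 +i* y)%C.
have ht : upper_half_plane t by [].
have small (n : nat) (d : R) : (0 < n)%N -> 0 < d -> n%:R / d <= y -> cabs (ec (t / n%:R)) < d.
  move=> n0 dp dy; have np : (0 : R) < n%:R by rewrite ltr0n.
  have -> : t / n%:R = (0 +i* (y / n%:R))%C.
    rewrite natr_complexE -fmorphV /=; apply/eqP; rewrite eq_complex /= !mulr0 !mul0r subr0 add0r eqxx.
    by rewrite eqxx.
  rewrite cabs_ec /= pi2; set z := 2 * pi * (y / n%:R).
  have zd : d^-1 <= z.
    apply: le_trans (_ : y / n%:R <= _); last by rewrite /z ler_peMl // divr_ge0 // ltW.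
    by rewrite ler_pdivlMr // mulrC.
  rewrite expRN -[ltRHS]invrK ltf_pV2 ?posrE ?expR_gt0 ?invr_gt0 //.
  by apply: le_lt_trans zd _; have := expR_ge1Dx z; lra.
have s1 : cabs (ec (t / h%:R)) < d1.
  by apply: small => //; rewrite /y; lra.
have s2 : cabs (ec (t / M%:R)) < e.
  by apply: small => //; rewrite /y; lra.
have up : cabs (f t) <= K.
  rewrite fF // cexp_ec; have := H1 _ s1; rewrite add0r => hF.
  have -> : F (ec (t / h%:R)) = (F (ec (t / h%:R)) - F 0) + F 0 by ring.
  apply: le_trans (cabsD _ _) _; rewrite /K addrC lerD2l; apply: le_trans hF _.
  by rewrite ler_pM2l // ltW.
have lowB : cabs (B 0) / 2 <= cabs (B (ec (t / M%:R))).
  have := H2 _ (lt_le_trans s2 e2); rewrite add0r => hB.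
  have h3 := cabs_sub (B 0) (B (ec (t / M%:R))); rewrite cabsC in h3.
  have : L2 * cabs (ec (t / M%:R)) <= L2 * e by rewrite ler_pM2l // ltW.
  lra.
have low : 1 + 2 * pi * (mu * y) <= cabs (er lam t).
  rewrite /er; have -> : ratr lam * t = (0 +i* (- (mu * y)))%C.
    have -> : (ratr lam : Cplx R) = (ratr lam : R)%:C%C.
      exact/esym/(fmorph_rat (real_complex R)).
    by apply/eqP; rewrite eq_complex /= /mu !mulr0 !mul0r subr0 addr0 mulNr opprK !eqxx.
  by rewrite cabs_ec /= pi2 mulrN opprK; exact: expR_ge1Dx.
have my : 2 * K / (cabs c * cabs (B 0)) <= mu * y.
  have : 2 * K / (cabs c * cabs (B 0) * mu) <= y by rewrite /y; lra.
  rewrite ler_pdivrMr ?mulr_gt0 // => hh.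
  by rewrite ler_pdivrMr ?mulr_gt0 //; lra.
have : K < cabs (f t).
  rewrite fE // !cabsM.
  have h1 : 2 * K / (cabs c * cabs (B 0)) < cabs (er lam t).
    have : mu * y <= 2 * pi * (mu * y) by rewrite ler_peMl // mulr_ge0 // ltW.
    lra.
  apply: lt_le_trans (_ : cabs c * cabs (er lam t) * (cabs (B 0) / 2) <= _).
    have -> : K = cabs c * (2 * K / (cabs c * cabs (B 0))) * (cabs (B 0) / 2).
      by field; rewrite !gt_eqF.
    by rewrite ltr_pM2r ?divr_gt0 // ltr_pM2l.
  by rewrite ler_wpM2l // mulr_ge0 ?cabs_ge0.
by rewrite ltNge up.
Qed.

(** Used at the identity matrix: holomorphy on the upper half plane follows from the condition at
    infinity. *)
Lemma holomorphic_at_infty_on f : holomorphic_at_infty f ->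
  holomorphic_on (@upper_half_plane R) f.
Proof.
move=> [h h0 [F dF fF]] t ht.
have e1 : cabs (ec (t / h%:R)) < 1 by apply: cabs_ec_lt1; exact: upper_natV.
pose g (w : Cplx R) := cexp (twopii R / h%:R * w).
have gE w : g w = ec (w / h%:R) by rewrite /g /ec; congr cexp; ring.
have dg : derivable g t 1.
  have h1 := derivable_mulr_const (twopii R / h%:R) t.
  have h2 : derivable (@cexp R) (twopii R / h%:R * t) 1.
    exact: (@ex_derive _ _ _ _ _ _ _ (is_derive_cexp _)).
  exact: (derivable_comp h1 h2).
have dF' : derivable F (g t) 1 by apply: dF; apply/unit_disc_cabs; rewrite gE.
have dFg := derivable_comp dg dF'.
have nE : {near t, F \o g =1 f}.
  (* [ht] serves as positivity of the radius Im t; the disc of that radius stays in the upper half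
     plane. *)
  apply: (nbhsC_cabs ht) => w wt; rewrite /= gE -cexp_ec -fF //.
  rewrite /upper_half_plane /=; have := Im_le_cabs (w - t).
  move: ht wt; rewrite /upper_half_plane /=; case: (w) (t) => a b [a' b'] /= h1 h2 h3.
  have := ler_norm (- (b - b')); rewrite normrN; lra.
exact: near_eq_derivable nE dFg.
Qed.

End Cusps.

(** * Residues modulo p and the generator alpha *)

Section Arithmetic.
Implicit Types (p : nat) (a : nat -> int).

Lemma frac_sum_residue p a (n : int) : prime p ->
  frac_sum p a n = p%:R / 2 * \sum_(1 <= i < (p.-1)./2.+1)
    ((i%:Z * n %% p)%Z%:~R / p%:R * (1 - (i%:Z * n %% p)%Z%:~R / p%:R) * (a i)%:~R).
Proof.
move=> pp; congr (_ * _); apply: eq_bigr => i _ /=.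
by rewrite -frac_part_divz ?prime_gt0 // intrM.
Qed.

Lemma frac_sum_mod p a (n n' : int) : prime p -> (n = n' %[mod p])%Z ->
  frac_sum p a n = frac_sum p a n'.
Proof.
move=> pp nn; rewrite !frac_sum_residue //; congr (_ * _); apply: eq_bigr => i _.
by rewrite -(modzMmr _ n) nn modzMmr.
Qed.

(** Replacing r by p - r turns x into 1 - x, which leaves x (1 - x) unchanged; this is why a
    generator modulo sign suffices. *)
Lemma frac_sumN p a (n : int) : prime p -> (5 <= p)%N -> ~~ (p %| n)%Z ->
  frac_sum p a (- n) = frac_sum p a n.
Proof.
move=> pp p5 pn; have pz : (p : int) != 0 by have := prime_gt0 pp; lia.
have pC : p%:R != 0 :> rat by rewrite pnatr_eq0 -lt0n prime_gt0.
rewrite !frac_sum_residue //; congr (_ * _); apply: eq_big_seq => i ih.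
have pin := ndvdz_mul pp (half_range pp p5 ih) pn.
have -> : (i%:Z * - n %% p)%Z = p%:Z - (i%:Z * n %% p)%Z.
  have h1 := ltz_mod (i%:Z * n) pz; have h2 := modz_ge0 (i%:Z * n) pz.
  have h3 : (i%:Z * n %% p)%Z != 0 by apply: contra pin => /eqP/dvdz_mod0P.
  have E := divz_eq (i%:Z * n) p; move: E h1 h2 h3.
  set r := (i%:Z * n %% p)%Z; set k := (i%:Z * n %/ p)%Z => E h1 h2 h3.
  have -> : i%:Z * - n = (- k - 1) * p%:Z + (p%:Z - r) by rewrite mulrN E; ring.
  by rewrite modzMDl modz_small //; lia.
move: (i%:Z * n %% p)%Z => r; rewrite rmorphB /=.
have -> : (p%:Z%:~R : rat) = p%:R by [].
by congr (_ * _); field.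
Qed.

Lemma intr_Zp_eq0 p (x : int) : (1 < p)%N -> (x%:~R == 0 :> 'Z_p) = (p %| x)%Z.
Proof.
move=> p1; have H (n : nat) : (n%:R == 0 :> 'Z_p) = (p %| n)%N.
  apply/eqP/idP => [h|/dvdnP[k ->]]; last by rewrite natrM pchar_Zp // mulr0.
  have := congr1 val h; rewrite /= val_Zp_nat // => /eqP.
  by rewrite /dvdn.
rewrite dvdzE absz_nat; case: x => n; first exact: H.
by rewrite NegzE abszN absz_nat mulrNz oppr_eq0; exact: H.
Qed.

Lemma intr_unit_Zp p (x : int) : prime p -> (x%:~R \is a (@GRing.unit 'Z_p)) = ~~ (p %| x)%Z.
Proof.
move=> pp; have p1 := prime_gt1 pp.
have H (n : nat) : (n%:R \is a (@GRing.unit 'Z_p)) = ~~ (p %| n)%N.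
  by rewrite unitZpE // prime_coprime.
rewrite dvdzE absz_nat; case: x => n; first exact: H.
by rewrite NegzE abszN absz_nat mulrNz unitrN; exact: H.
Qed.

Lemma generator_powers_ndvd p (alpha : int) (m : nat) : prime p ->
  generates_units_mod_sign p alpha -> ~~ (p %| alpha ^+ m)%Z.
Proof.
move=> pp [u uE _]; have := valP u; rewrite uE intr_unit_Zp // => h.
rewrite dvdzE abszX absz_nat; apply: contra h; rewrite dvdzE absz_nat.
by case: m => [|m]; [rewrite expn0 dvdn1 => /eqP p1; rewrite p1 in pp|rewrite Euclid_dvdX //= => /andP[]].
Qed.

(** The quotient by the sign has (p - 1)/2 elements, so exponents may be taken up to (p - 3)/2;
    equality of cosets leaves a power of -1. *)
Lemma generator_covers p (alpha n : int) : prime p -> (5 <= p)%N ->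
  generates_units_mod_sign p alpha -> ~~ (p %| n)%Z ->
  exists2 m : nat, (m <= (p - 3)./2)%N &
    (n = alpha ^+ m %[mod p])%Z \/ (n = - alpha ^+ m %[mod p])%Z.
Proof.
move=> pp p5 [u uE gen] pn; have p1 := prime_gt1 pp.
have wU : (n%:~R : 'Z_p) \is a GRing.unit by rewrite intr_unit_Zp.
pose w : {unit 'Z_p} := FinRing.unit 'Z_p wU.
set s := FinRing.unit 'Z_p _ in gen; set sgn := <[s]>%G.
have abU : abelian (units_Zp p) by exact: units_Zp_abelian.
have inU (x : {unit 'Z_p}) : x \in units_Zp p by rewrite inE.
have nU (x : {unit 'Z_p}) : x \in 'N(sgn)%g.
  have sU : (sgn \subset units_Zp p)%g.
    by apply/fintype.subsetP => y _; exact: inU.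
  exact: (fintype.subsetP (sub_abelian_norm abU sU)) (inU x).
have s2 : #[s]%g = 2.
  apply/eqP; rewrite eqn_leq; apply/andP; split.
    apply: dvdn_leq => //; rewrite order_dvdn; apply/eqP/val_inj => /=.
    by rewrite -expr2 sqrrN expr1n.
  rewrite ltn_neqAle order_gt0 andbT eq_sym order_eq1; apply/eqP => /(congr1 val) /= h.
  have : ((2 : int)%:~R == 0 :> 'Z_p).
    by rewrite -[2]/(1 + 1) intrD -{1}(opprK 1) h addNr.
  rewrite intr_Zp_eq0 // dvdzE !absz_nat => /dvdn_leq; lia.
have cardq : #|(units_Zp p / sgn)%g| = (p.-1)./2%N.
  have nsub : fingroup.normal sgn (units_Zp p).
    by apply/andP; split; apply/fintype.subsetP => x _; [exact: inU|exact: nU].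
  rewrite -divg_normal // card_units_Zp ?prime_gt0 // totient_prime // -divn2.
  by congr (_ %/ _)%N; exact: s2.
have wq : coset sgn w \in (units_Zp p / sgn)%g by apply: mem_quotient.
move: (wq); rewrite gen => /cycleP[k0 hk0].
pose m := (k0 %% #[coset sgn u]%g)%N.
have hk : coset sgn w = (coset sgn u ^+ m)%g by rewrite hk0 /m expg_mod_order.
exists m.
  have : (m < #[coset sgn u]%g)%N by rewrite ltn_mod order_gt0.
  rewrite orderE -gen cardq; lia.
have [|||z /cycleP[j ->] wE] := kercoset_rcoset (H := sgn) (x := w) (y := (u ^+ m)%g).
- exact: nU.
- exact: nU.
- by rewrite hk morphX.
have nE : n%:~R = (-1) ^+ j * alpha%:~R ^+ m :> 'Z_p.
  by have := congr1 val wE; rewrite FinRing.val_unitM !FinRing.val_unitX uE.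
have eqE (x y : int) : x%:~R = y%:~R :> 'Z_p -> (x = y %[mod p])%Z.
  move=> /eqP; rewrite -subr_eq0 -intrB intr_Zp_eq0 // => h; apply/eqP.
  by rewrite eqz_mod_dvd.
move: nE; rewrite -signr_odd; case: (odd j) => nE; [right|left]; apply: eqE; rewrite nE.
  by rewrite expr1 mulN1r mulrNz rmorphXn.
by rewrite expr0 mul1r rmorphXn.
Qed.

End Arithmetic.

(** * The weight operator on the eta product *)

Section Slash.
Context {R : realType}.
Implicit Types (x y z u v w t q s : Cplx R) (p r : nat) (a : nat -> int).

Lemma SL2Z_det (g : 'M[int]_2) : SL2Z g <-> g 0 0 * g 1 1 - g 0 1 * g 1 0 = 1.
Proof.
rewrite /SL2Z /= (expand_det_row _ 0) !big_ord_recl big_ord0 /cofactor !det_mx11 !mxE /=.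
have l0 : lift (0 : 'I_2) (0 : 'I_1) = 1 by apply/val_inj.
have l1 : lift (lift (0 : 'I_2) (0 : 'I_1)) (0 : 'I_1) = 0 by apply/val_inj.
by rewrite l1 l0 /= !mulN1r !mul1r addr0 mulrN.
Qed.

Definition mx2 (a b c d : int) : 'M[int]_2 :=
  \matrix_(i, j) if i == 0 then (if j == 0 then a else b) else (if j == 0 then c else d).

Lemma slashE (k : int) (g : 'M[int]_2) (f : Cplx R -> Cplx R) t :
  slash k g f t = den (g 1 0) (g 1 1) t ^ (- k) * f (mob (g 0 0) (g 0 1) (g 1 0) (g 1 1) t).
Proof. by []. Qed.

Lemma slash_mx2 (k a b c d : int) (f : Cplx R -> Cplx R) t :
  slash k (mx2 a b c d) f t = den c d t ^ (- k) * f (mob a b c d t).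
Proof. by rewrite slashE !mxE. Qed.

Lemma SL2Z_mx2 (a b c d : int) : a * d - b * c = 1 -> SL2Z (mx2 a b c d).
Proof. by move=> h; apply/SL2Z_det; rewrite !mxE. Qed.

Lemma ndvd1 p : prime p -> ~~ (p %| 1)%Z.
Proof. by move=> pp; rewrite dvdz1 absz_nat neq_ltn prime_gt1 ?orbT. Qed.

Lemma det_ndvd p (A B C D : int) : prime p -> A * D - B * (p%:Z * C) = 1 -> ~~ (p %| A)%Z.
Proof.
move=> pp h; apply/negP => pA; move/negP: (ndvd1 pp); apply.
have : (p %| A * D - B * (p%:Z * C))%Z.
  apply: rpredB; first exact: dvdz_mulr.
  by rewrite dvdz_mull // dvdz_mulr // dvdzz.
by rewrite h.
Qed.

Lemma bezout_prime p (n : int) : prime p -> ~~ (p %| n)%Z -> exists u v : int, u * n + v * p%:Z = 1.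
Proof.
move=> pp pn; have [u [v E]] := Bezoutz n p; exists u, v; rewrite E.
have : coprimez n p by rewrite coprimezE absz_nat coprime_sym prime_coprime // -dvdzE.
by rewrite /coprimez => /eqP.
Qed.

Lemma kap_product_eta_product p a : prime p -> (5 <= p)%N -> (2 %| a 0%N)%Z ->
  exists2 c : Cplx R, c != 0 & forall t, upper_half_plane t ->
  kap_product p a 1 t = c * eta_product p a t.
Proof.
move=> pp p5 a0; have [c c0 H] := kap_product_expansion (R := R) pp p5 a0 (ndvd1 pp).
exists c; first exact: c0.
by move=> t ht; rewrite (H t ht) (eta_product_expansion a t pp p5) mulrA.
Qed.

Lemma slash_infty_cusp p a (A B C D : int) : prime p -> (5 <= p)%N -> (2 %| a 0%N)%Z ->
  A * D - B * (p%:Z * C) = 1 ->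
  exists2 c : Cplx R, c != 0 & forall t, upper_half_plane t ->
  den (p%:Z * C) D t ^ (- weight a) * eta_product p a (mob A B (p%:Z * C) D t) =
  c * kap_product p a A t.
Proof.
move=> pp p5 a0 h; have p0 := prime_gt0 pp.
have [c1 c10 H1] := kap_product_eta_product pp p5 a0.
have [chi chi12 H2] := kap_product_modular (R := R) a p0 h.
have chi0 : chi != 0.
  by apply/eqP => chi0; move/eqP: chi12; rewrite chi0 expr0n /= eq_sym oner_eq0.
pose E : Cplx R := \prod_(1 <= i < (p.-1)./2.+1)
      (ec (i%:R ^+ 2 * A%:~R * B%:~R / (2 * p%:R)) * (-1) ^ (i%:Z * B)) ^ a i.
have E0 : E != 0.
  rewrite prodf_seq_neq0; apply/allP => i _; apply/implyP => _.
  by rewrite expfz_neq0 // mulf_neq0 ?ec_neq0 // expfz_neq0 // oppr_eq0 oner_neq0.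
exists (c1^-1 * chi ^ wt p a * E) => [|t ht].
  by rewrite !mulf_neq0 ?invr_eq0 ?expfz_neq0.
have d0 := den_neq0 h ht; have hm := upper_mob h ht.
have H3 := H2 t ht; rewrite (H1 _ hm) -/E in H3.
have -> : eta_product p a (mob A B (p%:Z * C) D t) =
    c1^-1 * (c1 * eta_product p a (mob A B (p%:Z * C) D t)) by rewrite mulKf.
rewrite H3 -invr_expz; have dW0 : den (p%:Z * C) D t ^ weight a != 0 by rewrite expfz_neq0.
move: (den _ _ _ ^ _) dW0 (chi ^ _) E {E0 H2 H3} (kap_product _ _ _ _) => d dW0 X E K.
transitivity (d^-1 * d * (c1^-1 * X * E * K)); first by ring.
by rewrite mulVf // mul1r.
Qed.

(** C is invertible modulo p, so D - j C is divisible by p for j = D u with u C = 1 mod p. The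
    matrix is then one with lower left entry divisible by p, times S and the translation by j. *)
Lemma slash_zero_cusp p a (A B C D : int) : prime p -> (5 <= p)%N -> (2 %| a 0%N)%Z ->
  A * D - B * C = 1 -> ~~ (p %| C)%Z ->
  exists2 c : Cplx R, c != 0 & exists2 n : int, ~~ (p %| n)%Z & exists j : int,
  forall t, upper_half_plane t ->
  den C D t ^ (- weight a) * eta_product p a (mob A B C D t) = c * zero_cusp p a n (t + j%:~R).
Proof.
move=> pp p5 a0 h pC; have p0 := prime_gt0 pp.
have [u [v uv]] := bezout_prime pp pC.
pose j := D * u; pose B' := B - j * A; pose D' := D - j * C.
have DE : - D' = p%:Z * (- (D * v)).
  rewrite /D' /j; have -> : D = D * (u * C + v * p%:Z) by rewrite uv mulr1.
  rewrite {3}uv; transitivity (D * u * C - D * (u * C + v * p%:Z)); last by ring.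
  by rewrite uv; ring.
have h' : (- B') * C - A * (p%:Z * (- (D * v))) = 1 by rewrite -DE /B' /D' -h; ring.
have [c c0 H1] := slash_infty_cusp pp p5 a0 h'.
have [c' c'0 H2] := kap_product_inversion (R := R) a (- B') p0.
exists (c * c'); first by rewrite mulf_neq0.
exists (- B'); first exact: det_ndvd pp h'.
exists j => t ht; have ht1 := upper_add1 j ht; have t0 := upper_neq0 ht1.
have dE : den C D t = (t + j%:~R) * den (- D') C (- (t + j%:~R)^-1).
  rewrite -denS // opprK -denT; congr den; rewrite /D'; ring.
have mE : mob A B C D t = mob (- B') A (- D') C (- (t + j%:~R)^-1).
  rewrite -mobS // !opprK -mobT; congr mob; rewrite /B' /D'; ring.
have H3 := H1 _ (upper_inv ht1); rewrite -DE in H3.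
rewrite dE mE expfzMl -[LHS]mulrA H3 (H2 _ ht1) -invr_expz.
have tW : (t + j%:~R) ^ weight a != 0 by rewrite expfz_neq0.
move: ((t + j%:~R) ^ _) tW (zero_cusp _ _ _ _) => T T0 Z.
transitivity (T^-1 * T * (c * c' * Z)); first by ring.
by rewrite mulVf // mul1r.
Qed.

Lemma ec_half_int (n : int) : ec (n%:~R / 2) = (-1) ^ n :> Cplx R.
Proof. by rewrite -ec_half -ecMz; congr ec; ring. Qed.

Lemma int_parity (x : int) : (exists k, x = 2 * k) \/ (exists k, x = 2 * k + 1).
Proof.
have [h|h] : x = 2 * (x %/ 2)%Z \/ x = 2 * (x %/ 2)%Z + 1.
  have := divz_eq x 2; have := @ltz_mod x 2 isT; have := @modz_ge0 x 2 isT.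
  by move: (x %% 2)%Z (x %/ 2)%Z => r k; lia.
- by left; exists (x %/ 2)%Z.
by right; exists (x %/ 2)%Z.
Qed.

(** As 24 divides T, the multiplier of [eta2] disappears. The constants of [kap_modular] and the
    signs from i A = i + (i m) p combine to e^{2 pi i x}, with x an integer by the second
    condition. *)
Lemma gamma1_invariance p a (m B C D K : int) : prime p -> (5 <= p)%N -> (2 %| a 0%N)%Z ->
  (24 %| exponent_sum p a)%Z -> frac_sum p a 1 = K%:~R ->
  (1 + m * p%:Z) * D - B * (p%:Z * C) = 1 ->
  forall t, upper_half_plane t ->
  den (p%:Z * C) D t ^ (- weight a) * eta_product p a (mob (1 + m * p%:Z) B (p%:Z * C) D t) =
  eta_product p a t.
Proof.
move=> pp p5 a0 T24 fK h t ht; have p0 := prime_gt0 pp; set A := 1 + m * p%:Z in h *.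
have [c1 c10 H1] := kap_product_eta_product pp p5 a0.
have [chi chi12 H2] := kap_product_modular (R := R) a p0 h.
have chiw : chi ^ wt p a = 1.
  have : (12 %| wt p a)%Z.
    move: T24; rewrite exponent_sum_wt // => /dvdzP[k kE].
    by apply/dvdzP; exists k; lia.
  by move=> /dvdzP[k ->]; rewrite mulrC -exprz_exp [chi ^ 12]chi12 exp1rz.
have d0 := den_neq0 h ht; have hm := upper_mob h ht.
have := H2 t ht; rewrite (H1 _ hm) chiw mul1r.
set E := \prod_(_ <= _ < _) _.
have pQ : p%:R != 0 :> rat by rewrite pnatr_eq0 -lt0n.
have EK : E * kap_product p a A t = kap_product p a 1 t.
  rewrite /kap_product mulrCA; congr (_ * _).
  pose f i : rat := i%:R ^+ 2 * A%:~R * B%:~R / (2 * p%:R) + i%:R * (B + m)%:~R / 2.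
  transitivity ((\prod_(1 <= i < (p.-1)./2.+1) er (f i) (1 : Cplx R) ^ a i) *
      \prod_(1 <= i < (p.-1)./2.+1) kap p (i%:Z * 1) t ^ a i).
    rewrite -!big_split /=; apply: eq_bigr => i _.
    have iA : i%:Z * A = i%:Z * 1 + (i%:Z * m) * p%:Z by rewrite /A; ring.
    have fE : er (f i) (1 : Cplx R) = ec (i%:R ^+ 2 * A%:~R * B%:~R / (2 * p%:R)) *
        (-1) ^ (i%:Z * B) * (-1) ^ (i%:Z * m).
      rewrite -!ec_half_int -!ecD /er; congr ec; rewrite /f.
      rewrite rmorphD !rmorphM /= !fmorphV ?rmorphM ?rmorphXn /= !rmorph_nat !ratr_int.
      by rewrite ?intrM ?intrD; have -> : (i%:Z%:~R : Cplx R) = i%:R by []; ring.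
    have alg (x y z : Cplx R) (k : int) : (x * y) ^ k * z ^ k = x ^ k * (y * z) ^ k.
      by rewrite !expfzMl mulrA.
    rewrite fE iA (@kap_addpz R p (i%:Z * 1) (i%:Z * m) t p0 ht).
    by symmetry; exact: alg.
  rewrite prod_er.
  suff [N ->] : exists N : int, \sum_(1 <= i < (p.-1)./2.+1) f i * (a i)%:~R = N%:~R :> rat.
    by rewrite /er ratr_int mulr1 ec_int mul1r.
  pose Q := \sum_(1 <= i < (p.-1)./2.+1) i%:Z ^+ 2 * a i.
  pose L := \sum_(1 <= i < (p.-1)./2.+1) i%:Z * a i.
  have QE : Q%:~R = \sum_(1 <= i < (p.-1)./2.+1) i%:R ^+ 2 * (a i)%:~R :> rat.
    by rewrite /Q rmorph_sum /=; apply: eq_bigr => i _; rewrite intrM rmorphXn.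
  have LE : L%:~R = \sum_(1 <= i < (p.-1)./2.+1) i%:R * (a i)%:~R :> rat.
    by rewrite /L rmorph_sum /=; apply: eq_bigr => i _; rewrite intrM.
  (* Each i is already its own residue, and (p/2) (i/p) (1 - i/p) = i/2 - i^2/(2 p). *)
  have fE : frac_sum p a 1 = L%:~R / 2 - Q%:~R / (2 * p%:R).
    rewrite frac_sum_residue // QE LE !mulr_suml mulr_sumr -sumrB.
    apply: eq_big_seq => i ih; have /andP[i0 ip] := half_range pp p5 ih.
    have -> : (i%:Z * 1 %% p)%Z = i by rewrite mulr1 modz_small //; lia.
    by have -> : (i%:Z%:~R : rat) = i%:R by []; field.
  have SE : \sum_(1 <= i < (p.-1)./2.+1) f i * (a i)%:~R =
      A%:~R * B%:~R * (Q%:~R / (2 * p%:R)) + (B + m)%:~R * (L%:~R / 2).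
    rewrite QE LE !mulr_suml !mulr_sumr -big_split /=; apply: eq_bigr => i _.
    by rewrite /f; field.
  (* For even m the entry A is odd and B (A + 1) is even. For odd m the entry A is even, as p is
     odd, and the determinant then forces B to be odd. *)
  have [e eE] : exists e : int, A * B + B + m = 2 * e.
    have [p' pE] : exists p' : nat, p = (2 * p' + 1)%N.
      exists p./2; have := odd_prime_gt2; have /even_prime[] := pp; first lia.
      by move=> po; rewrite -[LHS]odd_double_half po -muln2; lia.
    have pE' : p%:Z = 2 * p'%:Z + 1 by rewrite pE PoszD PoszM.
    have [mm|mm] := int_parity m.
      case: mm => k mE; exists (B + k * (p%:Z * B + 1)); rewrite /A mE; ring.
    have [bb|bb] := int_parity B.
      case: mm bb => k mE [l lE]; exfalso.
      have AE : A = 2 * (1 + p'%:Z + 2 * k * p'%:Z + k) by rewrite /A mE pE'; ring.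
      move: h; rewrite AE lE.
      have -> : 2 * (1 + p'%:Z + 2 * k * p'%:Z + k) * D - 2 * l * (p%:Z * C) =
         2 * ((1 + p'%:Z + 2 * k * p'%:Z + k) * D - l * (p%:Z * C)) by ring.
      move: (_ - _) => X; lia.
    case: mm => k mE; have AE : A = 2 * (1 + p'%:Z + 2 * k * p'%:Z + k) by rewrite /A mE pE'; ring.
    case: bb => l lE; exists (B * (1 + p'%:Z + 2 * k * p'%:Z + k) + l + k + 1).
    by rewrite AE lE mE; ring.
  (* Substituting Q/(2 p) = L/2 - K in [SE] gives (A B + B + m) L/2 - A B K. *)
  exists (L * e - A * B * K).
  have QK : Q%:~R / (2 * p%:R) = L%:~R / 2 - K%:~R :> rat by rewrite -fK fE; ring.
  rewrite SE QK; have -> : (B + m)%:~R = 2 * e%:~R - A%:~R * B%:~R :> rat.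
    by rewrite -[2]/(2%:~R) -!intrM -intrB -eE; congr (_%:~R); ring.
  by rewrite intrB !intrM; field.
have alg (d X K' Y : Cplx R) : d != 0 -> c1 * X = E * d * K' -> E * K' = c1 * Y -> d^-1 * X = Y.
  move=> dn H4 H5; apply: (mulfI c10); rewrite -H5; transitivity (d^-1 * (c1 * X)); first by ring.
  by rewrite H4; transitivity (d^-1 * d * (E * K')); [ring|rewrite mulVf // mul1r].
have dW0 : den (p%:Z * C) D t ^ weight a != 0 by rewrite expfz_neq0.
move=> H3; rewrite -invr_expz; apply: (alg _ _ _ _ dW0 H3).
by rewrite EK H1.
Qed.

End Slash.

(** * The conditions at the cusps and the equivalence *)

Section Criterion.
Context {R : realType}.
Implicit Types (x y z u v w t q s : Cplx R) (p r : nat) (a : nat -> int).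

Lemma infty_cusp_form p a (n : int) (f : Cplx R -> Cplx R) (c : Cplx R) :
  prime p -> (5 <= p)%N -> (2 %| a 0%N)%Z -> ~~ (p %| n)%Z -> c != 0 ->
  (forall t, upper_half_plane t -> f t = c * kap_product p a n t) ->
  exists2 c' : Cplx R, c' != 0 & forall t, upper_half_plane t ->
    f t = c' * er (cusp_order p a n) t * cusp_unit p a n (ec (t / 1%:R)).
Proof.
move=> pp p5 a0 pn c0 fE; have [c1 c10 H] := kap_product_expansion (R := R) pp p5 a0 pn.
exists (c * c1) => [|t ht]; first exact: mulf_neq0.
by rewrite (fE t ht) (H t ht) divr1 !mulrA.
Qed.

Lemma zero_cusp_form p a (n j : int) (f : Cplx R -> Cplx R) (c : Cplx R) :
  prime p -> (5 <= p)%N -> (2 %| a 0%N)%Z -> ~~ (p %| n)%Z -> c != 0 ->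
  (forall t, upper_half_plane t -> f t = c * zero_cusp p a n (t + j%:~R)) ->
  exists2 c' : Cplx R, c' != 0 & forall t, upper_half_plane t ->
    f t = c' * er ((exponent_sum p a)%:~R / (24 * p%:R)) t *
      zero_cusp_unit p a n (ec (j%:~R / p%:R) * ec (t / p%:R)).
Proof.
move=> pp p5 a0 pn c0 fE; have [c1 c10 H] := zero_cusp_expansion (R := R) pp p5 a0 pn.
set lam := _%:~R / (24 * p%:R) in H *.
exists (c * c1 * er lam j%:~R) => [|t ht].
  by apply: mulf_neq0; [exact: mulf_neq0|exact: er_neq0].
rewrite (fE t ht) (H _ (upper_add1 j ht)) er_shift mulrDl ecD [ec (t / _) * _]mulrC.
by move: (zero_cusp_unit _ _ _ _) (er lam t) (er lam _) => Z e1 e2; ring.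
Qed.

Lemma holomorphic_infty_cusp p a (n : int) (f : Cplx R -> Cplx R) (c : Cplx R) :
  prime p -> (5 <= p)%N -> (2 %| a 0%N)%Z -> ~~ (p %| n)%Z -> c != 0 ->
  (forall t, upper_half_plane t -> f t = c * kap_product p a n t) ->
  holomorphic_at_infty f <-> 0 <= cusp_order p a n.
Proof.
move=> pp p5 a0 pn c0 /(infty_cusp_form pp p5 a0 pn c0)[c' c'0 fE]; split=> [hf|l0].
  apply: (order_at_infty_ge0 hf c'0 (isT : (0 < 1)%N) _ _ fE).
    by apply: derivable_cusp_unit => //; rewrite cabs0.
  by apply: cusp_unit_neq0 => //; rewrite cabs0.
apply: (holomorphic_at_infty_of (isT : (0 < 1)%N) l0 _ fE) => x x1.
exact: derivable_cusp_unit.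
Qed.

Lemma holomorphic_zero_cusp p a (n j : int) (f : Cplx R -> Cplx R) (c : Cplx R) :
  prime p -> (5 <= p)%N -> (2 %| a 0%N)%Z -> ~~ (p %| n)%Z -> c != 0 ->
  (forall t, upper_half_plane t -> f t = c * zero_cusp p a n (t + j%:~R)) ->
  holomorphic_at_infty f <-> 0 <= exponent_sum p a.
Proof.
move=> pp p5 a0 pn c0 /(zero_cusp_form pp p5 a0 pn c0)[c' c'0 fE].
have p0 := prime_gt0 pp; have z1 := cabs_ec_frac (R := R) j p.
have -> : (0 <= exponent_sum p a) = (0 <= (exponent_sum p a)%:~R / (24 * p%:R) :> rat).
  have q0 : 0 < (24 * p%:R : rat)^-1 by rewrite invr_gt0 mulr_gt0 // ltr0n.
  by rewrite (pmulr_lge0 _ q0) ler0z.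
(* Translation by j becomes a rotation of the unit disc. *)
pose U (s : Cplx R) := zero_cusp_unit p a n (ec (j%:~R / p%:R) * s).
have dU s : cabs s < 1 -> derivable U s 1.
  move=> s1; have zs1 : cabs (ec (j%:~R / p%:R) * s) < 1 by rewrite cabsM z1 mul1r.
  exact: (derivable_comp (derivable_mulr_const _ s) (derivable_zero_cusp_unit (a := a) (n := n) zs1)).
split=> [hf|l0].
  apply: (order_at_infty_ge0 (B := U) hf c'0 p0 _ _ fE).
    by apply: dU; rewrite cabs0.
  by rewrite /U mulr0 zero_cusp_unit_neq0 // cabs0.
exact: (holomorphic_at_infty_of (B := U) p0 l0 dU fE).
Qed.

Lemma slash1 (k : int) (f : Cplx R -> Cplx R) t : slash k (mx2 1 0 0 1) f t = f t.
Proof. by rewrite slash_mx2 mob1 den1 exp1rz mul1r. Qed.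

Lemma dvd_lower_left p (C : int) : (p %| C)%Z -> exists C', C = p%:Z * C'.
Proof. by case/dvdzP => C' ->; exists C'; rewrite mulrC. Qed.

Lemma modular_form_of_conditions p (alpha : int) a : prime p -> (5 <= p)%N ->
  generates_units_mod_sign p alpha -> (2 %| a 0%N)%Z ->
  0 <= exponent_sum p a -> (24 %| exponent_sum p a)%Z -> frac_sum p a 1 \is a Num.int ->
  (forall m : nat, (m <= (p - 3)./2)%N -> 0 <= cusp_order p a (alpha ^+ m)) ->
  @modular_forms R (a 0%N %/ 2)%Z (Gamma1 p) (@eta_product R p a).
Proof.
move=> pp p5 gen a0 T0 T24 /intrP[K fK] ord; have p0 := prime_gt0 pp.
(* The order depends on n only modulo p and sign, so the listed powers of alpha cover all cusps over
   infinity. *)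
have ord_all (n : int) : ~~ (p %| n)%Z -> 0 <= cusp_order p a n.
  move=> pn; have [m mp [nm|nm]] := generator_covers pp p5 gen pn.
    by rewrite /cusp_order (frac_sum_mod a pp nm); exact: ord.
  rewrite /cusp_order (frac_sum_mod a pp nm) frac_sumN //; first exact: ord.
  exact: generator_powers_ndvd gen.
have cusps (g : 'M[int]_2) : SL2Z g -> holomorphic_at_infty (slash (a 0%N %/ 2)%Z g (@eta_product R p a)).
  move=> /SL2Z_det; set A := g 0 0; set B := g 0 1; set C := g 1 0; set D := g 1 1 => h.
  have [pC|pC] := boolP (p %| C)%Z.
    have [C' CE] := dvd_lower_left pC; rewrite CE in h.
    have [c c0 H] := slash_infty_cusp (R := R) pp p5 a0 h.
    have pA := det_ndvd pp h.
    apply/(holomorphic_infty_cusp pp p5 a0 pA c0) => [t ht|]; last exact: ord_all.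
    by rewrite slashE -/A -/B -/C -/D CE; exact: H.
  have [c c0 [n pn [j H]]] := slash_zero_cusp (R := R) pp p5 a0 h pC.
  apply/(holomorphic_zero_cusp (j := j) pp p5 a0 pn c0) => [t ht|]; last exact: T0.
  by rewrite slashE; exact: H.
split=> //.
  have := cusps _ (SL2Z_mx2 (erefl : 1 * 1 - 0 * 0 = 1 :> int)).
  move=> /holomorphic_at_infty_on.
  have -> // : slash (a 0%N %/ 2)%Z (mx2 1 0 0 1) (@eta_product R p a) = @eta_product R p a.
  by apply/funext => t; exact: slash1.
move=> g [/SL2Z_det]; set A := g 0 0; set B := g 0 1; set C := g 1 0; set D := g 1 1.
move=> h A1 _ C0 t ht; rewrite slashE -/A -/B -/C -/D.
have [C' CE] : exists C', C = p%:Z * C'.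
  by apply: dvd_lower_left; apply/dvdz_mod0P; rewrite C0 mod0z.
have [m AE] : exists m, A = 1 + m * p%:Z.
  have : (p %| A - 1)%Z by rewrite -eqz_mod_dvd; apply/eqP.
  by case/dvdzP => m mE; exists m; rewrite -mE; ring.
rewrite CE AE in h *.
exact: (gamma1_invariance pp p5 a0 T24 fK h ht).
Qed.

Lemma conditions_of_modular_form p (alpha : int) a : prime p -> (5 <= p)%N ->
  generates_units_mod_sign p alpha -> (2 %| a 0%N)%Z ->
  @modular_forms R (a 0%N %/ 2)%Z (Gamma1 p) (@eta_product R p a) ->
  [/\ 0 <= exponent_sum p a, (24 %| exponent_sum p a)%Z, frac_sum p a 1 \is a Num.int &
    forall m : nat, 0 <= cusp_order p a (alpha ^+ m)].
Proof.
move=> pp p5 gen a0 [_ inv hol]; have p0 := prime_gt0 pp.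
have pC : p%:R != 0 :> Cplx R by rewrite pnatr_eq0 -lt0n.
have pQ : p%:R != 0 :> rat by rewrite pnatr_eq0 -lt0n.
have [c1 c10 H1] := kap_product_eta_product (R := R) pp p5 a0.
have [c3 c30 H3] := kap_product_inversion (R := R) a 1 p0.
have [c4 c40 H4] := zero_cusp_expansion (R := R) pp p5 a0 (ndvd1 pp).
(* One base point is enough for both integrality conditions: the nonzero unit factors cancel there,
   and e^{2 pi i x} = 1 forces x to be an integer. *)
pose t0 : Cplx R := (0 +i* 1)%C.
have ht0 : upper_half_plane t0 by rewrite /upper_half_plane /= ltr01.
have ratr_inj (x : rat) (n : int) : (ratr x : Cplx R) = n%:~R -> x = n%:~R.
  by rewrite -[RHS](ratr_int (Cplx R)) => /fmorph_inj.
have T0 : 0 <= exponent_sum p a.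
  have h : (0 : int) * 0 - (-1) * 1 = 1 by [].
  apply/(@holomorphic_zero_cusp p a 1 0 _ (c1^-1 * c3) pp p5 a0 (ndvd1 pp) _ _).1;
    last exact: (hol _ (SL2Z_mx2 h)).
    by rewrite mulf_neq0 ?invr_eq0.
  move=> t ht; have tn0 := upper_neq0 ht; rewrite slash_mx2 addr0.
  have -> : den 1 0 t = t by rewrite /den mul1r addr0.
  have -> : mob 0 (-1) 1 0 t = - t^-1 by rewrite /mob /den mul1r !addr0 mul0r add0r mulN1r.
  have := H3 t ht; rewrite (H1 _ (upper_inv ht)) => E.
  have -> : eta_product p a (- t^-1) = c1^-1 * (c1 * eta_product p a (- t^-1)) by rewrite mulKf.
  rewrite E -invr_expz; have tW : t ^ weight a != 0 by rewrite expfz_neq0.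
  rewrite -/(weight a); move: (t ^ _) tW (zero_cusp _ _ _ _) => d d0 Z.
  transitivity (d^-1 * d * (c1^-1 * c3 * Z)); first by ring.
  by rewrite mulVf // mul1r.
have T24 : (24 %| exponent_sum p a)%Z.
  have h : (1 : int) * 1 - 0 * (- p%:Z) = 1 by rewrite mul1r mul0r subr0.
  have gG : Gamma1 p (mx2 1 0 (- p%:Z) 1).
    split; rewrite ?mxE //=; first exact: SL2Z_mx2.
    by apply/eqP; rewrite eqz_mod_dvd subr0 dvdzE abszN.
  (* Conjugation by S turns (1 0; -p 1) into t |-> t + p. As [zero_cusp_unit] depends on e^{2 pi i t
     / p}, the factor q^{T/(24 p)} must itself have period p, so T/24 is an integer. *)
  have Zper : zero_cusp p a 1 (t0 + p%:Z%:~R) = zero_cusp p a 1 t0.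
    have ht1 := upper_add1 p%:Z ht0; have t0n := upper_neq0 ht0; have t1n := upper_neq0 ht1.
    have := inv _ gG _ (upper_inv ht0); rewrite slash_mx2.
    set t1 := t0 + _ in ht1 t1n *.
    have dE : den (- p%:Z) 1 (- t0^-1) = t1 / t0.
      by rewrite /den mulrNz /t1; have -> : (p%:Z%:~R : Cplx R) = p%:R by []; field.
    have -> : mob 1 0 (- p%:Z) 1 (- t0^-1) = - t1^-1.
      by rewrite /mob dE; field; rewrite t0n t1n.
    rewrite dE => E.
    have E0 := H3 _ ht0; have E1 := H3 _ ht1.
    rewrite (H1 _ (upper_inv ht0)) in E0; rewrite (H1 _ (upper_inv ht1)) in E1.
    have wE : (t1 / t0) ^ (- (a 0%N %/ 2)%Z) = (t1 ^ weight a)^-1 * t0 ^ weight a.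
      by rewrite -invr_expz expfzMl exprz_inv -invr_expz invfM invrK.
    rewrite -E wE in E0; move: E0 E1.
    have d0 : t0 ^ weight a != 0 by rewrite expfz_neq0.
    have d1 : t1 ^ weight a != 0 by rewrite expfz_neq0.
    move: (t0 ^ _) (t1 ^ _) d0 d1 (eta_product _ _ _) (zero_cusp _ _ _ t0) (zero_cusp _ _ _ t1).
    move=> d0 d1 d00 d10 X Z0 Z1 E0 E1.
    have k0 : c3 * d1 != 0 by exact: mulf_neq0.
    apply: (mulfI k0); rewrite -E1.
    transitivity (d1 / d0 * (c3 * d0 * Z0)); last by field.
    by rewrite -E0; field; rewrite d00 d10.
  rewrite (H4 _ ht0) (H4 _ (upper_add1 p%:Z ht0)) in Zper; move: Zper.
  set lam := _%:~R / (24 * p%:R).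
  have -> : ec ((t0 + p%:Z%:~R) / p%:R) = ec (t0 / p%:R).
    have -> : (p%:Z%:~R : Cplx R) = p%:R by [].
    by rewrite mulrDl divff // ecD ec1 mulr1.
  have x1 : cabs (ec (t0 / p%:R)) < 1 by apply: cabs_ec_lt1; exact: upper_natV.
  have U0 := zero_cusp_unit_neq0 p a 1 x1.
  move=> /(mulIf U0)/(mulfI c40); rewrite er_shift -[RHS]mulr1 => /(mulfI (er_neq0 _ _)).
  rewrite /er => /ec_eq1[n]; rewrite /lam => E.
  apply/dvdzP; exists n.
  have := ratr_inj ((exponent_sum p a)%:~R / 24) n.
  have -> : ratr ((exponent_sum p a)%:~R / 24) = n%:~R :> Cplx R.
    rewrite -E; have -> : (p%:Z%:~R : Cplx R) = ratr p%:R by rewrite rmorph_nat.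
    by rewrite -rmorphM /=; congr ratr; field; rewrite pQ.
  move=> /(_ erefl) E'; apply/eqP; rewrite -(eqr_int rat) intrM -E'; apply/eqP.
  by have -> : (24%:~R : rat) = 24 by []; field.
(* Invariance under t |-> t + 1 makes the order p T/24 - [frac_sum p a 1] an integer, and T/24
   already is one. *)
have fK : frac_sum p a 1 \is a Num.int.
  have h : (1 : int) * 1 - 1 * 0 = 1 by [].
  have gG : Gamma1 p (mx2 1 1 0 1) by split; rewrite ?mxE //; exact: SL2Z_mx2.
  have := inv _ gG _ ht0; rewrite slash_mx2.
  have -> : den 0 1 t0 = 1 by exact: den1.
  have -> : mob 1 1 0 1 t0 = t0 + 1 by rewrite /mob den1 mul1r divr1.
  rewrite exp1rz mul1r !(eta_product_expansion _ _ pp p5) ecD ec1 mulr1.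
  have U0 := cusp_unit_neq0 a pp p5 (ndvd1 pp) (cabs_ec_lt1 ht0).
  move=> /(mulIf U0); rewrite er_shift -[RHS]mulr1 => /(mulfI (er_neq0 _ _)).
  rewrite /er mulr1 => /ec_eq1[n] /ratr_inj; rewrite /cusp_order.
  case/dvdzP: T24 => k -> E; apply/intrP; exists (p%:Z * k - n).
  rewrite intrB -E intrM intrM; have -> : (p%:Z%:~R : rat) = p%:R by [].
  by field.
split=> // m; have pA := generator_powers_ndvd m pp gen.
have [u [v uv]] := bezout_prime pp pA.
(* A matrix with left column (alpha^m, p): its upper left entry selects the cusp of order
   [cusp_order p a (alpha ^+ m)]. *)
have h : alpha ^+ m * u - (- v) * (p%:Z * 1) = 1 by rewrite -[RHS]uv; ring.
have [c c0 H] := slash_infty_cusp (R := R) pp p5 a0 h.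
apply/(holomorphic_infty_cusp pp p5 a0 pA c0); last exact: (hol _ (SL2Z_mx2 h)).
by move=> t ht; rewrite slash_mx2; exact: H.
Qed.

End Criterion.

Theorem lemma2p2 (R : realType) (p : nat) (alpha : int) (a : nat -> int)
    (hp : prime p) (hp5 : (5 <= p)%N)
    (halpha : generates_units_mod_sign p alpha)
    (ha0_pos : 0 < a 0%N) (ha0_even : (2 %| a 0%N)%Z) :
  @modular_forms R (a 0%N %/ 2)%Z (Gamma1 p) (@eta_product R p a) <->
  [/\ 0 <= exponent_sum p a /\ (exponent_sum p a = 0 %[mod 24])%Z,
      frac_sum p a 1 \is a Num.int
    & forall m : nat, (m <= (p - 3)./2)%N ->
        0 <= p%:R / 24 * (exponent_sum p a)%:~R - frac_sum p a (alpha ^+ m)].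
Proof.
split=> [hf|[[T0 T24] fK ord]].
  have [T0 T24 fK ord] := conditions_of_modular_form hp hp5 halpha ha0_even hf.
  split=> //; last by move=> m _; exact: ord.
  by split=> //; rewrite mod0z; apply/dvdz_mod0P.
apply: (modular_form_of_conditions hp hp5 halpha ha0_even T0 _ fK ord).
by apply/dvdz_mod0P; rewrite T24 mod0z.
Qed.
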